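(* Let $N\ge1$ be an integer, $\rho_1,\rho_2\ge1$, $\mu_1,\mu_2\in(0,1]$, and assume that $\mu_j=1$ and $\rho_j\ge2$ for a certain $j\in\{1,2\}$. Suppose that $\psi:[p_1,p_2]\to\mathbb{R}$ satisfies Assumption $(P_{\rho_1,\rho_2,N})$ and $U:(p_1,p_2)\to\mathbb{C}$ satisfies Assumption $(A_{\mu_1,\mu_2,N})$. With $\eta,\nu,s_l,k_l,\nu_l,\Lambda^{(l)}$ as in the context, for $l\in\{1,2\}$ and $\omega>0$ define $$A_N^{(l)}(\omega):=e^{i\omega\psi(p_l)}\sum_{n=0}^{N-1}\Theta^{(l)}_{n+1}(\rho_l,\mu_l)\,\frac{d^n}{ds^n}[k_l](0)\;\omega^{-\frac{n+\mu_l}{\rho_l}},$$ $$R_N^{(l)}(\omega):=(-1)^{N+1+l}e^{i\omega\psi(p_l)}\int_0^{s_l}\phi_N^{(l)}(s,\omega,\rho_l,\mu_l)\,\frac{d^N}{ds^N}[\nu_lk_l](s)\,ds,$$ where for $n=0,\dots,N-1$ $$\Theta^{(l)}_{n+1}(\rho_l,\mu_l):=\frac{(-1)^{l+1}}{n!\,\rho_l}\,\Gamma\!\left(\frac{n+\mu_l}{\rho_l}\right)e^{(-1)^{l+1}i\frac\pi2\frac{n+\mu_l}{\rho_l}},$$ $$\phi^{(l)}_{n+1}(s,\omega,\rho_l,\mu_l):=\frac{(-1)^{n+1}}{n!}\int_{\Lambda^{(l)}(s)}(z-s)^nz^{\mu_l-1}e^{(-1)^{l+1}i\omega z^{\rho_l}}\,dz.$$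 Then for all $\omega>0$, $$\int_{p_1}^{p_2}U(p)e^{i\omega\psi(p)}\,dp=\sum_{l=1,2}\left(A_N^{(l)}(\omega)+R_N^{(l)}(\omega)\right),$$ $$\left|R_N^{(l)}(\omega)\right|\le\frac1{(N-1)!}\,\frac1{\rho_l}\,\Gamma\!\left(\frac N{\rho_l}\right)\int_0^{s_l}s^{\mu_l-1}\left|\frac{d^N}{ds^N}[\nu_lk_l](s)\right|ds\;\omega^{-\frac N{\rho_l}}\qquad(l=1,2),$$ and moreover, for every $\gamma\in(0,1)$, with $\delta:=\frac{\gamma+N}{\rho_j}\in\left(\frac N{\rho_j},\frac{N+1}{\rho_j}\right)$, $$\left|R_N^{(j)}(\omega)\right|\le L_{\gamma,\rho_j,N}\int_0^{s_j}s^{-\gamma}\left|\frac{d^N}{ds^N}[\nu_jk_j](s)\right|ds\;\omega^{-\delta}.$$ Here $L_{\gamma,\rho,N}:=a\,K^\gamma$, where $K$ is the unique positive solution of $aK^\rho-bK-c=0$ with $$a:=\frac{\Gamma(N/\rho)}{(N-1)!\,\rho},\qquad c:=\frac{(\rho-1)\,\Gamma(N/\rho)}{\rho^2(N-1)!},\qquad b:=\begin{cases}\dfrac1\rho & N=1,\\[2mm]\dfrac{\Gamma((N-1)/\rho)}{\rho^2(N-2)!}& N\ge2.\end{cases}$$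
   Context: $p_1<p_2$ are finite real numbers. Complex powers are principal branches (on $\mathbb{C}\setminus(-\infty,0]$). Assumption $(P_{\rho_1,\rho_2,N})$ ($\rho_1,\rho_2\ge1$): $\psi\in\mathcal{C}^1([p_1,p_2],\mathbb{R})$ and there is a positive function $\tilde\psi\in\mathcal{C}^N([p_1,p_2],\mathbb{R})$ with $\psi'(p)=(p-p_1)^{\rho_1-1}(p_2-p)^{\rho_2-1}\tilde\psi(p)$ for all $p\in[p_1,p_2]$. Assumption $(A_{\mu_1,\mu_2,N})$ ($\mu_1,\mu_2\in(0,1]$): there is $\tilde u\in\mathcal{C}^N([p_1,p_2],\mathbb{C})$ with $U(p)=(p-p_1)^{\mu_1-1}(p_2-p)^{\mu_2-1}\tilde u(p)$ for $p\in(p_1,p_2)$, and $\tilde u(p_j)\ne0$ if $\mu_j\ne1$ ($j=1,2$). Fix $\eta\in(0,\frac{p_2-p_1}2)$. Put $\varphi_1(p):=(\psi(p)-\psi(p_1))^{1/\rho_1}$ on $I_1:=[p_1,p_2-\eta]$, $\varphi_2(p):=(\psi(p_2)-\psi(p))^{1/\rho_2}$ on $I_2:=[p_1+\eta,p_2]$, $s_1:=\varphi_1(p_2-\eta)$, $s_2:=\varphi_2(p_1+\eta)$. For $l=1,2$, $k_l(s):=U(\varphi_l^{-1}(s))\,s^{1-\mu_l}\,(\varphi_l^{-1})'(s)$ on $(0,s_l]$, which extends to a $\mathcal{C}^N$ function on $[0,s_l]$ (still denoted $k_l$). Let $\nu:[p_1,p_2]\to\mathbb{R}$ be smooth with $\nu=1$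 on $[p_1,p_1+\eta]$, $\nu=0$ on $[p_2-\eta,p_2]$, $0\le\nu\le1$; put $\nu_1:=\nu\circ\varphi_1^{-1}$ on $[0,s_1]$, $\nu_2:=(1-\nu)\circ\varphi_2^{-1}$ on $[0,s_2]$. For $s>0$, $\Lambda^{(l)}(s):=\{s+te^{(-1)^{l+1}i\frac\pi{2\rho_l}}\mid t\ge0\}$, oriented by increasing $t$. *)

(* Defs.v *)
From Stdlib Require Import Reals Factorial ClassicalEpsilon.
From Coquelicot Require Import Coquelicot.
Open Scope R_scope.

(* C = R * R carries several structures; this one has real scalars. *)
Notation CR := C_R_CompleteNormedModule.

(* Real power with 0^0 = 1 and 0^y = 0 otherwise; Rpower 0 y would be 1.
   Only used for x >= 0. *)
Definition rpow (x y : R) : R :=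
  if Req_EM_T x 0 then (if Req_EM_T y 0 then 1 else 0) else Rpower x y.

Definition Cexp (z : C) : C :=
  (exp (fst z) * cos (snd z), exp (fst z) * sin (snd z)).

(* Half-angle formula for the argument in (-PI, PI), valid off (-oo, 0]. *)
Definition Carg (z : C) : R := 2 * atan (snd z / (Cmod z + fst z)).

Definition Clog (z : C) : C := (ln (Cmod z), Carg z).

Definition Cpowr (z : C) (a : R) : C := Cexp (RtoC a * Clog z)%C.

Definition Gamma (x : R) : R :=
  RInt_gen (V := R_CompleteNormedModule)
    (fun t => rpow t (x - 1) * exp (- t)) (at_right 0) (Rbar_locally p_infty).

Definition Icc (a b : R) : R -> Prop := fun x => a <= x <= b.

(* Difference quotients inside [a, b], hence one-sided at a and b. *)
Definition is_derive_on {V : CompleteNormedModule R_AbsRing}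
    (a b : R) (f : R -> V) (x : R) (l : V) : Prop :=
  filterlim (fun y => scal (/ (y - x)) (minus (f y) (f x)))
    (within (Icc a b) (locally' x)) (locally l).

Fixpoint Ck_on {V : CompleteNormedModule R_AbsRing}
    (n : nat) (a b : R) (f : R -> V) : Prop :=
  match n with
  | O => continuous_on (Icc a b) f
  | S m => exists g : R -> V,
      (forall x, Icc a b x -> is_derive_on a b f x (g x)) /\ Ck_on m a b g
  end.

Definition Derive_on {V : CompleteNormedModule R_AbsRing}
    (a b : R) (f : R -> V) (x : R) : V := iota (is_derive_on a b f x).

Fixpoint Derive_on_n {V : CompleteNormedModule R_AbsRing}
    (n : nat) (a b : R) (f : R -> V) : R -> V :=
  match n with
  | O => f
  | S m => Derive_on a b (Derive_on_n m a b f)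
  end.

(* The preimage of s under f in [a, b], when there is one. *)
Definition inverse_on (a b : R) (f : R -> R) (s : R) : R :=
  epsilon (inhabits 0) (fun x => Icc a b x /\ f x = s).

Inductive endpoint : Set := Pt1 | Pt2.

Definition idx (l : endpoint) : nat := match l with Pt1 => 1 | Pt2 => 2 end.

Definition sgn (l : endpoint) : R := (-1) ^ (idx l + 1).

Definition assumption_P (p rho : endpoint -> R) (N : nat) (psi : R -> R)
  : Prop :=
  Ck_on (V := R_CompleteNormedModule) 1 (p Pt1) (p Pt2) psi /\
  exists psit : R -> R,
    Ck_on (V := R_CompleteNormedModule) N (p Pt1) (p Pt2) psit /\
    (forall x, Icc (p Pt1) (p Pt2) x -> 0 < psit x) /\
    forall x, Icc (p Pt1) (p Pt2) x ->
      is_derive_on (V := R_CompleteNormedModule) (p Pt1) (p Pt2) psi x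
        (rpow (x - p Pt1) (rho Pt1 - 1) * rpow (p Pt2 - x) (rho Pt2 - 1)
         * psit x).

Definition assumption_A (p mu : endpoint -> R) (N : nat) (U : R -> C) : Prop :=
  exists ut : R -> C,
    Ck_on (V := CR) N (p Pt1) (p Pt2) ut /\
    (forall x, p Pt1 < x < p Pt2 ->
      U x = (RtoC (rpow (x - p Pt1) (mu Pt1 - 1)
                   * rpow (p Pt2 - x) (mu Pt2 - 1))
             * ut x)%C) /\
    forall l, mu l <> 1 -> ut (p l) <> RtoC 0.

Section Expansion.
Variables (p rho mu : endpoint -> R) (psi : R -> R) (U : R -> C).
Variables (eta : R) (nu : R -> R).

Definition I_lo (l : endpoint) : R :=
  match l with Pt1 => p Pt1 | Pt2 => p Pt1 + eta end.

Definition I_hi (l : endpoint) : R :=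
  match l with Pt1 => p Pt2 - eta | Pt2 => p Pt2 end.

Definition phi (l : endpoint) (x : R) : R :=
  match l with
  | Pt1 => rpow (psi x - psi (p Pt1)) (/ rho Pt1)
  | Pt2 => rpow (psi (p Pt2) - psi x) (/ rho Pt2)
  end.

Definition s_max (l : endpoint) : R :=
  match l with Pt1 => phi Pt1 (p Pt2 - eta) | Pt2 => phi Pt2 (p Pt1 + eta) end.

Definition phi_inv (l : endpoint) : R -> R :=
  inverse_on (I_lo l) (I_hi l) (phi l).

Definition k_pos (l : endpoint) (s : R) : C :=
  (U (phi_inv l s) * RtoC (rpow s (1 - mu l))
   * RtoC (Derive_on (V := R_CompleteNormedModule)
             0 (s_max l) (phi_inv l) s))%C.

(* The value at 0 is that of the continuous extension. *)
Definition k (l : endpoint) (s : R) : C :=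
  if Rlt_dec 0 s then k_pos l s
  else iota (T := CR) (fun v : CR =>
         filterlim (k_pos l : R -> CR) (at_right 0) (locally v)).

Definition nu_ (l : endpoint) (s : R) : R :=
  match l with
  | Pt1 => nu (phi_inv Pt1 s)
  | Pt2 => 1 - nu (phi_inv Pt2 s)
  end.

Definition nuk (l : endpoint) (s : R) : C := (RtoC (nu_ l s) * k l s)%C.

Definition DN_nuk (l : endpoint) (N : nat) (s : R) : C :=
  Derive_on_n (V := CR) N 0 (s_max l) (nuk l) s.

(* Theta l n is the coefficient Theta^(l)_{n+1}. *)
Definition Theta (l : endpoint) (n : nat) : C :=
  (RtoC (sgn l / (INR (fact n) * rho l) * Gamma ((INR n + mu l) / rho l))
   * Cexp (Ci * RtoC (sgn l * (PI / 2) * ((INR n + mu l) / rho l))))%C.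

Definition ray_dir (l : endpoint) : C :=
  Cexp (Ci * RtoC (sgn l * (PI / (2 * rho l))))%C.

(* Pull-back of f(z) dz along t |-> s + t * ray_dir l, t >= 0. *)
Definition ray_form (l : endpoint) (s : R) (f : C -> C) (t : R) : C :=
  (f (RtoC s + RtoC t * ray_dir l) * ray_dir l)%C.

Definition ray_integral (l : endpoint) (s : R) (f : C -> C) : C :=
  RInt_gen (V := CR) (ray_form l s f) (at_point 0) (Rbar_locally p_infty).

Definition kernel_integrand (l : endpoint) (n : nat) (s omega : R) (z : C)
  : C :=
  (Cpow (z - RtoC s) n * Cpowr z (mu l - 1)
   * Cexp (RtoC (sgn l) * Ci * RtoC omega * Cpowr z (rho l)))%C.

(* phi^(l)_N, for N >= 1 (the factorial and the power use n = N - 1). *)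
Definition kernel (l : endpoint) (N : nat) (s omega : R) : C :=
  (RtoC ((-1) ^ N / INR (fact (N - 1)))
   * ray_integral l s (kernel_integrand l (N - 1) s omega))%C.

Definition phase (omega x : R) : C := Cexp (Ci * RtoC (omega * psi x))%C.

Definition A_term (l : endpoint) (N : nat) (omega : R) : C :=
  (phase omega (p l)
   * sum_n (G := C_AbelianMonoid) (fun n =>
       Theta l n * Derive_on_n (V := CR) n 0 (s_max l) (k l) 0
       * RtoC (rpow omega (- ((INR n + mu l) / rho l)))) (N - 1))%C.

Definition R_integrand (l : endpoint) (N : nat) (omega s : R) : C :=
  (kernel l N s omega * DN_nuk l N s)%C.

Definition R_term (l : endpoint) (N : nat) (omega : R) : C :=
  (RtoC ((-1) ^ (N + 1 + idx l)) * phase omega (p l)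
   * RInt_gen (V := CR) (R_integrand l N omega)
       (at_right 0) (at_point (s_max l)))%C.

Definition bound_integrand (l : endpoint) (N : nat) (e s : R) : R :=
  rpow s e * Cmod (DN_nuk l N s).

Definition bound_integral (l : endpoint) (N : nat) (e : R) : R :=
  RInt_gen (V := R_CompleteNormedModule) (bound_integrand l N e)
    (at_right 0) (at_point (s_max l)).

End Expansion.

Definition a_cst (rho : R) (N : nat) : R :=
  Gamma (INR N / rho) / (INR (fact (N - 1)) * rho).

Definition b_cst (rho : R) (N : nat) : R :=
  if Nat.eq_dec N 1 then / rho
  else Gamma ((INR N - 1) / rho) / (rho ^ 2 * INR (fact (N - 2))).

Definition c_cst (rho : R) (N : nat) : R :=
  (rho - 1) * Gamma (INR N / rho) / (rho ^ 2 * INR (fact (N - 1))).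

Definition K_root (rho : R) (N : nat) (K : R) : Prop :=
  0 < K /\ a_cst rho N * rpow K rho - b_cst rho N * K - c_cst rho N = 0.

Definition L_cst (gamma rho : R) (N : nat) (K : R) : R :=
  a_cst rho N * rpow K gamma.

(* Main.v *)
Require Import Defs.
From Stdlib Require Import Reals Factorial Lra Lia ClassicalEpsilon.
From Coquelicot Require Import Coquelicot.
Open Scope R_scope.

(** On a half-line neighbourhood of [p l] the substitution [s = phi l x] turns
    the cut-off integral into that of [f s * s^(mu-1) * exp(+-i w s^rho)] with
    [f = nu_l k_l].  The kernels are iterated primitives of the oscillating
    factor: moving the base point of a ray integral differentiates the integrand
    along the ray, so this follows by integrating by parts in the ray parameter
    and needs no contour deformation.  [N] integrations by parts in [s] then give
    the expansion; at [s = 0] the exponential on the ray is [exp(-w t^rho)] and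
    the boundary terms are Gamma integrals.

    On the ray from [s > 0], [Im z^rho] is still at least [t^rho], and [|z| >= s];
    this bounds the kernel and gives the first estimate.  When [mu = 1], writing
    [exp(i w z^rho) dz] as [z^(1-rho) d(exp(i w z^rho)) / (i w rho)] gives a second
    bound, [b X^(1-rho) + c X^(-rho)] with [X = s w^(1/rho)], and the two bounds
    are interpolated at the point [X = K] where they cross.

    The amplitudes are smooth because [|psi x - psi (p l)| = y^rho J y], where
    [y] is the distance to [p l] and [J y] is the integral of
    [t^(rho-1) g (y t)] over [0 <= t <= 1], so that [phi l] is [y J^(1/rho)]. *)

(** * Complex-valued functions of a real variable *)

(** Two exponents [n] and [c] are kept free in the ray integrals [Phi n c s]: the kernels only need
    [c = mu - 1], but differentiation in [s] produces [c - 1] and [c + rho - 1], and the second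
    kernel bound uses [c = 1 - rho]. The single identity [Phi_by_parts] serves both purposes. The
    delicate point is [s = 0]: for [mu < 1] and [n = 0] the [s]-derivative of the integrand has no
    integrable majorant that is uniform up to 0, so the boundary values come from splitting the
    singularity between [s] and [t]. Both endpoints go through one argument in the distance [y] to
    [p l]; the sign [sgn l] records the reflection and the conjugate ray. Improper integrals are
    evaluated through primitives with limits at both ends, and existence follows from a comparison
    test. The derivatives in the statement are chosen by description; each is identified with a
    member of a [jet], a sequence of genuine derivatives on the whole line. *)

Lemma norm_CR (z : C) : norm (z : CR) = Cmod z.
Proof.
  unfold norm; simpl; unfold prod_norm, Cmod.
  f_equal. unfold norm; simpl. unfold abs; simpl.
  rewrite !Rmult_1_r, <- !Rabs_mult, !Rabs_pos_eq; nra.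
Qed.

Lemma scal_CR (c : R) (z : C) : scal c (z : CR) = (RtoC c * z)%C.
Proof.
  unfold scal; simpl. unfold prod_scal, scal; simpl. unfold mult; simpl.
  destruct z as [u v]. unfold Cmult, RtoC; simpl. f_equal; ring.
Qed.

Ltac ring_C := match goal with |- ?a = ?b => change (@eq C a b) end; ring.
Ltac ring_R := match goal with |- ?a = ?b => change (@eq R a b) end; ring.

Lemma derive_continuous {V : NormedModule R_AbsRing} (f : R -> V) (x : R) (l : V) :
  is_derive f x l -> continuous f x.
Proof. intros H. apply (ex_derive_continuous (V := V)). exists l; exact H. Qed.

Lemma continuous_at_right {V : UniformSpace} (f : R -> V) (x : R) :
  continuous f x -> filterlim f (at_right x) (locally (f x)).
Proof.
  intros H Q HQ. generalize (H Q HQ). unfold filtermap, at_right, within.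
  apply filter_imp; auto.
Qed.

Lemma continuous_Rmult (f g : R -> R) (t : R) :
  continuous f t -> continuous g t -> continuous (fun t => f t * g t) t.
Proof. apply (continuous_mult (K := R_AbsRing)). Qed.

Lemma continuous_Rplus (f g : R -> R) (t : R) :
  continuous f t -> continuous g t -> continuous (fun t => f t + g t) t.
Proof. apply (continuous_plus (V := R_NormedModule)). Qed.

Lemma continuous_Rmax_l (a x : R) : continuous (fun t => Rmax a t) x.
Proof.
  apply (continuous_ext (fun t => (a + t + Rabs (a - t)) / 2)).
  { intros t. unfold Rmax, Rabs. destruct Rle_dec, Rcase_abs; lra. }
  apply continuous_Rmult; [|apply continuous_const].
  apply continuous_Rplus.
  - apply continuous_Rplus. apply continuous_const. apply continuous_id.
  - apply continuous_comp. apply (continuous_minus (V := R_NormedModule)).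
    apply continuous_const. apply continuous_id. apply continuous_Rabs.
Qed.

Section Pairs.
Context {T : Type} {F : (T -> Prop) -> Prop} {FF : Filter F}.

Lemma filterlim_C (f : T -> C) (l : C) :
  filterlim (fun t => fst (f t)) F (locally (fst l)) ->
  filterlim (fun t => snd (f t)) F (locally (snd l)) ->
  filterlim f F (locally (T := CR) l).
Proof.
  intros H1 H2. apply filterlim_locally. intros eps.
  generalize (proj1 (filterlim_locally _ _) H1 eps).
  generalize (proj1 (filterlim_locally _ _) H2 eps).
  intros A B. generalize (filter_and _ _ A B). apply filter_imp.
  intros x [? ?]. split; assumption.
Qed.

Lemma filterlim_C_fst (f : T -> C) (l : C) :
  filterlim f F (locally (T := CR) l) ->
  filterlim (fun t => fst (f t)) F (locally (fst l)).
Proof.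
  intros H. apply filterlim_locally. intros eps.
  generalize (proj1 (filterlim_locally (U := CR) _ _) H eps).
  apply filter_imp. intros x [? ?]; assumption.
Qed.

Lemma filterlim_C_snd (f : T -> C) (l : C) :
  filterlim f F (locally (T := CR) l) ->
  filterlim (fun t => snd (f t)) F (locally (snd l)).
Proof.
  intros H. apply filterlim_locally. intros eps.
  generalize (proj1 (filterlim_locally (U := CR) _ _) H eps).
  apply filter_imp. intros x [? ?]; assumption.
Qed.

Lemma filterlim_Rmult (f g : T -> R) (l m : R) :
  filterlim f F (locally l) -> filterlim g F (locally m) ->
  filterlim (fun t => f t * g t) F (locally (l * m)).
Proof.
  intros. apply (filterlim_comp_2 (G := locally l) (H := locally m)); auto.
  apply (filterlim_mult (K := R_AbsRing)).
Qed.

Lemma filterlim_Rplus (f g : T -> R) (l m : R) :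
  filterlim f F (locally l) -> filterlim g F (locally m) ->
  filterlim (fun t => f t + g t) F (locally (l + m)).
Proof.
  intros. apply (filterlim_comp_2 (G := locally l) (H := locally m)); auto.
  apply (filterlim_plus (V := R_NormedModule)).
Qed.

Lemma filterlim_Ropp (f : T -> R) (l : R) :
  filterlim f F (locally l) -> filterlim (fun t => - f t) F (locally (- l)).
Proof.
  intros. eapply filterlim_comp; [eassumption|].
  apply (filterlim_opp (V := R_NormedModule)).
Qed.

Lemma filterlim_Cmult (f g : T -> C) (l m : C) :
  filterlim f F (locally (T := CR) l) -> filterlim g F (locally (T := CR) m) ->
  filterlim (fun t => (f t * g t)%C) F (locally (T := CR) (l * m)%C).
Proof.
  intros Hf Hg.
  generalize (filterlim_C_fst _ _ Hf) (filterlim_C_snd _ _ Hf)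
    (filterlim_C_fst _ _ Hg) (filterlim_C_snd _ _ Hg). intros.
  apply filterlim_C; simpl.
  - apply filterlim_Rplus; [|apply filterlim_Ropp]; apply filterlim_Rmult; auto.
  - apply filterlim_Rplus; apply filterlim_Rmult; auto.
Qed.

Lemma filterlim_Cplus (f g : T -> C) (l m : C) :
  filterlim f F (locally (T := CR) l) -> filterlim g F (locally (T := CR) m) ->
  filterlim (fun t => (f t + g t)%C) F (locally (T := CR) (l + m)%C).
Proof.
  intros. apply (filterlim_comp_2 (G := locally l) (H := locally m)); auto.
  apply (filterlim_plus (V := CR)).
Qed.

Lemma filterlim_RtoC (f : T -> R) (l : R) :
  filterlim f F (locally l) ->
  filterlim (fun t => RtoC (f t)) F (locally (T := CR) (RtoC l)).
Proof.
  intros. apply filterlim_C; simpl; auto. apply filterlim_const.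
Qed.
End Pairs.

Lemma is_derive_C (f : R -> C) (x : R) (l : C) :
  is_derive (fun t => fst (f t)) x (fst l) ->
  is_derive (fun t => snd (f t)) x (snd l) ->
  is_derive (V := CR) f x l.
Proof.
  intros H1 H2.
  apply filterdiff_ext with (f := fun t => (fst (f t), snd (f t))).
  { intros y. destruct (f y); reflexivity. }
  apply filterdiff_ext_lin
    with (l1 := fun t => (scal t (fst l), scal t (snd l))).
  2:{ intros y; destruct l; reflexivity. }
  apply (filterdiff_comp'_2 (U := R_NormedModule) (V := R_NormedModule)
    (W := CR) (fun t => fst (f t)) (fun t => snd (f t)) (fun a b => (a, b)) x
    (fun t => scal t (fst l)) (fun t => scal t (snd l)) (fun a b => (a, b))).
  - exact H1.
  - exact H2.
  - apply filterdiff_ext with (f := fun t => t). { intros []; reflexivity. }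
    apply filterdiff_ext_lin with (l1 := fun t => t).
    apply filterdiff_id. intros []; reflexivity.
Qed.

Lemma is_derive_C_fst (f : R -> C) (x : R) (l : C) :
  is_derive (V := CR) f x l -> is_derive (fun t => fst (f t)) x (fst l).
Proof.
  intros H.
  apply (filterdiff_comp' f (fst : CR -> R) x (fun y => scal y l)
    (fst : CR -> R)); [exact H|].
  apply filterdiff_linear, (is_linear_fst (U := R_NormedModule)).
Qed.

Lemma is_derive_C_snd (f : R -> C) (x : R) (l : C) :
  is_derive (V := CR) f x l -> is_derive (fun t => snd (f t)) x (snd l).
Proof.
  intros H.
  apply (filterdiff_comp' f (snd : CR -> R) x (fun y => scal y l)
    (snd : CR -> R)); [exact H|].
  apply filterdiff_linear, (is_linear_snd (V := R_NormedModule)).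
Qed.

Lemma is_derive_Req (f : R -> R) x (l l' : R) :
  is_derive f x l -> l = l' -> is_derive f x l'.
Proof. intros; subst; auto. Qed.

Lemma is_derive_Ceq (f : R -> C) x (l l' : C) :
  is_derive (V := CR) f x l -> l = l' -> is_derive (V := CR) f x l'.
Proof. intros; subst; auto. Qed.

Lemma is_derive_Rmult (f g : R -> R) (x l m : R) :
  is_derive f x l -> is_derive g x m ->
  is_derive (fun t => f t * g t) x (l * g x + f x * m).
Proof.
  intros. eapply is_derive_Req. apply (is_derive_mult f g x l m); auto.
  intros; apply Rmult_comm. reflexivity.
Qed.

Lemma is_derive_Cmult (f g : R -> C) (x : R) (l m : C) :
  is_derive (V := CR) f x l -> is_derive (V := CR) g x m ->
  is_derive (V := CR) (fun t => (f t * g t)%C) x (l * g x + f x * m)%C.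
Proof.
  intros Hf Hg.
  generalize (is_derive_C_fst _ _ _ Hf) (is_derive_C_snd _ _ _ Hf)
    (is_derive_C_fst _ _ _ Hg) (is_derive_C_snd _ _ _ Hg).
  intros Hf1 Hf2 Hg1 Hg2.
  apply is_derive_C; simpl.
  - eapply is_derive_Req.
    apply (is_derive_minus (fun t => fst (f t) * fst (g t))
      (fun t => snd (f t) * snd (g t))); apply is_derive_Rmult; eassumption.
    unfold minus, plus, opp; simpl. ring.
  - eapply is_derive_Req.
    apply (is_derive_plus (fun t => fst (f t) * snd (g t))
      (fun t => snd (f t) * fst (g t))); apply is_derive_Rmult; eassumption.
    unfold plus; simpl. ring.
Qed.

Lemma is_derive_Cplus (f g : R -> C) (x : R) (l m : C) :
  is_derive (V := CR) f x l -> is_derive (V := CR) g x m ->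
  is_derive (V := CR) (fun t => (f t + g t)%C) x (l + m)%C.
Proof. intros; apply (is_derive_plus (V := CR)); auto. Qed.

Lemma is_derive_RtoC (f : R -> R) (x l : R) :
  is_derive f x l -> is_derive (V := CR) (fun t => RtoC (f t)) x (RtoC l).
Proof.
  intros. apply is_derive_C; simpl; auto. apply (is_derive_const (V := R_NormedModule)).
Qed.

Lemma is_derive_Cconst (c : C) (x : R) :
  is_derive (V := CR) (fun _ => c) x (RtoC 0).
Proof. apply (is_derive_const (V := CR)). Qed.

Lemma is_derive_Cmult_l (c : C) (f : R -> C) (x : R) (l : C) :
  is_derive (V := CR) f x l ->
  is_derive (V := CR) (fun t => (c * f t)%C) x (c * l)%C.
Proof.
  intros. eapply is_derive_Ceq. apply is_derive_Cmult; [apply is_derive_Cconst|eassumption].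
  rewrite Cmult_0_l, Cplus_0_l. reflexivity.
Qed.

Lemma is_derive_Cexp (f : R -> C) (x : R) (l : C) :
  is_derive (V := CR) f x l ->
  is_derive (V := CR) (fun t => Cexp (f t)) x (l * Cexp (f x))%C.
Proof.
  intros H.
  generalize (is_derive_C_fst _ _ _ H) (is_derive_C_snd _ _ _ H). intros H1 H2.
  assert (D1 : is_derive (fun t => exp (fst (f t))) x (fst l * exp (fst (f x)))).
  { apply (is_derive_comp exp (fun t => fst (f t))); auto. apply is_derive_exp. }
  assert (D2 : is_derive (fun t => cos (snd (f t))) x (snd l * - sin (snd (f x)))).
  { apply (is_derive_comp cos (fun t => snd (f t))); auto. apply is_derive_cos. }
  assert (D3 : is_derive (fun t => sin (snd (f t))) x (snd l * cos (snd (f x)))).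
  { apply (is_derive_comp sin (fun t => snd (f t))); auto. apply is_derive_sin. }
  apply is_derive_C; unfold Cexp; simpl.
  - eapply is_derive_Req. apply is_derive_Rmult; eassumption. simpl; ring.
  - eapply is_derive_Req. apply is_derive_Rmult; eassumption. simpl; ring.
Qed.

Lemma Cexp_add (z w : C) : Cexp (z + w) = (Cexp z * Cexp w)%C.
Proof.
  unfold Cexp, Cmult; simpl. rewrite exp_plus, cos_plus, sin_plus.
  f_equal; ring.
Qed.

Lemma Cmod_Cexp (z : C) : Cmod (Cexp z) = exp (fst z).
Proof.
  unfold Cmod, Cexp; simpl.
  transitivity (sqrt ((exp (fst z))^2)).
  - f_equal. generalize (sin2_cos2 (snd z)). unfold Rsqr. nra.
  - rewrite sqrt_pow2; auto. left; apply exp_pos.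
Qed.

(** The plane cut along the closed negative real axis: |z| + Re z vanishes exactly on (-oo, 0], and
    it is the denominator in [Carg]. *)
Definition Crp (z : C) : Prop := 0 < Cmod z + fst z.

Lemma Crp_neq (z : C) : Crp z -> z <> RtoC 0.
Proof. intros H ->. unfold Crp in H. rewrite Cmod_0 in H. simpl in H. lra. Qed.

Lemma Cmod_sqr (z : C) : Cmod z * Cmod z = fst z * fst z + snd z * snd z.
Proof.
  unfold Cmod. rewrite sqrt_sqrt. ring. nra.
Qed.

Lemma is_derive_Cmod (f : R -> C) (x : R) (l : C) :
  is_derive (V := CR) f x l -> f x <> RtoC 0 ->
  is_derive (fun t => Cmod (f t)) x
    ((fst (f x) * fst l + snd (f x) * snd l) / Cmod (f x)).
Proof.
  intros H H0.
  generalize (is_derive_C_fst _ _ _ H) (is_derive_C_snd _ _ _ H). intros H1 H2.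
  assert (P : 0 < Cmod (f x)) by (apply Cmod_gt_0; auto).
  assert (Q := Cmod_sqr (f x)).
  unfold Cmod at 1. eapply is_derive_Req.
  - apply (is_derive_comp sqrt (fun t => fst (f t) ^ 2 + snd (f t) ^ 2)).
    + apply is_derive_Reals, derivable_pt_lim_sqrt. nra.
    + apply (is_derive_plus (fun t => fst (f t) ^ 2) (fun t => snd (f t) ^ 2));
      eapply is_derive_pow; eassumption.
  - unfold scal, plus; simpl. unfold mult; simpl.
    fold (Cmod (f x)). change (sqrt _) with (Cmod (f x)). field. lra.
Qed.

(** With z = a + ib, z' = l + im and r = |z|, the left side is the derivative of the half-angle
    formula in [Carg] and the right side is Im (z'/z). The computation collapses because 1 + tan^2
    (arg/2) = 2r/(r + a). *)
Lemma Clog_derive_aux (r a b l m : R) :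
  0 < r -> 0 < r + a -> r * r = a * a + b * b ->
  2 * ((m * (r + a) - b * ((a * l + b * m) / r + l)) / ((r + a) * (r + a))
       * / (1 + b / (r + a) * (b / (r + a)))) = (a * m - b * l) / (r * r).
Proof.
  intros P Hp Q.
  assert (W : 1 + b / (r + a) * (b / (r + a)) = 2 * r / (r + a)).
  { transitivity (((r + a) * (r + a) + b * b) / ((r + a) * (r + a))).
    field; lra.
    replace ((r + a) * (r + a) + b * b) with (2 * r * (r + a)) by nra.
    field; lra. }
  rewrite W.
  apply Rmult_eq_reg_r with (r * r * (r + a));
    [|apply Rgt_not_eq; repeat apply Rmult_lt_0_compat; lra].
  transitivity (m * r * (r + a) - b * (a * l + b * m) - b * l * r);
    [|transitivity ((r + a) * (a * m - b * l))].
  - field. lra.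
  - replace (b * (a * l + b * m)) with (a * b * l + (r * r - a * a) * m)
      by (rewrite Q; ring). ring.
  - field. lra.
Qed.

Lemma is_derive_Clog (f : R -> C) (x : R) (l : C) :
  is_derive (V := CR) f x l -> Crp (f x) ->
  is_derive (V := CR) (fun t => Clog (f t)) x (l / f x)%C.
Proof.
  intros H Hp.
  assert (Hn := Crp_neq _ Hp). unfold Crp in Hp.
  assert (P : 0 < Cmod (f x)) by (apply Cmod_gt_0; auto).
  generalize (is_derive_C_fst _ _ _ H) (is_derive_C_snd _ _ _ H). intros H1 H2.
  assert (Q := Cmod_sqr (f x)).
  assert (D := is_derive_Cmod _ _ _ H Hn).
  set (r := Cmod (f x)) in *.
  assert (E : fst (f x) ^ 2 + snd (f x) ^ 2 = r * r) by (rewrite Q; ring).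
  apply is_derive_C; unfold Clog; simpl.
  - eapply is_derive_Req.
    apply (is_derive_comp ln (fun t => Cmod (f t))); [|eassumption].
    apply is_derive_Reals, derivable_pt_lim_ln. exact P.
    unfold scal; simpl; unfold mult; simpl. fold r.
    rewrite !Rmult_1_r. rewrite <- Q. field; lra.
  - unfold Carg. eapply is_derive_Req.
    + apply (is_derive_scal (fun t => atan (snd (f t) / (Cmod (f t) + fst (f t))))).
      apply (is_derive_comp atan (fun t => snd (f t) / (Cmod (f t) + fst (f t)))).
      apply is_derive_Reals, derivable_pt_lim_atan.
      apply is_derive_div. exact H2.
      apply (is_derive_plus (fun t => Cmod (f t)) (fun t => fst (f t))); eassumption.
      fold r; lra.
    + unfold scal, plus; simpl; unfold mult; simpl. fold r.
      set (a := fst (f x)) in *. set (b := snd (f x)) in *.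
      unfold Rsqr. rewrite !Rmult_1_r, <- Q.
      etransitivity; [apply (Clog_derive_aux r a b (fst l) (snd l) P Hp Q)|].
      field. lra.
Qed.

(** With u = b/(r + a), the tangent of half the argument, this is the rational parametrization cos =
    (1 - u^2)/(1 + u^2), sin = 2u/(1 + u^2). *)
Lemma Cexp_Clog (z : C) : Crp z -> Cexp (Clog z) = z.
Proof.
  intros Hp. assert (Hn := Crp_neq _ Hp). unfold Crp in Hp.
  assert (P : 0 < Cmod z) by (apply Cmod_gt_0; auto).
  assert (Q := Cmod_sqr z).
  unfold Cexp, Clog; simpl. rewrite exp_ln by auto.
  unfold Carg. destruct z as [a b]; simpl in *.
  set (r := Cmod (a, b)) in *. set (u := b / (r + a)).
  assert (S : 0 < 1 + u²) by (unfold Rsqr; nra).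
  rewrite cos_2a, sin_2a, cos_atan, sin_atan.
  assert (T : sqrt (1 + u²) <> 0) by (apply Rgt_not_eq, sqrt_lt_R0; auto).
  assert (T2 : sqrt (1 + u²) * sqrt (1 + u²) = 1 + u²) by (apply sqrt_sqrt; lra).
  set (q := sqrt (1 + u²)) in *.
  replace (1 / q * (1 / q) - u / q * (u / q)) with ((1 - u²) / (1 + u²))
    by (rewrite <- T2; unfold Rsqr; field; auto).
  replace (2 * (u / q) * (1 / q)) with (2 * u / (1 + u²))
    by (rewrite <- T2; unfold Rsqr; field; auto).
  assert (U : 1 + u² = 2 * r / (r + a)).
  { unfold u, Rsqr.
    transitivity (((r + a) * (r + a) + b * b) / ((r + a) * (r + a))).
    field; lra.
    replace ((r + a) * (r + a) + b * b) with (2 * r * (r + a)) by nra.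
    field; lra. }
  assert (U' : 1 - u² = 2 * a / (r + a)) .
  { replace (1 - u²) with (2 - (1 + u²)) by ring. rewrite U. field. lra. }
  rewrite U, U'. f_equal; [|unfold u]; field; lra.
Qed.

Lemma Cpowr_plus (z : C) (a b : R) :
  Cpowr z (a + b) = (Cpowr z a * Cpowr z b)%C.
Proof.
  unfold Cpowr. rewrite <- Cexp_add. f_equal. rewrite RtoC_plus. ring.
Qed.

Lemma Cpowr_1 (z : C) : Crp z -> Cpowr z 1 = z.
Proof. intros. unfold Cpowr. rewrite Cmult_1_l. apply Cexp_Clog; auto. Qed.

Lemma is_derive_Cpowr (f : R -> C) (x : R) (l : C) (a : R) :
  is_derive (V := CR) f x l -> Crp (f x) ->
  is_derive (V := CR) (fun t => Cpowr (f t) a) x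
    (RtoC a * (Cpowr (f x) (a - 1) * l))%C.
Proof.
  intros H Hp. assert (Hn := Crp_neq _ Hp).
  assert (D := is_derive_Clog _ _ _ H Hp).
  unfold Cpowr at 1. eapply is_derive_Ceq.
  apply is_derive_Cexp, is_derive_Cmult_l, D.
  cbv beta. change (Cexp (a * Clog (f x))) with (Cpowr (f x) a).
  (* The chain rule yields z^a z'/z; lowering the exponent uses z = exp (log z), hence the cut
     plane. *)
  replace (Cpowr (f x) a) with (Cpowr (f x) (a - 1) * f x)%C.
  - field. auto.
  - rewrite <- (Cpowr_1 (f x) Hp) at 2. rewrite <- Cpowr_plus. f_equal. ring.
Qed.

Lemma Cmod_Cpowr (z : C) (a : R) : Cmod (Cpowr z a) = Rpower (Cmod z) a.
Proof.
  unfold Cpowr. rewrite Cmod_Cexp. unfold Clog, Rpower; simpl. f_equal. ring.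
Qed.

Lemma Cpowr_RtoC (x a : R) : 0 < x -> Cpowr (RtoC x) a = RtoC (Rpower x a).
Proof.
  intros H. unfold Cpowr, Clog, Carg, Cexp, RtoC, Rpower; simpl.
  change (x, 0) with (RtoC x). rewrite Cmod_R, Rabs_pos_eq by lra.
  replace (0 / (x + x)) with 0 by (field; lra). rewrite atan_0.
  replace (a * (2 * 0) + 0 * ln x) with 0 by ring. rewrite cos_0, sin_0.
  replace (a * ln x - 0 * (2 * 0)) with (a * ln x) by ring. f_equal; ring.
Qed.

(** * Functions of class C^n on an interval *)

Lemma plus_minus_r {G : AbelianGroup} (u v : G) : plus u (minus v u) = v.
Proof.
  unfold minus. rewrite (plus_comm v), plus_assoc, plus_opp_r.
  apply plus_zero_l.
Qed.

Section Quotients.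
Context {V : NormedModule R_AbsRing}.

(** The normed-module axiom is only an inequality; the reverse one is the axiom applied to the
    scalar 1/l. *)
Lemma norm_scal_R (l : R) (x : V) : norm (scal l x) = Rabs l * norm x.
Proof.
  apply Rle_antisym; [apply (norm_scal l x)|].
  destruct (Req_dec l 0) as [->|n].
  { rewrite Rabs_R0, Rmult_0_l. apply norm_ge_0. }
  assert (P : 0 < Rabs l) by (apply Rabs_pos_lt; auto).
  apply Rmult_le_reg_l with (/ Rabs l). apply Rinv_0_lt_compat; auto.
  rewrite <- Rmult_assoc, Rinv_l, Rmult_1_l by lra.
  replace x with (scal (/ l) (scal l x)) at 1.
  - eapply Rle_trans; [apply (norm_scal (/ l))|].
    unfold abs; simpl. rewrite Rabs_inv. lra.
  - rewrite scal_assoc. replace (mult (/ l) l) with (@one R_AbsRing)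
      by (unfold mult, one; simpl; field; auto).
    apply (scal_one x).
Qed.

Lemma scal_inv_r (d : R) (m : V) : d <> 0 -> scal d (scal (/ d) m) = m.
Proof.
  intros. rewrite scal_assoc. replace (mult d (/ d)) with (@one R_AbsRing)
    by (unfold mult, one; simpl; field; auto).
  apply (scal_one m).
Qed.

Lemma scal_inv_minus (d : R) (m l : V) : d <> 0 ->
  scal d (minus (scal (/ d) m) l) = minus m (scal d l).
Proof.
  intros. etransitivity; [apply (scal_minus_distr_l d)|].
  rewrite scal_inv_r; auto.
Qed.

(** Links the difference quotients of [is_derive_on] to the little-o form of [is_derive]. The case y
    = x is split off because the quotient has no meaning there. *)
Lemma slope_norm (f : R -> V) (x y : R) (l : V) :
  norm (minus (minus (f y) (f x)) (scal (y - x) l))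
  = Rabs (y - x) * (if Req_EM_T y x then 0 else
      norm (minus (scal (/ (y - x)) (minus (f y) (f x))) l)).
Proof.
  destruct (Req_EM_T y x) as [->|n].
  - rewrite Rmult_0_r. assert (Z : scal (x - x) l = zero)
      by (replace (x - x) with 0 by ring; apply (scal_zero_l l)).
    rewrite Z, minus_eq_zero. 
    transitivity (norm (minus (@zero V) (@zero V))); [reflexivity|].
    rewrite minus_eq_zero. apply norm_zero.
  - assert (y - x <> 0) by lra.
    rewrite <- scal_inv_minus by auto. apply norm_scal_R.
Qed.

Lemma is_derive_slope (f : R -> V) (x : R) (l : V) :
  filterlim (fun y => scal (/ (y - x)) (minus (f y) (f x))) (locally' x) (locally l)
  -> is_derive f x l.
Proof.
  intros H. split. apply is_linear_scal_l.
  intros y Hy. 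
  apply (is_filter_lim_locally_unique (V := AbsRing_NormedModule R_AbsRing)) in Hy.
  subst y.
  intros eps. generalize (proj1 (filterlim_locally_ball_norm _ _) H eps).
  unfold locally', within. apply filter_imp. intros y Hy.
  change (norm (minus (minus (f y) (f x)) (scal (y - x) l))
          <= eps * Rabs (y - x)).
  rewrite slope_norm, Rmult_comm. apply Rmult_le_compat_r. apply Rabs_pos.
  destruct (Req_EM_T y x). left; apply cond_pos. left. apply Hy, n.
Qed.

Lemma slope_is_derive (f : R -> V) (x : R) (l : V) :
  is_derive f x l ->
  filterlim (fun y => scal (/ (y - x)) (minus (f y) (f x))) (locally' x) (locally l).
Proof.
  intros [_ H]. specialize (H x (fun P HP => HP)).
  apply filterlim_locally_ball_norm. intros eps.
  assert (He : 0 < eps / 2) by (destruct eps; simpl; lra).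
  generalize (H (mkposreal _ He)). unfold locally', within. apply filter_imp.
  intros y Hy Hn.
  change (norm (minus (minus (f y) (f x)) (scal (y - x) l))
          <= eps / 2 * Rabs (y - x)) in Hy.
  rewrite slope_norm in Hy. destruct (Req_EM_T y x). contradiction.
  assert (0 < Rabs (y - x)) by (apply Rabs_pos_lt; lra).
  unfold ball_norm. apply Rle_lt_trans with (eps / 2).
  - apply Rmult_le_reg_l with (Rabs (y - x)); auto.
    rewrite (Rmult_comm _ (eps / 2)). exact Hy.
  - destruct eps; simpl in *; lra.
Qed.
(** Write f y = f x + (y - x) q(y), where the quotient q has a limit. Restricting to [D] covers
    one-sided derivatives. *)
Lemma slope_continuous (D : R -> Prop) (f : R -> V) (x : R) (l : V) :
  filterlim (fun y => scal (/ (y - x)) (minus (f y) (f x)))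
    (within D (locally' x)) (locally l) ->
  filterlim f (within D (locally x)) (locally (f x)).
Proof.
  intros H.
  assert (F : Filter (within D (locally' x)))
    by (apply within_filter, within_filter, locally_filter).
  assert (Z : filterlim (fun y : R => y - x) (within D (locally' x)) (locally 0)).
  { intros P [eps HP]. exists eps. intros y Hy _ _. apply HP.
    change (Rabs (y - x) < eps) in Hy. change (Rabs (y - x - 0) < eps).
    rewrite Rminus_0_r. exact Hy. }
  assert (L : filterlim (fun y => plus (f x) (scal (y - x)
      (scal (/ (y - x)) (minus (f y) (f x))))) (within D (locally' x))
    (locally (plus (f x) (scal 0 l)))).
  { apply (filterlim_comp_2 (G := locally (f x)) (H := locally (scal 0 l))).
    - apply filterlim_const.
    - apply (filterlim_comp_2 (G := locally 0) (H := locally l)); auto.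
      apply (filterlim_scal (V := V)).
    - apply (filterlim_plus (V := V)). }
  replace (plus (f x) (scal 0 l)) with (f x) in L.
  2:{ rewrite <- (plus_zero_r (f x)) at 1. apply f_equal. symmetry. apply (scal_zero_l l). }
  intros P HP. generalize (L P HP). unfold filtermap, within, locally', within.
  apply filter_imp. intros y Hy HD.
  destruct (Req_dec y x) as [->|n]; [apply locally_singleton; auto|].
  specialize (Hy n HD). rewrite scal_inv_r in Hy by lra.
  rewrite <- (plus_minus_r (f x) (f y)). exact Hy.
Qed.
End Quotients.

Lemma within_Icc_locally' (a b x : R) : a < x < b ->
  forall P, within (Icc a b) (locally' x) P -> locally' x P.
Proof.
  intros Hx P H. change (locally x (fun y => y <> x -> Icc a b y -> P y)) in H.
  change (locally x (fun y => y <> x -> P y)).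
  assert (L : locally x (fun y => a <= y <= b)).
  { apply (filter_imp (fun y => a < y < b)). intros; lra.
    apply (open_and (fun y => a < y) (fun y => y < b)); auto.
    apply open_gt. apply open_lt. }
  generalize (filter_and _ _ L H). apply filter_imp. intros y [A B] C.
  apply B; auto.
Qed.

(** Makes the two filters below proper, so that one-sided limits and derivatives are unique at the
    endpoints too. The step away from [x] goes towards the farther end of the interval. *)
Lemma interior_near (a b x : R) (eps : posreal) : a < b -> Icc a b x ->
  exists y, a < y < b /\ y <> x /\ ball x eps y.
Proof.
  intros Hab Hx.
  set (d := Rmin (eps / 2) ((b - a) / 4)).
  assert (Hd : 0 < d) by (apply Rmin_glb_lt; [destruct eps; simpl|]; lra).
  assert (d <= eps / 2) by apply Rmin_l.
  assert (d <= (b - a) / 4) by apply Rmin_r.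
  assert (0 < eps) by apply cond_pos.
  unfold Icc in *.
  destruct (Rle_dec x ((a + b) / 2)); [exists (x + d)|exists (x - d)];
    (split; [lra|]; split; [lra|]);
    unfold ball; simpl; unfold AbsRing_ball, abs, minus, plus, opp; simpl;
    apply Rabs_def1; lra.
Qed.

Lemma within_Icc_proper (a b x : R) : a < b -> Icc a b x ->
  ProperFilter' (within (Icc a b) (locally' x)).
Proof.
  intros Hab Hx. constructor.
  - intros [eps He]. destruct (interior_near a b x eps) as [y [H1 [H2 H3]]]; auto.
    apply (He y); auto. unfold Icc; lra.
  - apply within_filter, within_filter, locally_filter.
Qed.

Lemma within_Ioo_proper (a b x : R) : a < b -> Icc a b x ->
  ProperFilter' (within (fun y => a < y < b) (locally x)).
Proof.
  intros Hab Hx. constructor.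
  - intros [eps He]. destruct (interior_near a b x eps) as [y [H1 [H2 H3]]]; auto.
    apply (He y); auto.
  - apply within_filter, locally_filter.
Qed.

(** Limits along interior points are unique. This carries identities obtained by ordinary
    differentiation inside the interval over to its endpoints. *)
Lemma eq_on_closure {V : NormedModule R_AbsRing} (a b : R) (f g : R -> V) :
  a < b -> (forall x, a < x < b -> f x = g x) ->
  continuous_on (Icc a b) f -> continuous_on (Icc a b) g ->
  forall x, Icc a b x -> f x = g x.
Proof.
  intros Hab E Hf Hg x Hx. generalize (within_Ioo_proper a b x Hab Hx). intro.
  apply (filterlim_locally_unique (F := within (fun y => a < y < b) (locally x)) f).
  - intros P HP. generalize (Hf x Hx P HP). unfold filtermap, within.
    apply filter_imp. intros y Hy Hi. apply Hy. unfold Icc; lra.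
  - intros P HP. generalize (Hg x Hx P HP). unfold filtermap, within.
    apply filter_imp. intros y Hy Hi. rewrite E by auto. apply Hy. unfold Icc; lra.
Qed.

Section Derive_on.
Context {V : CompleteNormedModule R_AbsRing}.

Lemma is_derive_on_interior (a b : R) (f : R -> V) (x : R) (l : V) :
  a < x < b -> is_derive_on a b f x l -> is_derive f x l.
Proof.
  intros Hx H. apply is_derive_slope. intros P HP.
  apply (within_Icc_locally' a b); auto. apply H, HP.
Qed.

Lemma is_derive_on_of (a b : R) (f : R -> V) (x : R) (l : V) :
  is_derive f x l -> is_derive_on a b f x l.
Proof.
  intros H. apply slope_is_derive in H. intros P HP.
  generalize (H P HP). unfold filtermap, within. apply filter_imp. auto.
Qed.

Lemma is_derive_on_unique (a b : R) (f : R -> V) (x : R) (l m : V) :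
  a < b -> Icc a b x -> is_derive_on a b f x l -> is_derive_on a b f x m -> l = m.
Proof.
  intros. generalize (within_Icc_proper a b x H H0). intro.
  eapply (filterlim_locally_unique (F := within (Icc a b) (locally' x))); eassumption.
Qed.

Lemma Derive_on_eq (a b : R) (f : R -> V) (x : R) (l : V) :
  a < b -> Icc a b x -> is_derive_on a b f x l -> Derive_on a b f x = l.
Proof.
  intros. apply iota_unique; auto.
  intros. eapply is_derive_on_unique; eassumption.
Qed.

Lemma is_derive_on_ext (a b : R) (f g : R -> V) (x : R) (l : V) :
  (forall y, Icc a b y -> f y = g y) -> Icc a b x ->
  is_derive_on a b f x l -> is_derive_on a b g x l.
Proof.
  intros E Hx H. intros P HP. generalize (H P HP).
  unfold filtermap, within, locally', within. apply filter_imp. intros y Hy Hn Hi.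
  rewrite <- !E; auto.
Qed.

Lemma is_derive_on_sub (a b c d : R) (f : R -> V) (x : R) (l : V) :
  a <= c -> d <= b -> is_derive_on a b f x l -> is_derive_on c d f x l.
Proof.
  intros Hc Hd H P HP. generalize (H P HP).
  unfold filtermap, within, locally', within. apply filter_imp. unfold Icc.
  intros y Hy Hn Hi.
  apply Hy; auto; lra.
Qed.

Lemma continuous_on_of (D : R -> Prop) (f : R -> V) :
  (forall x, D x -> continuous f x) -> continuous_on D f.
Proof.
  intros H x Hx P HP. generalize (H x Hx P HP). unfold filtermap, within.
  apply filter_imp; auto.
Qed.

Lemma is_derive_on_continuous (a b : R) (f : R -> V) (x : R) (l : V) :
  is_derive_on a b f x l ->
  filterlim f (within (Icc a b) (locally x)) (locally (f x)).
Proof. exact (slope_continuous (V := V) (Icc a b) f x l). Qed.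

(** One-sided derivatives are avoided by extending [C^n] functions on an interval
    to the whole line ([Ck_on_extend]). *)
Fixpoint Cg (n : nat) (f : R -> V) : Prop :=
  match n with
  | O => forall x, continuous f x
  | S m => exists g, (forall x, is_derive f x (g x)) /\ Cg m g
  end.

Lemma Cg_continuous (n : nat) (f : R -> V) : Cg n f -> forall x, continuous f x.
Proof.
  destruct n; simpl; auto. intros [g [H _]] x.
  eapply (derive_continuous (V := V)), H.
Qed.

Lemma Cg_pred (n : nat) (f : R -> V) : Cg (S n) f -> Cg n f.
Proof.
  revert f; induction n; intros f H.
  - intros x. exact (Cg_continuous 1 f H x).
  - destruct H as [g [H1 H2]]. exists g; auto.
Qed.

Lemma Cg_Ck_on (n : nat) (a b : R) (f F : R -> V) :
  Cg n F -> (forall x, Icc a b x -> F x = f x) -> Ck_on n a b f.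
Proof.
  revert f F; induction n; simpl; intros f F H E.
  - intros x Hx. rewrite <- E by auto.
    generalize (continuous_on_of (Icc a b) F (fun x _ => H x) x Hx).
    apply filterlim_ext_loc. unfold within. apply filter_forall. auto.
  - destruct H as [g [H1 H2]]. exists g. split.
    + intros x Hx. apply (is_derive_on_ext a b F); auto. apply is_derive_on_of; auto.
    + apply (IHn g g); auto.
Qed.

(** The antiderivative of an extension of [f'] extends [f]. *)
Lemma Ck_on_extend (n : nat) (a b : R) (f : R -> V) : a < b ->
  Ck_on n a b f -> exists F, Cg n F /\ forall x, Icc a b x -> F x = f x.
Proof.
  intros Hab. revert f; induction n; simpl; intros f H.
  (* Clamping to [a, b] does not increase distances, so the composite with [f] is continuous on the
     whole line. *)
  - set (cl := fun x => Rmax a (Rmin b x)).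
    assert (Hcl : forall x, Icc a b (cl x)).
    { intros; unfold cl, Icc, Rmax, Rmin. repeat destruct Rle_dec; lra. }
    assert (Hcl' : forall x, Icc a b x -> cl x = x).
    { intros; unfold cl, Icc, Rmax, Rmin in *. repeat destruct Rle_dec; lra. }
    exists (fun x => f (cl x)). split.
    2: intros; rewrite Hcl'; auto.
    intros x. apply (filterlim_comp _ _ _ cl f _ (within (Icc a b) (locally (cl x)))).
    2: apply H, Hcl.
    intros P [eps HP]. exists eps. intros y Hy. apply HP; auto.
    unfold ball in *; simpl in *; unfold AbsRing_ball, abs, minus, plus, opp in *; simpl in *.
    eapply Rle_lt_trans; [|exact Hy]. unfold cl, Rmax, Rmin.
    repeat destruct Rle_dec; unfold Rabs; repeat destruct Rcase_abs; lra.
  - destruct H as [g [H1 H2]]. destruct (IHn g H2) as [G [G1 G2]].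
    (* The primitive is based at an interior point: equality with [f] is first proved where [f] has
       a two-sided derivative, and then reaches the endpoints by continuity. *)
    set (c := (a + b) / 2).
    assert (GI : forall x y, ex_RInt G x y).
    { intros. apply ex_RInt_continuous. intros; eapply Cg_continuous; eassumption. }
    set (F := fun x => plus (f c) (RInt G c x)).
    assert (DF : forall x, is_derive F x (G x)).
    { intros x. unfold F. rewrite <- (plus_zero_l (G x)).
      apply (is_derive_plus (V := V)). apply (is_derive_const (V := V)).
      apply (is_derive_RInt (V := V)) with c.
      apply filter_forall. intros; apply RInt_correct, GI.
      eapply Cg_continuous; eassumption. }
    assert (E : forall x, a < x < b -> F x = f x).
    { intros x Hx. unfold F.
      assert (I : is_RInt G c x (minus (f x) (f c))).
      { apply (is_RInt_derive (V := V)).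
        - intros z Hz. rewrite G2.
          + apply (is_derive_on_interior a b); [|apply H1];
            unfold Icc, c, Rmin, Rmax in *; destruct Rle_dec; lra.
          + unfold Icc, c, Rmin, Rmax in *; destruct Rle_dec; lra.
        - intros; eapply Cg_continuous; eassumption. }
      rewrite (is_RInt_unique _ _ _ _ I).
      exact (plus_minus_r (G := V) (f c) (f x)). }
    exists F. split. { exists G; auto. }
    apply (eq_on_closure a b); auto.
    + apply continuous_on_of. intros.
      eapply (derive_continuous (V := V)), DF.
    + intros x Hx. eapply is_derive_on_continuous, H1, Hx.
Qed.

Lemma Ck_on_ext (n : nat) (a b : R) (f g : R -> V) : a < b ->
  (forall x, Icc a b x -> f x = g x) -> Ck_on n a b f -> Ck_on n a b g.
Proof.
  intros Hab E H. destruct (Ck_on_extend n a b f) as [F [F1 F2]]; auto.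
  apply (Cg_Ck_on n a b g F); auto. intros; rewrite F2; auto.
Qed.

(** Gives names to the successive derivatives, so that [Derive_on_n], which is chosen by
    description, can be replaced by functions differentiable on the whole line. Entries beyond index
    [n] are unconstrained. *)
Fixpoint jet (n : nat) (F : nat -> R -> V) : Prop :=
  match n with
  | O => forall x, continuous (F O) x
  | S m => (forall x, is_derive (F O) x (F 1%nat x)) /\ jet m (fun k => F (S k))
  end.

Lemma Cg_jet (n : nat) (f : R -> V) : Cg n f -> exists F, F O = f /\ jet n F.
Proof.
  revert f; induction n; intros f H.
  - exists (fun _ => f). auto.
  - destruct H as [g [H1 H2]]. destruct (IHn g H2) as [F [F1 F2]].
    exists (fun k => match k with O => f | S m => F m end). simpl. subst g; auto.
Qed.

Lemma jet_derive (n : nat) (F : nat -> R -> V) : jet n F ->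
  forall k x, (k < n)%nat -> is_derive (F k) x (F (S k) x).
Proof.
  revert F; induction n; intros F H k x Hk. lia.
  destruct H as [H1 H2]. destruct k; auto. apply (IHn _ H2). lia.
Qed.

Lemma jet_Cg (n : nat) (F : nat -> R -> V) : jet n F -> Cg n (F O).
Proof.
  revert F; induction n; intros F H; auto.
  destruct H. exists (F 1%nat). split; auto. apply (IHn _ H0).
Qed.

Lemma jet_continuous (n : nat) (F : nat -> R -> V) : jet n F ->
  forall k x, (k <= n)%nat -> continuous (F k) x.
Proof.
  revert F; induction n; intros F H k x Hk.
  - replace k with O by lia. apply H.
  - destruct k. apply (Cg_continuous _ _ (jet_Cg _ _ H)).
    destruct H. apply (IHn _ H0). lia.
Qed.

Lemma jet_Derive_on_n (n : nat) (a b : R) (f : R -> V) (F : nat -> R -> V) :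
  a < b -> jet n F -> (forall x, Icc a b x -> f x = F O x) ->
  forall k x, (k <= n)%nat -> Icc a b x -> Derive_on_n k a b f x = F k x.
Proof.
  intros Hab H E. induction k; intros x Hk Hx; simpl; auto.
  apply Derive_on_eq; auto.
  apply (is_derive_on_ext a b (F k)); auto.
  - intros y Hy. symmetry. apply IHk; auto. lia.
  - apply is_derive_on_of. apply (jet_derive n); auto. 
Qed.

(** One-sided derivatives at the ends of [a, b] only see values inside, so agreement on the interval
    forces agreement of all derivatives, endpoints included. It is used twice: near 0, where the
    cut-off equals 1, and beyond [s_max], where it vanishes. *)
Lemma jet_unique (n : nat) (a b : R) (F G : nat -> R -> V) :
  a < b -> jet n F -> jet n G -> (forall x, Icc a b x -> F O x = G O x) ->
  forall k x, (k <= n)%nat -> Icc a b x -> F k x = G k x.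
Proof.
  intros Hab HF HG E k x Hk Hx.
  rewrite <- (jet_Derive_on_n n a b (F O) F) by auto.
  apply (jet_Derive_on_n n a b (F O) G); auto.
Qed.
End Derive_on.

Notation RR := R_CompleteNormedModule.

Lemma scal_product_rule_aux {W : ModuleSpace R_Ring} (y l a : R) (u m : W) :
  plus (scal (y * l) u) (scal a (scal y m)) = scal y (plus (scal l u) (scal a m)).
Proof.
  rewrite scal_distr_l, !scal_assoc. unfold mult; simpl.
  rewrite (Rmult_comm a y). reflexivity.
Qed.

Section Closure.
Context {V : CompleteNormedModule R_AbsRing}.

Lemma is_derive_scal_fct (a : R -> R) (f : R -> V) (x : R) (l : R) (m : V) :
  is_derive a x l -> is_derive f x m ->
  is_derive (fun t => scal (a t) (f t)) x (plus (scal l (f x)) (scal (a x) m)).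
Proof.
  intros Ha Hf.
  eapply filterdiff_ext_lin.
  - apply (filterdiff_scal_fct (V := V) x a f (fun y => scal y l) (fun y => scal y m)).
    intros; apply Rmult_comm. exact Ha. exact Hf.
  - intros y; simpl.
    exact (scal_product_rule_aux (W := V) y l (a x) (f x) m).
Qed.

Lemma Cg_const (n : nat) (c : V) : Cg n (fun _ => c).
Proof.
  revert c; induction n; intros c; simpl.
  - intros; apply continuous_const.
  - exists (fun _ => zero). split; auto. intros. apply (is_derive_const (V := V)).
Qed.

Lemma Cg_plus (n : nat) (f g : R -> V) :
  Cg n f -> Cg n g -> Cg n (fun x => plus (f x) (g x)).
Proof.
  revert f g; induction n; intros f g Hf Hg; simpl.
  - intros; apply (continuous_plus (V := V)); [apply Hf|apply Hg].
  - destruct Hf as [f' [Hf1 Hf2]], Hg as [g' [Hg1 Hg2]].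
    exists (fun x => plus (f' x) (g' x)). split; auto.
    intros; apply (is_derive_plus (V := V)); auto.
Qed.

Lemma Cg_scal (n : nat) (a : R -> R) (f : R -> V) :
  Cg (V := RR) n a -> Cg n f -> Cg n (fun x => scal (a x) (f x)).
Proof.
  revert a f; induction n; intros a f Ha Hf.
  - intros x; apply (continuous_scal (V := V)); [apply Ha|apply Hf].
  - assert (Ha' := Cg_pred _ _ Ha). assert (Hf' := Cg_pred _ _ Hf).
    destruct Ha as [a' [Ha1 Ha2]], Hf as [f' [Hf1 Hf2]].
    exists (fun x => plus (scal (a' x) (f x)) (scal (a x) (f' x))). split.
    + intros; apply is_derive_scal_fct; auto. 
    + apply Cg_plus; apply IHn; auto.
Qed.

Lemma Cg_comp (n : nat) (f : R -> V) (h : R -> R) :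
  Cg n f -> Cg (V := RR) n h -> Cg n (fun x => f (h x)).
Proof.
  revert f; induction n; intros f Hf Hh.
  - intros x. apply continuous_comp; [apply Hh|apply Hf].
  - assert (Hh' := Cg_pred _ _ Hh).
    destruct Hf as [f' [Hf1 Hf2]], Hh as [h' [Hh1 Hh2]].
    exists (fun x => scal (h' x) (f' (h x))). split.
    + intros x. apply (is_derive_comp (V := V)); auto.
    + apply Cg_scal; auto.
Qed.

Lemma Ck_on_const (n : nat) (a b : R) (c : V) : Ck_on n a b (fun _ => c).
Proof. apply (Cg_Ck_on n a b _ (fun _ => c)); auto. apply Cg_const. Qed.

Lemma Ck_on_scal (n : nat) (a b : R) (u : R -> R) (f : R -> V) : a < b ->
  Ck_on (V := RR) n a b u -> Ck_on n a b f -> Ck_on n a b (fun x => scal (u x) (f x)).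
Proof.
  intros Hab Hu Hf.
  destruct (Ck_on_extend _ _ _ _ Hab Hu) as [U [U1 U2]].
  destruct (Ck_on_extend _ _ _ _ Hab Hf) as [F [F1 F2]].
  apply (Cg_Ck_on n a b _ (fun x => scal (U x) (F x))). apply Cg_scal; auto.
  intros; rewrite U2, F2; auto.
Qed.

Lemma Ck_on_comp (n : nat) (a b c d : R) (f : R -> V) (h : R -> R) :
  a < b -> c < d -> Ck_on n c d f -> Ck_on (V := RR) n a b h ->
  (forall x, Icc a b x -> Icc c d (h x)) -> Ck_on n a b (fun x => f (h x)).
Proof.
  intros Hab Hcd Hf Hh E.
  destruct (Ck_on_extend _ _ _ _ Hcd Hf) as [F [F1 F2]].
  destruct (Ck_on_extend _ _ _ _ Hab Hh) as [H [H1 H2]].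
  apply (Cg_Ck_on n a b _ (fun x => F (H x))). apply Cg_comp; auto.
  intros; rewrite H2 by auto. apply F2. auto.
Qed.

Lemma Ck_on_succ (n : nat) (a b : R) (f g : R -> V) :
  (forall x, Icc a b x -> is_derive_on a b f x (g x)) -> Ck_on n a b g ->
  Ck_on (S n) a b f.
Proof. intros. exists g; auto. Qed.

Lemma Ck_on_pred (n : nat) (a b : R) (f : R -> V) : a < b ->
  Ck_on (S n) a b f -> Ck_on n a b f.
Proof.
  intros Hab H. destruct (Ck_on_extend _ _ _ _ Hab H) as [F [F1 F2]].
  apply (Cg_Ck_on n a b f F); auto. apply Cg_pred; auto.
Qed.

Lemma Ck_on_le (n m : nat) (a b : R) (f : R -> V) : a < b -> (m <= n)%nat ->
  Ck_on n a b f -> Ck_on m a b f.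
Proof. intros Hab. induction 1; auto. intros; apply IHle, Ck_on_pred; auto. Qed.
End Closure.

Lemma Cg_id (n : nat) : Cg (V := RR) n (fun x => x).
Proof.
  destruct n; simpl. intros; apply continuous_id.
  exists (fun _ => 1). split. intros; apply (is_derive_id (K := R_AbsRing)).
  apply Cg_const.
Qed.

Lemma Cg_affine (n : nat) (u v : R) : Cg (V := RR) n (fun x => u + v * x).
Proof.
  apply (Cg_plus (V := RR) n (fun _ => u) (fun x => v * x)). apply Cg_const.
  apply (Cg_scal (V := RR) n (fun _ => v) (fun x => x)). apply Cg_const.
  apply Cg_id.
Qed.

Lemma Cg_RtoC (n : nat) (f : R -> R) :
  Cg (V := RR) n f -> Cg (V := CR) n (fun x => RtoC (f x)).
Proof.
  revert f; induction n; intros f H.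
  - intros x. apply filterlim_RtoC, H.
  - destruct H as [g [H1 H2]]. exists (fun x => RtoC (g x)). split; auto.
    intros; apply is_derive_RtoC, H1.
Qed.

Lemma Cg_Cmult (n : nat) (f g : R -> C) :
  Cg (V := CR) n f -> Cg (V := CR) n g -> Cg (V := CR) n (fun x => (f x * g x)%C).
Proof.
  revert f g; induction n; intros f g Hf Hg.
  - intros x. apply filterlim_Cmult; [apply Hf|apply Hg].
  - assert (Hf' := Cg_pred _ _ Hf). assert (Hg' := Cg_pred _ _ Hg).
    destruct Hf as [f' [Hf1 Hf2]], Hg as [g' [Hg1 Hg2]].
    exists (fun x => (f' x * g x + f x * g' x)%C). split.
    + intros; apply is_derive_Cmult; auto.
    + apply (Cg_plus (V := CR)); apply IHn; auto.
Qed.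

Lemma Ck_on_RtoC (n : nat) (a b : R) (f : R -> R) : a < b ->
  Ck_on (V := RR) n a b f -> Ck_on (V := CR) n a b (fun x => RtoC (f x)).
Proof.
  intros Hab Hf.
  destruct (Ck_on_extend _ _ _ _ Hab Hf) as [F [F1 F2]].
  apply (Cg_Ck_on (V := CR) n a b _ (fun x => RtoC (F x))). apply Cg_RtoC; auto.
  intros; rewrite F2; auto.
Qed.

Lemma Ck_on_Cmult (n : nat) (a b : R) (f g : R -> C) : a < b ->
  Ck_on (V := CR) n a b f -> Ck_on (V := CR) n a b g ->
  Ck_on (V := CR) n a b (fun x => (f x * g x)%C).
Proof.
  intros Hab Hf Hg.
  destruct (Ck_on_extend _ _ _ _ Hab Hf) as [F [F1 F2]].
  destruct (Ck_on_extend _ _ _ _ Hab Hg) as [G [G1 G2]].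
  apply (Cg_Ck_on (V := CR) n a b _ (fun x => (F x * G x)%C)). apply Cg_Cmult; auto.
  intros; rewrite F2, G2; auto.
Qed.

Lemma Ck_on_Rmult (n : nat) (a b : R) (f g : R -> R) : a < b ->
  Ck_on (V := RR) n a b f -> Ck_on (V := RR) n a b g ->
  Ck_on (V := RR) n a b (fun x => f x * g x).
Proof. intros. apply (Ck_on_scal (V := RR) n a b f g); auto. Qed.

Lemma is_derive_Rpower (f : R -> R) (x l al : R) : is_derive f x l -> 0 < f x ->
  is_derive (fun t => Rpower (f t) al) x (al * Rpower (f x) (al - 1) * l).
Proof.
  intros H P. unfold Rpower at 1.
  eapply is_derive_Req.
  - apply (is_derive_comp exp (fun t => al * ln (f t))). apply is_derive_exp.
    apply (is_derive_scal (fun t => ln (f t))).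
    apply (is_derive_comp ln f); [|eassumption].
    apply is_derive_Reals, derivable_pt_lim_ln, P.
  - unfold scal; simpl; unfold mult; simpl.
    change (exp (al * ln (f x))) with (Rpower (f x) al).
    replace (Rpower (f x) al) with (Rpower (f x) (al - 1) * f x).
    field; lra.
    rewrite <- (Rpower_1 (f x) P) at 2. rewrite <- Rpower_plus. f_equal; ring.
Qed.

Lemma Ck_on_Rpower_id (n : nat) (m M al : R) : 0 < m -> m < M ->
  Ck_on (V := RR) n m M (fun x => Rpower x al).
Proof.
  intros Hm HmM. revert al; induction n; intros al.
  - apply (continuous_on_of (V := RR)). intros x Hx.
    eapply (derive_continuous (V := RR)), (is_derive_Rpower (fun t => t)). apply (is_derive_id (K := R_AbsRing)).
    unfold Icc in Hx; lra.
  - apply Ck_on_succ with (fun x => al * Rpower x (al - 1)).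
    + intros x Hx. apply (is_derive_on_of (V := RR)).
      eapply is_derive_Req. apply (is_derive_Rpower (fun t => t)).
      apply (is_derive_id (K := R_AbsRing)). unfold Icc in Hx; lra.
      unfold one; simpl. ring.
    + apply (Ck_on_Rmult n m M (fun _ => al)); auto. apply (Ck_on_const (V := RR)).
Qed.

Lemma Ck_on_bounds (n : nat) (a b : R) (f : R -> R) : a < b ->
  Ck_on (V := RR) n a b f ->
  exists u v, Icc a b u /\ Icc a b v /\ forall x, Icc a b x -> f u <= f x <= f v.
Proof.
  intros Hab H. destruct (Ck_on_extend _ _ _ _ Hab H) as [F [F1 F2]].
  assert (HC : forall c, a <= c <= b -> continuity_pt F c).
  { intros. apply continuity_pt_filterlim. apply (Cg_continuous _ _ F1 c). }
  destruct (continuity_ab_min F a b) as [u [U1 U2]]; auto. lra.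
  destruct (continuity_ab_maj F a b) as [v [V1 V2]]; auto. lra.
  exists u, v. split; auto. split; auto. intros x Hx.
  rewrite <- !F2; auto.
Qed.

Lemma Ck_on_Rpower (n : nat) (a b : R) (f : R -> R) (al : R) : a < b ->
  Ck_on (V := RR) n a b f -> (forall x, Icc a b x -> 0 < f x) ->
  Ck_on (V := RR) n a b (fun x => Rpower (f x) al).
Proof.
  intros Hab H P. destruct (Ck_on_bounds _ _ _ _ Hab H) as [u [v [Hu [Hv E]]]].
  (* The upper bound is raised by 1 so that the target interval is nondegenerate even for constant
     [f]. *)
  apply (Ck_on_comp (V := RR) n a b (f u) (f v + 1) (fun x => Rpower x al) f); auto.
  - specialize (E u Hu). lra.
  - apply Ck_on_Rpower_id. auto. specialize (E u Hu). lra.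
  - intros x Hx. specialize (E x Hx). unfold Icc; lra.
Qed.

Lemma filterlim_Rinv {T : Type} {F : (T -> Prop) -> Prop} {FF : Filter F}
  (f : T -> R) (l : R) : l <> 0 -> filterlim f F (locally l) ->
  filterlim (fun t => / f t) F (locally (/ l)).
Proof.
  intros Hl H. eapply filterlim_comp; [exact H|].
  apply (ex_derive_continuous (V := R_NormedModule) Rinv l).
  auto_derive; auto.
Qed.

(** The mean value theorem is applied to a differentiable extension of [f]; uniqueness of
    derivatives identifies the slope with [f']. *)
Lemma MVT_Ck_on (a b : R) (f f' : R -> R) :
  (forall x, Icc a b x -> is_derive_on (V := RR) a b f x (f' x)) ->
  Ck_on (V := RR) 0 a b f' ->
  forall x y, a <= x -> x < y -> y <= b ->
  exists c, x < c < y /\ f y - f x = f' c * (y - x).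
Proof.
  intros D C x y Hx Hxy Hy.
  assert (Hab : a < b) by lra.
  assert (K : Ck_on (V := RR) 1 a b f) by (exists f'; auto).
  destruct (Ck_on_extend _ _ _ _ Hab K) as [F [[F' [F1 F2]] F3]].
  destruct (MVT_cor2 F F' x y Hxy) as [c [E Hc]].
  { intros. apply is_derive_Reals, F1. }
  exists c. split; auto. rewrite <- !F3 by (unfold Icc; lra).
  rewrite E. f_equal.
  apply (is_derive_on_unique (V := RR) a b f c); auto. unfold Icc; lra.
  - apply (is_derive_on_ext (V := RR) a b F); auto. unfold Icc; lra.
    apply (is_derive_on_of (V := RR)), F1.
  - apply D. unfold Icc; lra.
Qed.

(** * Inverses of increasing functions of class C^n *)

Section Inverse.
Variables (n : nat) (a b : R) (f f' : R -> R).
Hypothesis Hab : a < b.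
Hypothesis D : forall x, Icc a b x -> is_derive_on (V := RR) a b f x (f' x).
Hypothesis C : Ck_on (V := RR) n a b f'.
Hypothesis P : forall x, Icc a b x -> 0 < f' x.

Let h := inverse_on a b f.

(** The constant is the minimum of the positive continuous function [f'] on the compact interval. It
    yields both strict monotonicity and a Lipschitz inverse. *)
Lemma inverse_slope_bound : exists m, 0 < m /\
  forall x y, a <= x -> x <= y -> y <= b -> m * (y - x) <= f y - f x.
Proof.
  destruct (Ck_on_bounds _ _ _ _ Hab C) as [u [v [Hu [Hv E]]]].
  exists (f' u). split; auto. intros x y Hx Hxy Hy.
  destruct Hxy as [Hxy| ->]; [|lra].
  destruct (MVT_Ck_on a b f f' D (Ck_on_le n 0 a b f' Hab (Nat.le_0_l _) C)
    x y Hx Hxy Hy) as [c [Hc ->]].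
  apply Rmult_le_compat_r. lra. apply E. unfold Icc; lra.
Qed.

Lemma inverse_strict (x y : R) : a <= x -> x < y -> y <= b -> f x < f y.
Proof.
  intros. destruct inverse_slope_bound as [m [Hm H2]].
  specialize (H2 x y). nra.
Qed.

Lemma inverse_injective (x y : R) : Icc a b x -> Icc a b y -> f x = f y -> x = y.
Proof.
  intros [] [] E. destruct (Rtotal_order x y) as [L|[L|L]]; auto.
  generalize (inverse_strict x y). lra. generalize (inverse_strict y x). lra.
Qed.

Lemma inverse_range (x : R) : Icc a b x -> Icc (f a) (f b) (f x).
Proof.
  intros []. destruct inverse_slope_bound as [m [Hm H2]].
  split; [generalize (H2 a x)|generalize (H2 x b)]; nra.
Qed.

Lemma inverse_spec (s : R) : Icc (f a) (f b) s -> Icc a b (h s) /\ f (h s) = s.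
Proof.
  intros Hs. unfold h, inverse_on.
  apply (epsilon_spec (inhabits 0) (fun x => Icc a b x /\ f x = s)).
  assert (K : Ck_on (V := RR) 1 a b f).
  { exists f'; split; auto. apply (Ck_on_le n 0); auto. lia. }
  destruct (Ck_on_extend _ _ _ _ Hab K) as [F [F1 F2]].
  destruct (IVT_gen F a b s) as [x [Hx Ex]].
  - intros x. apply continuity_pt_filterlim, (Cg_continuous _ _ F1).
  - rewrite !F2 by (unfold Icc; lra).
    rewrite Rmin_left, Rmax_right; auto; unfold Icc in Hs; lra.
  - rewrite Rmin_left, Rmax_right in Hx by lra.
    exists x. split; auto. rewrite <- F2; auto.
Qed.

Lemma inverse_left (x : R) : Icc a b x -> h (f x) = x.
Proof.
  intros Hx. destruct (inverse_spec (f x)). apply inverse_range; auto.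
  apply inverse_injective; auto.
Qed.

Lemma inverse_lipschitz : exists M, 0 < M /\ forall s t,
  Icc (f a) (f b) s -> Icc (f a) (f b) t -> Rabs (h s - h t) <= M * Rabs (s - t).
Proof.
  destruct inverse_slope_bound as [m [Hm H2]].
  assert (W : forall s t, Icc (f a) (f b) s -> Icc (f a) (f b) t -> h s <= h t ->
    h t - h s <= / m * (t - s)).
  { intros s t Hs Ht L. destruct (inverse_spec s Hs) as [[] E1].
    destruct (inverse_spec t Ht) as [[] E2].
    apply Rmult_le_reg_l with m; auto. rewrite <- Rmult_assoc, Rinv_r, Rmult_1_l by lra.
    rewrite <- E1, <- E2 at 2. apply H2; auto. }
  exists (/ m). split. apply Rinv_0_lt_compat; auto.
  assert (0 < / m) by (apply Rinv_0_lt_compat; auto).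
  intros s t Hs Ht. destruct (Rle_dec (h s) (h t)) as [L|L].
  - rewrite Rabs_left1 by lra. generalize (W s t Hs Ht L). intros.
    apply Rle_trans with (/ m * (t - s)). lra. apply Rmult_le_compat_l. lra.
    rewrite Rabs_minus_sym. apply Rle_abs.
  - rewrite Rabs_pos_eq by lra. assert (L' : h t <= h s) by lra.
    generalize (W t s Ht Hs L'). intros.
    apply Rle_trans with (/ m * (s - t)). lra. apply Rmult_le_compat_l. lra.
    apply Rle_abs.
Qed.

Lemma inverse_derive (s : R) : Icc (f a) (f b) s ->
  is_derive_on (V := RR) (f a) (f b) h s (/ f' (h s)).
Proof.
  intros Hs. destruct (inverse_spec s Hs) as [Hx Ex].
  assert (Hh : filterlim h (within (Icc (f a) (f b)) (locally' s))
    (within (Icc a b) (locally' (h s)))).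
  { intros Q [eps HQ]. destruct inverse_lipschitz as [M [HM L]].
    assert (Hd : 0 < eps / M) by (apply Rdiv_lt_0_compat; [apply cond_pos|auto]).
    exists (mkposreal _ Hd). intros t Ht Hn Hi.
    destruct (inverse_spec t Hi) as [Ht1 Ht2].
    apply HQ; auto.
    - unfold ball in *; simpl in *; unfold AbsRing_ball, abs, minus, plus, opp in *; simpl in *.
      eapply Rle_lt_trans; [apply (L t s Hi Hs)|].
      apply Rmult_lt_reg_l with (/ M). apply Rinv_0_lt_compat; auto.
      rewrite <- Rmult_assoc, Rinv_l, Rmult_1_l by lra. 
      unfold Rminus. rewrite (Rmult_comm (/ M)). exact Ht.
    - intros E. apply Hn. congruence. }
  assert (G : filterlim (fun t => / (/ (h t - h s) * (f (h t) - f (h s))))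
    (within (Icc (f a) (f b)) (locally' s)) (locally (/ f' (h s)))).
  { assert (F1 : Filter (within (Icc (f a) (f b)) (locally' s)))
      by (apply within_filter, within_filter, locally_filter).
    apply (filterlim_Rinv (F := within (Icc (f a) (f b)) (locally' s))).
    apply Rgt_not_eq, P; auto.
    apply (filterlim_comp _ _ _ h (fun x => / (x - h s) * (f x - f (h s))) _ _ _ Hh).
    exact (D (h s) Hx). }
  unfold is_derive_on. intros Q HQ. generalize (G Q HQ).
  unfold filtermap, within, locally', within. apply filter_imp.
  intros t Ht Hn Hi. specialize (Ht Hn Hi).
  destruct (inverse_spec t Hi) as [Ht1 Ht2].
  (* The difference quotient of [h] is the reciprocal of that of [f]; the divisions are legitimate
     because [t <> s] forces [h t <> h s]. *)
  assert (E : / (/ (h t - h s) * (f (h t) - f (h s))) = / (t - s) * (h t - h s)).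
  { rewrite Ht2, Ex. field. split; [lra|]. intros E. apply Hn.
    rewrite <- Ex, <- Ht2. f_equal. lra. }
  rewrite E in Ht. exact Ht.
Qed.

(** A bootstrap: the derivative 1/f'(h) is as smooth as [h] up to order [n], so each round gains one
    order, and the last one reaches [S n]. *)
Lemma inverse_Ck : Ck_on (V := RR) (S n) (f a) (f b) h.
Proof.
  assert (Hf : f a < f b) by (apply inverse_strict; lra).
  assert (W : forall k, (k <= S n)%nat -> Ck_on (V := RR) k (f a) (f b) h); [|auto].
  induction k; intros Hk.
  - intros s Hs. eapply (is_derive_on_continuous (V := RR)), inverse_derive, Hs.
  - apply Ck_on_succ with (fun s => / f' (h s)). apply inverse_derive.
    apply (Ck_on_ext (V := RR) k _ _ (fun s => Rpower (f' (h s)) (- (1)))); auto.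
    + intros s Hs. rewrite Rpower_Ropp, Rpower_1; auto. apply P, inverse_spec, Hs.
    + apply (Ck_on_Rpower k _ _ (fun s => f' (h s))); auto.
      * apply (Ck_on_comp (V := RR) k _ _ a b f' h); auto.
        apply (Ck_on_le n); auto. lia. apply IHk; lia.
        intros; apply inverse_spec; auto.
      * intros s Hs. apply P, inverse_spec, Hs.
Qed.
End Inverse.

(** * Improper integrals *)

Definition convex (D : R -> Prop) : Prop :=
  forall x y z, D x -> D y -> x <= z <= y -> D z.

Lemma convex_gt (a : R) : convex (fun t => a < t).
Proof. intros x y z; lra. Qed.

Lemma convex_minmax (D : R -> Prop) (x y z : R) : convex D -> D x -> D y ->
  Rmin x y <= z <= Rmax x y -> D z.
Proof.
  intros HD Hx Hy. unfold Rmin, Rmax. destruct (Rle_dec x y); intros.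
  apply (HD x y); auto. apply (HD y x); auto; lra.
Qed.

Lemma minus_minus_l {G : AbelianGroup} (y u v : G) :
  minus (minus y u) (minus y v) = minus v u.
Proof.
  unfold minus at 1. rewrite opp_minus, plus_comm.
  symmetry. apply minus_trans.
Qed.

Lemma minus_minus_r {G : AbelianGroup} (x u v : G) :
  minus v u = minus (minus v x) (minus u x).
Proof.
  unfold minus at 2. rewrite opp_minus. apply minus_trans.
Qed.

Lemma norm_minus_sym {V : NormedModule R_AbsRing} (u v : V) :
  norm (minus u v) = norm (minus v u).
Proof. rewrite <- (norm_opp (minus u v)), opp_minus. reflexivity. Qed.

Lemma norm_minus_triangle {V : NormedModule R_AbsRing} (u v l : V) :
  norm (minus u v) <= norm (minus u l) + norm (minus v l).
Proof.
  rewrite (minus_trans l). eapply Rle_trans; [apply norm_triangle|].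
  rewrite (norm_minus_sym v l). apply Rle_refl.
Qed.

(** The way improper integrals are evaluated below. The set [D] holds the points where the primitive
    is known; both ends of integration eventually lie in it. *)
Lemma is_RInt_gen_primitive {V : NormedModule R_AbsRing}
  {Fa Fb : (R -> Prop) -> Prop} {FFa : Filter Fa} {FFb : Filter Fb}
  (D : R -> Prop) (f P : R -> V) (la lb : V) :
  Fa D -> Fb D -> (forall x y, D x -> D y -> is_RInt f x y (minus (P y) (P x))) ->
  filterlim P Fa (locally la) -> filterlim P Fb (locally lb) ->
  is_RInt_gen f Fa Fb (minus lb la).
Proof.
  intros Da Db HI Ha Hb Q HQ.
  assert (L : filterlim (fun ab => minus (P (snd ab)) (P (fst ab)))
    (filter_prod Fa Fb) (locally (minus lb la))).
  { unfold minus.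
    apply (filterlim_comp_2 (G := locally lb) (H := locally (opp la))).
    - eapply filterlim_comp; [apply filterlim_snd|exact Hb].
    - eapply filterlim_comp; [|apply (filterlim_opp la)].
      eapply filterlim_comp; [apply filterlim_fst|exact Ha].
    - apply filterlim_plus. }
  assert (DD : filter_prod Fa Fb (fun ab => D (fst ab) /\ D (snd ab))).
  { apply (Filter_prod _ _ _ D D); auto. }
  assert (LQ := L Q HQ). unfold filtermap in LQ.
  unfold filtermapi.
  generalize (filter_and _ _ DD LQ). apply filter_imp.
  intros [x y] [[Hx Hy] Hq]. exists (minus (P y) (P x)). split; auto.
Qed.

Lemma is_RInt_gen_primitive_derive {V : CompleteNormedModule R_AbsRing}
  {Fa Fb : (R -> Prop) -> Prop} {FFa : Filter Fa} {FFb : Filter Fb}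
  (D : R -> Prop) (f P : R -> V) (la lb : V) :
  convex D -> Fa D -> Fb D ->
  (forall x, D x -> is_derive P x (f x)) -> (forall x, D x -> continuous f x) ->
  filterlim P Fa (locally la) -> filterlim P Fb (locally lb) ->
  is_RInt_gen f Fa Fb (minus lb la).
Proof.
  intros HD Da Db H1 H2. apply (is_RInt_gen_primitive (V := V) D); auto.
  intros x y Hx Hy. apply (is_RInt_derive (V := V)); intros z Hz;
    [apply H1|apply H2]; apply (convex_minmax D x y); auto.
Qed.

Section Limits.
Context {V : CompleteNormedModule R_AbsRing}.
Variables (D : R -> Prop) (f : R -> V) (h : R -> R) (c : R).
Hypothesis HD : convex D.
Hypothesis Hc : D c.
Hypothesis Cf : forall x, D x -> continuous f x.

Lemma ex_RInt_convex (x y : R) : D x -> D y -> ex_RInt f x y.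
Proof.
  intros. apply ex_RInt_continuous. intros z Hz. apply Cf.
  apply (convex_minmax D x y); auto.
Qed.

Lemma is_RInt_convex (x y : R) : D x -> D y ->
  is_RInt f x y (minus (RInt f c y) (RInt f c x)).
Proof.
  intros Hx Hy.
  assert (E : plus (RInt f x c) (RInt f c y) = minus (RInt f c y) (RInt f c x)).
  { rewrite <- (opp_RInt_swap f c x). apply (plus_comm (G := V)).
    apply ex_RInt_convex; auto. }
  rewrite <- E.
  apply (is_RInt_Chasles (V := V)) with c; apply RInt_correct, ex_RInt_convex; auto.
Qed.

End Limits.

Lemma RInt_dominated {V : CompleteNormedModule R_AbsRing}
  (D : R -> Prop) (f : R -> V) (h : R -> R) (c x y : R) :
  convex D -> D c -> D x -> D y ->
  (forall x, D x -> continuous f x) -> (forall x, D x -> continuous h x) ->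
  (forall x, D x -> norm (f x) <= h x) ->
  norm (minus (RInt f c y) (RInt f c x)) <= Rabs (RInt h c y - RInt h c x).
Proof.
  intros HD Hc Hx Hy Cf Ch H.
  assert (W : forall u v, D u -> D v -> u <= v ->
    norm (minus (RInt f c v) (RInt f c u)) <= Rabs (RInt h c v - RInt h c u)).
  { intros u v Hu Hv Huv. eapply Rle_trans; [|apply Rle_abs].
    apply (norm_RInt_le f h u v); auto.
    - intros z Hz. apply H, (HD u v); auto.
    - apply (is_RInt_convex D f c HD Hc Cf); auto.
    - apply (is_RInt_convex (V := RR) D h c HD Hc Ch); auto. }
  destruct (Rle_dec x y); auto.
  rewrite Rabs_minus_sym.
  eapply Rle_trans; [right; apply (norm_minus_sym (V := V))|].
  apply W; auto. lra.
Qed.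

(** The Cauchy criterion passes from the primitive of the majorant [h] to the primitive of [f]. *)
Lemma limit_dominated {V : CompleteNormedModule R_AbsRing}
  {F : (R -> Prop) -> Prop} {FF : ProperFilter F}
  (D : R -> Prop) (f : R -> V) (h : R -> R) (c : R) :
  convex D -> D c -> F D ->
  (forall x, D x -> continuous f x) -> (forall x, D x -> continuous h x) ->
  (forall x, D x -> norm (f x) <= h x) ->
  (exists l, filterlim (RInt h c) F (locally l)) ->
  exists l, filterlim (RInt f c) F (locally l).
Proof.
  intros HD Hc FD Cf Ch H Hl.
  apply (filterlim_locally_cauchy (U := V)). intros eps.
  destruct (proj2 (filterlim_locally_cauchy (U := R_CompleteSpace) (RInt h c)) Hl eps)
    as [Q [HQ Q2]].
  exists (fun x => D x /\ Q x). split. apply filter_and; auto.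
  intros u v [Du Qu] [Dv Qv]. apply (norm_compat1 (V := V)).
  eapply Rle_lt_trans; [apply (RInt_dominated D f h c u v); auto|].
  exact (Q2 u v Qu Qv).
Qed.

(** A converse of [is_RInt_gen_primitive]. Convergence is joint in the two ends; freezing one end at
    an admissible point turns it into a Cauchy condition at the other. *)
Lemma RInt_gen_limits {V : CompleteNormedModule R_AbsRing}
  {Fa Fb : (R -> Prop) -> Prop} {FFa : ProperFilter Fa} {FFb : ProperFilter Fb}
  (D : R -> Prop) (f : R -> V) (c : R) :
  convex D -> D c -> Fa D -> Fb D -> (forall x, D x -> continuous f x) ->
  ex_RInt_gen f Fa Fb ->
  (exists la, filterlim (RInt f c) Fa (locally la)) /\
  (exists lb, filterlim (RInt f c) Fb (locally lb)).
Proof.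
  intros HD Hc Da Db Cf [l Hl].
  assert (W : forall eps : posreal, filter_prod Fa Fb (fun ab =>
    (D (fst ab) /\ D (snd ab)) /\
    ball_norm l eps (minus (RInt f c (snd ab)) (RInt f c (fst ab))))).
  { intros eps.
    generalize (Hl (ball_norm l eps) (locally_ball_norm l eps)). intros A.
    assert (B : filter_prod Fa Fb (fun ab => D (fst ab) /\ D (snd ab))).
    { apply (Filter_prod _ _ _ D D); auto. }
    generalize (filter_and _ _ B A). apply filter_imp.
    intros [x y] [[Dx Dy] [z [Hz1 Hz2]]]. split; auto.
    assert (I := is_RInt_unique _ _ _ _ (is_RInt_convex D f c HD Hc Cf x y Dx Dy)).
    simpl in *. rewrite (is_RInt_unique _ _ _ _ Hz1) in I. rewrite I in Hz2.
    exact Hz2. }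
  assert (T : forall eps : posreal, exists Q S, Fa Q /\ Fb S /\
    forall x x' y y', Q x -> Q x' -> S y -> S y' ->
      norm (minus (minus (RInt f c y) (RInt f c x))
             (minus (RInt f c y') (RInt f c x'))) < eps).
  { intros eps.
    assert (He : 0 < eps / 2) by (destruct eps; simpl; lra).
    destruct (W (mkposreal _ He)) as [Q S HQ HS HQS].
    exists Q, S. split; auto. split; auto. intros x x' y y' Hx Hx' Hy Hy'.
    destruct (HQS x y Hx Hy) as [_ A]. destruct (HQS x' y' Hx' Hy') as [_ B].
    unfold ball_norm in A, B; simpl in A, B.
    set (u := minus (RInt f c y) (RInt f c x)) in *.
    set (v := minus (RInt f c y') (RInt f c x')) in *.
    apply Rle_lt_trans with (norm (minus u l) + norm (minus v l));
      [|replace (pos eps) with (eps / 2 + eps / 2) by lra;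
        apply Rplus_lt_compat; [exact A|exact B]].
    exact (norm_minus_triangle (V := V) u v l). }
  split; apply (filterlim_locally_cauchy (U := V)); intros eps;
    destruct (T eps) as [Q [S [HQ [HS H]]]].
  - exists Q. split; auto. intros u v Qu Qv.
    destruct (filter_ex _ HS) as [y Hy]. specialize (H v u y y Qv Qu Hy Hy).
    apply (norm_compat1 (V := V)).
    rewrite (minus_minus_l (G := V)), (norm_minus_sym (V := V)) in H. exact H.
  - exists S. split; auto. intros u v Su Sv.
    destruct (filter_ex _ HQ) as [x Hx]. specialize (H x x v u Hx Hx Sv Su).
    apply (norm_compat1 (V := V)).
    replace (minus (minus (RInt f c v) (RInt f c x)) (minus (RInt f c u) (RInt f c x)))
      with (minus (RInt f c v) (RInt f c u)) in H; auto.
    apply (minus_minus_r (G := V)).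
Qed.

Lemma ex_RInt_gen_dominated {V : CompleteNormedModule R_AbsRing}
  {Fa Fb : (R -> Prop) -> Prop} {FFa : ProperFilter Fa} {FFb : ProperFilter Fb}
  (D : R -> Prop) (f : R -> V) (h : R -> R) :
  convex D -> Fa D -> Fb D ->
  (forall x, D x -> continuous f x) -> (forall x, D x -> continuous h x) ->
  (forall x, D x -> norm (f x) <= h x) ->
  ex_RInt_gen h Fa Fb -> ex_RInt_gen f Fa Fb.
Proof.
  intros HD Da Db Cf Ch H Hh.
  destruct (filter_ex _ Da) as [c Hc].
  destruct (RInt_gen_limits (V := RR) D h c HD Hc Da Db Ch Hh) as [La Lb].
  destruct (limit_dominated D f h c HD Hc Da Cf Ch H La) as [la Hla].
  destruct (limit_dominated D f h c HD Hc Db Cf Ch H Lb) as [lb Hlb].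
  exists (minus lb la).
  apply (is_RInt_gen_primitive (V := V) D f (RInt f c)); auto.
  intros. apply (is_RInt_convex D f c HD Hc Cf); auto.
Qed.

(** The ray integrals of the statement start at the point 0 itself, while the analysis is done on t
    > 0. Replacing [f t] by [f (Rmax a t)] makes the integrand continuous everywhere, so its
    primitive is continuous at [a] and both readings agree. *)
Lemma is_RInt_gen_at_right_point {V : CompleteNormedModule R_AbsRing}
  {Fb : (R -> Prop) -> Prop} {FFb : ProperFilter Fb} (a : R) (f : R -> V) (l : V) :
  Fb (fun t => a < t) -> (forall x, a <= x -> continuous f x) ->
  is_RInt_gen f (at_right a) Fb l -> is_RInt_gen f (at_point a) Fb l.
Proof.
  intros Hb Cf Hl.
  set (g := fun t => f (Rmax a t)).
  assert (Cg : forall x, continuous g x).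
  { intros x. apply (continuous_comp (fun t => Rmax a t) f); [|apply Cf, Rmax_l].
    apply continuous_Rmax_l. }
  assert (E : forall t, a <= t -> g t = f t).
  { intros; unfold g; rewrite Rmax_right; auto. }
  set (P := RInt g (a + 1)).
  assert (DP : forall x, continuous P x).
  { intros x. apply (ex_derive_continuous (V := V)). exists (g x).
    apply (is_derive_RInt (V := V)) with (a + 1); auto.
    apply filter_forall. intros. apply RInt_correct, ex_RInt_continuous; auto. }
  set (D := fun t => a <= t).
  assert (HD : convex D) by (intros x y z; unfold D; lra).
  assert (HDc : D (a + 1)) by (unfold D; lra).
  assert (Hb' : Fb D) by (revert Hb; apply filter_imp; unfold D; intros; lra).
  assert (Hr : at_right a D).
  { unfold at_right, within. apply filter_forall. unfold D; intros; lra. }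
  assert (Hl' : is_RInt_gen g (at_right a) Fb l).
  { apply (is_RInt_gen_ext (V := V) f g); auto.
    apply (Filter_prod _ _ _ D D); auto. unfold D; simpl.
    intros x y Hx Hy z Hz. symmetry. apply E. unfold Rmin in Hz.
    destruct Rle_dec; lra. }
  destruct (RInt_gen_limits (V := V) D g (a + 1) HD HDc Hr Hb' (fun x _ => Cg x)
    (ex_intro _ l Hl')) as [_ [lb Hlb]].
  assert (PI : forall x y, D x -> D y -> is_RInt g x y (minus (P y) (P x))).
  { intros. apply (is_RInt_convex D g (a + 1)); auto. }
  assert (La : filterlim P (at_right a) (locally (P a))).
  { apply (continuous_at_right (V := V)), DP. }
  assert (El : l = minus lb (P a)).
  { rewrite <- (is_RInt_gen_unique g l Hl'). apply is_RInt_gen_unique.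
    apply (is_RInt_gen_primitive (V := V) D g P); auto. }
  rewrite El.
  apply (is_RInt_gen_ext (V := V) g f).
  { apply (Filter_prod _ _ _ D D); auto. unfold at_point, D; lra. unfold D; simpl.
    intros x y Hx Hy z Hz. apply E. unfold Rmin in Hz.
    destruct Rle_dec; lra. }
  apply (is_RInt_gen_primitive (V := V) D g P); auto. unfold at_point, D; lra.
  intros Q [eps HQ]. apply HQ, ball_center.
Qed.

Lemma at_right_gt (a : R) : at_right a (fun t => a < t).
Proof. unfold at_right, within. apply filter_forall; auto. Qed.

Lemma at_right_lt (a b : R) : a < b -> at_right a (fun t => t < b).
Proof.
  intros. unfold at_right, within.
  apply (filter_imp (fun t => t < b)); auto. apply (open_lt b a H).
Qed.

Lemma p_infty_gt (a : R) : Rbar_locally p_infty (fun t => a < t).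
Proof. exists a; auto. Qed.

Lemma filterlim_R_eps {T : Type} {F : (T -> Prop) -> Prop} {FF : Filter F}
  (f : T -> R) (l : R) :
  (forall eps, 0 < eps -> F (fun t => Rabs (f t - l) < eps)) ->
  filterlim f F (locally l).
Proof.
  intros H. apply filterlim_locally. intros eps. apply (H eps), cond_pos.
Qed.

Lemma filterlim_Req {T : Type} {F : (T -> Prop) -> Prop} (f : T -> R) (l l' : R) :
  filterlim f F (locally l) -> l = l' -> filterlim f F (locally l').
Proof. intros; subst; auto. Qed.

(** * Powers and exponentials near 0 and infinity *)

Lemma Rpower_pos (x y : R) : 0 < Rpower x y.
Proof. apply exp_pos. Qed.

Lemma Rpower_lt_base (x y a : R) : 0 < a -> 0 < x -> x < y -> Rpower x a < Rpower y a.
Proof. intros. apply Rlt_Rpower_l; auto. Qed.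

Lemma Rpower_le_base (x y a : R) : 0 <= a -> 0 < x -> x <= y -> Rpower x a <= Rpower y a.
Proof. intros. apply Rle_Rpower_l; auto. Qed.

Lemma Rpower_inv_cancel (x a : R) : a <> 0 -> 0 < x -> Rpower (Rpower x (/ a)) a = x.
Proof. intros. rewrite Rpower_mult, Rinv_l, Rpower_1; auto. Qed.

Lemma filterlim_Rpower_0 (a : R) : 0 < a ->
  filterlim (fun t => Rpower t a) (at_right 0) (locally 0).
Proof.
  intros Ha. apply filterlim_R_eps. intros eps He.
  assert (P : 0 < Rpower eps (/ a)) by apply Rpower_pos.
  generalize (filter_and _ _ (at_right_gt 0) (at_right_lt _ _ P)).
  apply filter_imp. intros t [H1 H2]. rewrite Rminus_0_r, Rabs_pos_eq.
  2: left; apply Rpower_pos.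
  rewrite <- (Rpower_inv_cancel eps a) by lra. apply Rpower_lt_base; auto.
Qed.

Lemma filterlim_Rpower_p_infty (a : R) : 0 < a ->
  filterlim (fun t => Rpower t a) (Rbar_locally p_infty) (Rbar_locally p_infty).
Proof.
  intros Ha P [M HM]. exists (Rpower (Rabs M + 1) (/ a)). intros t Ht.
  apply HM. assert (Q := Rabs_pos M). assert (Q2 := Rle_abs M).
  apply Rlt_trans with (Rabs M + 1). lra.
  rewrite <- (Rpower_inv_cancel (Rabs M + 1) a) by lra.
  apply Rpower_lt_base; auto. apply Rpower_pos.
Qed.

Lemma continuous_Rpower (a t : R) : 0 < t -> continuous (fun t => Rpower t a) t.
Proof.
  intros. eapply (derive_continuous (V := R_NormedModule)), (is_derive_Rpower (fun t => t)); auto. apply (is_derive_id (K := R_AbsRing)).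
Qed.

Lemma continuous_exp_neg (f : R -> R) (t : R) :
  continuous f t -> continuous (fun t => exp (- f t)) t.
Proof.
  intros. apply (continuous_comp f (fun u => exp (- u))); auto.
  apply (ex_derive_continuous (V := R_NormedModule)). auto_derive; auto.
Qed.

(** This is e^x >= 1 + x at x = ln (t/k). The free parameter [k] makes the slope as small as
    desired. *)
Lemma ln_le_linear (k t : R) : 0 < k -> 0 < t -> ln t <= t / k + ln k.
Proof.
  intros Hk Ht. assert (P : 0 < t / k) by (apply Rdiv_lt_0_compat; auto).
  replace (ln t) with (ln (t / k) + ln k).
  2:{ unfold Rdiv. rewrite ln_mult, ln_Rinv; auto. ring. apply Rinv_0_lt_compat; auto. }
  generalize (exp_ineq1_le (ln (t / k))). rewrite exp_ln by auto. lra.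
Qed.

Lemma Rpower_le_exp (a e : R) : 0 < e ->
  exists M, 0 < M /\ forall t, 1 <= t -> Rpower t a <= M * exp (e * t).
Proof.
  (* With this [k] the slope |a|/k equals e |a|/(|a| + 1), which is at most [e]; the 1 keeps [k]
     positive when a = 0. *)
  intros He. set (k := (Rabs a + 1) / e).
  assert (Ha := Rabs_pos a).
  assert (Hk : 0 < k) by (apply Rdiv_lt_0_compat; lra).
  exists (exp (Rabs a * ln k)). split. apply exp_pos.
  intros t Ht. rewrite <- exp_plus. unfold Rpower. apply exp_le_inv || idtac.
  assert (L : 0 <= ln t). { rewrite <- ln_1. apply ln_le; lra. }
  assert (L2 := ln_le_linear k t Hk ltac:(lra)).
  assert (a * ln t <= Rabs a * ln k + e * t).
  { apply Rle_trans with (Rabs a * ln t).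
    - apply Rmult_le_compat_r; auto. apply Rle_abs.
    - apply Rle_trans with (Rabs a * (t / k + ln k)).
      apply Rmult_le_compat_l; auto.
      rewrite Rmult_plus_distr_l. 
      assert (Rabs a * (t / k) <= e * t); [|lra].
      unfold k. replace (Rabs a * (t / ((Rabs a + 1) / e)))
        with (e * t * (Rabs a / (Rabs a + 1))) by (field; lra).
      rewrite <- (Rmult_1_r (e * t)) at 2. apply Rmult_le_compat_l. nra.
      apply Rmult_le_reg_r with (Rabs a + 1). lra.
      unfold Rdiv. rewrite Rmult_assoc, Rinv_l; lra. }
  destruct H as [H|H]. left; apply exp_increasing; auto. rewrite H; lra.
Qed.

Lemma filterlim_exp_neg (e : R) : 0 < e ->
  filterlim (fun t => exp (- (e * t))) (Rbar_locally p_infty) (locally 0).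
Proof.
  intros He. apply filterlim_R_eps. intros eps Heps.
  exists (- ln eps / e). intros t Ht.
  rewrite Rminus_0_r, Rabs_pos_eq by (left; apply exp_pos).
  rewrite <- (exp_ln eps) by auto. apply exp_increasing.
  apply (Rmult_lt_compat_l e) in Ht; auto.
  replace (e * (- ln eps / e)) with (- ln eps) in Ht by (field; lra). lra.
Qed.

(** For t >= 1 and rho >= 1 one has t <= t^rho. Half of the resulting linear rate [w] absorbs the
    power, and the other half still tends to 0. *)
Lemma Rpower_exp_vanish (a w rho : R) : 0 < w -> 1 <= rho ->
  filterlim (fun t => Rpower t a * exp (- (w * Rpower t rho)))
    (Rbar_locally p_infty) (locally 0).
Proof.
  intros Hw Hr. destruct (Rpower_le_exp a (w / 2)) as [M [HM H]]; [lra|].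
  assert (L := filterlim_exp_neg (w / 2) ltac:(lra)).
  apply filterlim_R_eps. intros eps He.
  assert (He' : 0 < eps / M) by (apply Rdiv_lt_0_compat; auto).
  generalize (proj1 (filterlim_locally _ _) L (mkposreal _ He')). intros L1.
  generalize (filter_and _ _ L1 (p_infty_gt 1)). apply filter_imp.
  intros t [H1 H2].
  unfold ball in H1; simpl in H1; unfold AbsRing_ball, abs, minus, plus, opp in H1; simpl in H1.
  rewrite Ropp_0, Rplus_0_r, Rabs_pos_eq in H1 by (left; apply exp_pos).
  rewrite Rminus_0_r, Rabs_pos_eq.
  2:{ apply Rmult_le_pos; left; [apply Rpower_pos|apply exp_pos]. }
  apply Rle_lt_trans with (M * exp (w / 2 * t) * exp (- (w * t))).
  - apply Rmult_le_compat; try (left; apply exp_pos). apply H; lra.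
    assert (t <= Rpower t rho).
    { rewrite <- (Rpower_1 t) at 1 by lra. apply Rle_Rpower; lra. }
    assert (w * t <= w * Rpower t rho) by (apply Rmult_le_compat_l; lra).
    destruct (Rle_lt_or_eq_dec _ _ H3). left; apply exp_increasing; lra.
    rewrite e; lra.
  - rewrite Rmult_assoc, <- exp_plus.
    replace (w / 2 * t + - (w * t)) with (- (w / 2 * t)) by field.
    apply (Rmult_lt_compat_l M) in H1; auto.
    replace (M * (eps / M)) with eps in H1 by (field; lra). auto.
Qed.

(** * Euler's Gamma integral *)

Definition gamma_integrand (x t : R) : R := Rpower t (x - 1) * exp (- t).

Lemma gamma_integrand_continuous (x t : R) : 0 < t ->
  continuous (gamma_integrand x) t.
Proof.
  intros. apply continuous_Rmult. apply continuous_Rpower; auto.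
  apply (continuous_exp_neg (fun t => t)), continuous_id.
Qed.

Lemma is_RInt_gen_Rpower_0 (e s : R) : -1 < e -> 0 < s ->
  is_RInt_gen (V := RR) (fun t => Rpower t e) (at_right 0) (at_point s)
    (Rpower s (e + 1) / (e + 1)).
Proof.
  intros He Hs.
  replace (Rpower s (e + 1) / (e + 1))
    with (minus (Rpower s (e + 1) / (e + 1)) 0)
    by (unfold minus, plus, opp; simpl; ring).
  apply (is_RInt_gen_primitive_derive (V := RR) (fun t => 0 < t) _
    (fun t => Rpower t (e + 1) / (e + 1))).
  - apply convex_gt.
  - apply at_right_gt.
  - exact Hs.
  - intros t Ht. unfold Rdiv.
    apply (is_derive_ext (fun t => / (e + 1) * Rpower t (e + 1))).
    intros; apply Rmult_comm.
    eapply is_derive_Req. apply (is_derive_scal (fun t => Rpower t (e + 1))).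
    apply (is_derive_Rpower (fun t => t)); auto. apply (is_derive_id (K := R_AbsRing)).
    unfold one; simpl. replace (e + 1 - 1) with e by ring. field. lra.
  - intros; apply continuous_Rpower; auto.
  - apply (filterlim_Req _ (0 * / (e + 1))); [|apply Rmult_0_l].
    apply (filterlim_Rmult (F := at_right 0)).
    apply filterlim_Rpower_0; lra. apply filterlim_const.
  - intros Q [d HQ]. apply HQ, ball_center.
Qed.

(** Split at 1: below it the integrand is at most t^(x-1), and above it the power is absorbed by
    half of the exponential decay. *)
Lemma ex_gamma (x : R) : 0 < x ->
  ex_RInt_gen (V := RR) (gamma_integrand x) (at_right 0) (Rbar_locally p_infty).
Proof.
  intros Hx.
  assert (E0 : ex_RInt_gen (V := RR) (gamma_integrand x) (at_right 0) (at_point 1)).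
  { apply (ex_RInt_gen_dominated (V := RR) (fun t => 0 < t) _ (fun t => Rpower t (x - 1))).
    - apply convex_gt.
    - apply at_right_gt.
    - unfold at_point; lra.
    - intros; apply gamma_integrand_continuous; auto.
    - intros; apply continuous_Rpower; auto.
    - intros t Ht. unfold norm; simpl; unfold abs; simpl.
      unfold gamma_integrand. rewrite Rabs_pos_eq.
      2:{ apply Rmult_le_pos; left; [apply Rpower_pos|apply exp_pos]. }
      rewrite <- (Rmult_1_r (Rpower t (x - 1))) at 2.
      apply Rmult_le_compat_l. left; apply Rpower_pos.
      rewrite <- exp_0. left; apply exp_increasing; lra.
    - eexists. apply is_RInt_gen_Rpower_0; lra. }
  assert (E1 : ex_RInt_gen (V := RR) (gamma_integrand x) (at_point 1) (Rbar_locally p_infty)).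
  { destruct (Rpower_le_exp (x - 1) (/ 2)) as [M [HM H]]; [lra|].
    apply (ex_RInt_gen_dominated (V := RR) (fun t => 1 <= t) _
      (fun t => M * exp (- (/ 2 * t)))).
    - intros u v z; lra.
    - unfold at_point; lra.
    - apply (filter_imp (fun t => 1 < t)). intros; lra. apply p_infty_gt.
    - intros; apply gamma_integrand_continuous; lra.
    - intros. apply continuous_Rmult. apply continuous_const.
      apply (continuous_exp_neg (fun t => / 2 * t)).
      apply continuous_Rmult. apply continuous_const. apply continuous_id.
    - intros t Ht. unfold norm; simpl; unfold abs; simpl.
      unfold gamma_integrand. rewrite Rabs_pos_eq.
      2:{ apply Rmult_le_pos; left; [apply Rpower_pos|apply exp_pos]. }
      apply Rle_trans with (M * exp (/ 2 * t) * exp (- t)).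
      apply Rmult_le_compat_r. left; apply exp_pos. apply H; auto.
      rewrite Rmult_assoc, <- exp_plus. right. f_equal. f_equal. field.
    - exists (minus 0 (- 2 * M * exp (- (/ 2 * 1)))).
      apply (is_RInt_gen_primitive_derive (V := RR) (fun t => 1 <= t) _
        (fun t => - 2 * M * exp (- (/ 2 * t)))).
      + intros u v z; lra.
      + unfold at_point; lra.
      + apply (filter_imp (fun t => 1 < t)). intros; lra. apply p_infty_gt.
      + intros. auto_derive; auto. field.
      + intros. apply continuous_Rmult. apply continuous_const.
        apply (continuous_exp_neg (fun t => / 2 * t)).
        apply continuous_Rmult. apply continuous_const. apply continuous_id.
      + intros Q [d HQ]. apply HQ, ball_center.
      + apply (filterlim_Req _ (- 2 * M * 0)); [|ring].
        apply (filterlim_Rmult (F := Rbar_locally p_infty)). apply filterlim_const.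
        apply filterlim_exp_neg; lra. }
  destruct E0 as [l0 E0], E1 as [l1 E1]. eexists.
  apply (is_RInt_gen_Chasles (V := RR) _ 1 _ _ E0 E1).
Qed.

Lemma rpow_pos_base (x y : R) : 0 < x -> rpow x y = Rpower x y.
Proof. intros. unfold rpow. destruct Req_EM_T; auto. lra. Qed.

Lemma is_RInt_gen_Gamma (x : R) : 0 < x ->
  is_RInt_gen (V := RR) (gamma_integrand x) (at_right 0) (Rbar_locally p_infty) (Gamma x).
Proof.
  intros Hx. unfold Gamma.
  rewrite <- (RInt_gen_ext (V := RR) (gamma_integrand x)).
  - apply RInt_gen_correct, ex_gamma; auto.
  - apply (Filter_prod _ _ _ (fun t => 0 < t) (fun t => 0 < t)).
    apply at_right_gt. apply p_infty_gt.
    simpl. intros a b Ha Hb t Ht. unfold gamma_integrand. rewrite rpow_pos_base; auto.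
    unfold Rmin in Ht; destruct Rle_dec; lra.
  - apply ex_gamma; auto.
Qed.

(** Presents [Gamma x] through one primitive with limits, so that positivity becomes monotonicity of
    [G] and a substitution becomes a composition with [G]. *)
Lemma gamma_primitive (x : R) : 0 < x -> exists G la lb,
  (forall u, 0 < u -> is_derive (V := RR) G u (gamma_integrand x u)) /\
  filterlim G (at_right 0) (locally la) /\
  filterlim G (Rbar_locally p_infty) (locally lb) /\ Gamma x = lb - la.
Proof.
  intros Hx. assert (I := is_RInt_gen_Gamma x Hx).
  set (D := fun t : R => 0 < t).
  assert (C0 : forall t, D t -> continuous (gamma_integrand x) t)
    by (intros; apply gamma_integrand_continuous; auto).
  destruct (RInt_gen_limits (V := RR) D (gamma_integrand x) 1 (convex_gt 0) Rlt_0_1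
    (at_right_gt 0) (p_infty_gt 0) C0 (ex_intro _ _ I)) as [[la La] [lb Lb]].
  exists (RInt (gamma_integrand x) 1), la, lb. split; [|split; [|split]]; auto.
  - intros u Hu. apply (is_derive_RInt (V := RR)) with 1; auto.
    apply (filter_imp D); [|apply (open_gt 0 u Hu)]. intros z Hz.
    apply RInt_correct. apply (ex_RInt_convex (V := RR) D (gamma_integrand x)); auto.
    apply convex_gt. unfold D; lra.
  - rewrite <- (is_RInt_gen_unique _ _ I). apply (is_RInt_gen_unique (V := RR)).
    apply (is_RInt_gen_primitive (V := RR) D _ (RInt (gamma_integrand x) 1)); auto.
    apply at_right_gt. apply p_infty_gt. intros.
    apply (is_RInt_convex (V := RR) D (gamma_integrand x) 1 (convex_gt 0) Rlt_0_1 C0); auto.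
Qed.

Lemma Gamma_pos (x : R) : 0 < x -> 0 < Gamma x.
Proof.
  intros Hx. destruct (gamma_primitive x Hx) as [G [la [lb [DG [La [Lb ->]]]]]].
  assert (Mono : forall u v, 0 < u -> u < v -> G u < G v).
  { intros u v Hu Huv. destruct (MVT_cor2 G (gamma_integrand x) u v Huv) as [c [E Hc]].
    { intros; apply is_derive_Reals, DG; lra. }
    assert (0 < gamma_integrand x c) by (apply Rmult_lt_0_compat; apply exp_pos). nra. }
  assert (A : la <= G 1).
  { apply (filterlim_le (F := at_right 0) G (fun _ => G 1) la (G 1)); auto.
    - generalize (filter_and _ _ (at_right_gt 0) (at_right_lt 0 1 Rlt_0_1)).
      apply filter_imp. intros t [H1 H2]. left; apply Mono; auto.
    - apply filterlim_const. }
  assert (B : G 2 <= lb).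
  { apply (filterlim_le (F := Rbar_locally p_infty) (fun _ => G 2) G (G 2) lb); auto.
    - generalize (p_infty_gt 2). apply filter_imp. intros; left; apply Mono; lra.
    - apply filterlim_const. }
  assert (G 1 < G 2) by (apply Mono; lra). lra.
Qed.

Definition powexp (w rho c t : R) : R := Rpower t (c - 1) * exp (- (w * Rpower t rho)).

Lemma powexp_continuous (w rho c t : R) : 0 < t -> continuous (powexp w rho c) t.
Proof.
  intros. apply continuous_Rmult. apply continuous_Rpower; auto.
  apply (continuous_exp_neg (fun t => w * Rpower t rho)).
  apply continuous_Rmult. apply continuous_const. apply continuous_Rpower; auto.
Qed.

Lemma powexp_pos (w rho c t : R) : 0 < powexp w rho c t.
Proof. apply Rmult_lt_0_compat; apply exp_pos. Qed.

(** Substitute [u = w t^rho] in Euler's integral. *)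
Lemma is_RInt_gen_powexp (w rho c : R) : 0 < w -> 0 < rho -> 0 < c ->
  is_RInt_gen (V := RR) (powexp w rho c) (at_right 0) (Rbar_locally p_infty)
    (/ rho * Gamma (c / rho) * Rpower w (- (c / rho))).
Proof.
  intros Hw Hr Hc. set (x := c / rho).
  assert (Hx : 0 < x) by (apply Rdiv_lt_0_compat; auto).
  destruct (gamma_primitive x Hx) as [G [la [lb [DG [La [Lb E]]]]]].
  (* Since du = w rho t^(rho-1) dt, one has t^(c-1) dt = k u^(x-1) du with this constant. *)
  set (k := / rho * Rpower w (- x)).
  replace (/ rho * Gamma x * Rpower w (- x)) with (minus (k * lb) (k * la))
    by (rewrite E; unfold k, minus, plus, opp; simpl; ring).
  apply (is_RInt_gen_primitive_derive (V := RR) (fun t => 0 < t) _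
    (fun t => k * G (w * Rpower t rho))).
  - apply convex_gt.
  - apply at_right_gt.
  - apply p_infty_gt.
  - intros t Ht. assert (P := Rpower_pos t rho).
    eapply is_derive_Req.
    + apply (is_derive_scal (fun t => G (w * Rpower t rho))).
      apply (is_derive_comp G (fun t => w * Rpower t rho)).
      apply DG. nra.
      apply (is_derive_scal (fun t => Rpower t rho)).
      apply (is_derive_Rpower (fun t => t)); auto. apply (is_derive_id (K := R_AbsRing)).
    + unfold one, scal; simpl; unfold mult; simpl.
      unfold powexp, gamma_integrand, k.
      rewrite <- Rpower_mult_distr by auto. rewrite Rpower_mult.
      replace (c - 1) with ((rho - 1) + rho * (x - 1)) by (unfold x; field; lra).
      rewrite Rpower_plus.
      replace (/ rho * Rpower w (- x) * (w * (rho * Rpower t (rho - 1) * 1) *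
        (Rpower w (x - 1) * Rpower t (rho * (x - 1)) * exp (- (w * Rpower t rho)))))
      with ((Rpower w (- x) * Rpower w 1 * Rpower w (x - 1)) *
        (Rpower t (rho - 1) * Rpower t (rho * (x - 1)) * exp (- (w * Rpower t rho))))
        by (rewrite Rpower_1 by auto; field; lra).
      rewrite <- !Rpower_plus. replace (- x + 1 + (x - 1)) with 0 by ring.
      rewrite Rpower_O by auto. ring.
  - intros; apply powexp_continuous; auto.
  - apply (filterlim_Rmult (F := at_right 0)). apply filterlim_const.
    eapply filterlim_comp; [|exact La]. intros Q [d HQ].
    assert (L : filterlim (fun t => w * Rpower t rho) (at_right 0) (locally 0)).
    { apply (filterlim_Req _ (w * 0)); [|ring].
      apply (filterlim_Rmult (F := at_right 0)). apply filterlim_const.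
      apply filterlim_Rpower_0; auto. }
    generalize (proj1 (filterlim_locally _ _) L d). unfold filtermap.
    apply filter_imp. intros t Ht. apply HQ; auto.
    apply Rmult_lt_0_compat; auto. apply Rpower_pos.
  - apply (filterlim_Rmult (F := Rbar_locally p_infty)). apply filterlim_const.
    eapply filterlim_comp; [|exact Lb]. intros Q [M HQ].
    generalize (filterlim_Rpower_p_infty rho Hr (fun u => M / w < u) (p_infty_gt _)).
    unfold filtermap. apply filter_imp. intros t Ht. apply HQ.
    apply (Rmult_lt_compat_l w) in Ht; auto.
    replace (w * (M / w)) with M in Ht by (field; lra). auto.
Qed.

(** * Complex improper integrals and Taylor estimates *)

Lemma is_RInt_Cmult_l (c : C) (f : R -> C) (a b : R) (l : C) :
  is_RInt (V := CR) f a b l -> is_RInt (V := CR) (fun t => (c * f t)%C) a b (c * l)%C.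
Proof.
  intros H.
  assert (H1 := is_RInt_fct_extend_fst (U := R_NormedModule) (V := R_NormedModule) f a b l H).
  assert (H2 := is_RInt_fct_extend_snd (U := R_NormedModule) (V := R_NormedModule) f a b l H).
  apply (is_RInt_fct_extend_pair (U := R_NormedModule) (V := R_NormedModule)
    (fun t => (c * f t)%C) a b); simpl.
  - apply (is_RInt_minus (V := R_NormedModule) (fun t => fst c * fst (f t))
      (fun t => snd c * snd (f t))); apply (is_RInt_scal (V := R_NormedModule)); assumption.
  - apply (is_RInt_plus (V := R_NormedModule) (fun t => fst c * snd (f t))
      (fun t => snd c * fst (f t))); apply (is_RInt_scal (V := R_NormedModule)); assumption.
Qed.

Section Gen.
Context {Fa Fb : (R -> Prop) -> Prop} {FFa : ProperFilter Fa} {FFb : ProperFilter Fb}.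

Lemma is_RInt_gen_Cmult_l (c : C) (f : R -> C) (l : C) :
  is_RInt_gen (V := CR) f Fa Fb l ->
  is_RInt_gen (V := CR) (fun t => (c * f t)%C) Fa Fb (c * l)%C.
Proof.
  intros H Q HQ.
  assert (L : filterlim (fun z : C => (c * z)%C) (locally (T := CR) l) (locally (T := CR) (c * l)%C)).
  { apply (filterlim_Cmult (F := locally (T := CR) l)). apply filterlim_const. apply filterlim_id. }
  generalize (H _ (L Q HQ)). unfold filtermapi, filtermap. apply filter_imp.
  intros ab [y [Hy1 Hy2]]. exists (c * y)%C. split; auto. apply is_RInt_Cmult_l; auto.
Qed.

Lemma is_RInt_gen_RtoC (f : R -> R) (l : R) :
  is_RInt_gen (V := RR) f Fa Fb l ->
  is_RInt_gen (V := CR) (fun t => RtoC (f t)) Fa Fb (RtoC l).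
Proof.
  intros H Q HQ.
  assert (L : filterlim RtoC (locally l) (locally (T := CR) (RtoC l))).
  { apply (filterlim_RtoC (F := locally l)), filterlim_id. }
  generalize (H _ (L Q HQ)). unfold filtermapi, filtermap. apply filter_imp.
  intros ab [y [Hy1 Hy2]]. exists (RtoC y). split; auto.
  apply (is_RInt_fct_extend_pair (U := R_NormedModule) (V := R_NormedModule)
    (fun t => RtoC (f t))); simpl; auto.
  assert (Z := is_RInt_const (V := R_NormedModule) (fst ab) (snd ab) 0).
  unfold scal in Z; simpl in Z; unfold mult in Z; simpl in Z.
  rewrite Rmult_0_r in Z. exact Z.
Qed.

Lemma is_RInt_gen_Cplus (f g : R -> C) (l m : C) :
  is_RInt_gen (V := CR) f Fa Fb l -> is_RInt_gen (V := CR) g Fa Fb m ->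
  is_RInt_gen (V := CR) (fun t => (f t + g t)%C) Fa Fb (l + m)%C.
Proof. intros. apply (is_RInt_gen_plus (V := CR)); auto. Qed.

Lemma is_RInt_gen_Cminus (f g : R -> C) (l m : C) :
  is_RInt_gen (V := CR) f Fa Fb l -> is_RInt_gen (V := CR) g Fa Fb m ->
  is_RInt_gen (V := CR) (fun t => (f t - g t)%C) Fa Fb (l - m)%C.
Proof. intros. apply (is_RInt_gen_minus (V := CR)); auto. Qed.

Lemma Cmod_RInt_gen_le (f : R -> C) (g : R -> R) (D : R -> Prop) (lf : C) (lg : R) :
  filter_prod Fa Fb (fun ab => fst ab <= snd ab) -> convex D -> Fa D -> Fb D ->
  (forall x, D x -> Cmod (f x) <= g x) ->
  is_RInt_gen (V := CR) f Fa Fb lf -> is_RInt_gen (V := RR) g Fa Fb lg ->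
  Cmod lf <= lg.
Proof.
  intros Hab HD Da Db H If Ig. rewrite <- norm_CR.
  apply (RInt_gen_norm (V := CR) (Fa := Fa) (Fb := Fb) f g); auto.
  apply (Filter_prod _ _ _ D D); auto. simpl. intros x y Hx Hy z Hz.
  rewrite norm_CR. apply H. apply (HD x y); auto.
Qed.
End Gen.

Lemma is_RInt_gen_ext_on {V : NormedModule R_AbsRing} {Fa Fb : (R -> Prop) -> Prop}
  {FFa : Filter Fa} {FFb : Filter Fb} (D : R -> Prop) (f g : R -> V) (l : V) :
  convex D -> Fa D -> Fb D -> (forall x, D x -> f x = g x) ->
  is_RInt_gen f Fa Fb l -> is_RInt_gen g Fa Fb l.
Proof.
  intros HD Da Db E. apply is_RInt_gen_ext; auto.
  apply (Filter_prod _ _ _ D D); auto. simpl. intros x y Hx Hy z Hz.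
  apply E, (convex_minmax D x y); auto. lra.
Qed.

Lemma le_at_right_p_infty (a : R) :
  filter_prod (at_right a) (Rbar_locally p_infty) (fun ab => fst ab <= snd ab).
Proof.
  apply (Filter_prod _ _ _ (fun t => t < a + 1) (fun t => a + 1 < t)).
  apply at_right_lt; lra. apply p_infty_gt. simpl; intros; lra.
Qed.

Lemma le_at_right_at_point (a b : R) : a < b ->
  filter_prod (at_right a) (at_point b) (fun ab => fst ab <= snd ab).
Proof.
  intros. apply (Filter_prod _ _ _ (fun t => t < b) (fun t => t = b)).
  apply at_right_lt; lra. reflexivity. simpl; intros; lra.
Qed.

Lemma Cmod_MVT (f f' : R -> C) (a b M : R) :
  (forall x, Rmin a b <= x <= Rmax a b -> is_derive (V := CR) f x (f' x)) ->
  (forall x, Rmin a b <= x <= Rmax a b -> continuous (U := CR) f' x) ->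
  (forall x, Rmin a b <= x <= Rmax a b -> Cmod (f' x) <= M) ->
  Cmod (f b - f a)%C <= M * Rabs (b - a).
Proof.
  revert a b. assert (W : forall a b, a <= b ->
  (forall x, Rmin a b <= x <= Rmax a b -> is_derive (V := CR) f x (f' x)) ->
  (forall x, Rmin a b <= x <= Rmax a b -> continuous (U := CR) f' x) ->
  (forall x, Rmin a b <= x <= Rmax a b -> Cmod (f' x) <= M) ->
  Cmod (f b - f a)%C <= M * Rabs (b - a)).
  { intros a b Hab H1 H2 H3.
    assert (I := is_RInt_derive (V := CR) f f' a b H1 H2).
    rewrite Rabs_pos_eq, Rmult_comm by lra.
    rewrite <- norm_CR. apply (norm_RInt_le_const (V := CR) f' a b); auto.
    rewrite Rmin_left, Rmax_right in H3 by auto.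
    intros; rewrite norm_CR; auto. }
  intros a b H1 H2 H3. destruct (Rle_dec a b); auto.
  rewrite Rabs_minus_sym. replace (f b - f a)%C with (- (f a - f b))%C by ring.
  rewrite Cmod_opp. rewrite (Rmin_comm a), (Rmax_comm a) in H1, H2, H3.
  apply W; auto. lra.
Qed.

(** The mean value inequality is applied twice: to [f'], and then to f x - f a - (x - a) f' a, whose
    derivative f' x - f' a is at most M |x - a|. The sharp factor 1/2 is not pursued. *)
Lemma Cmod_Taylor2 (f f' f'' : R -> C) (a b M : R) :
  (forall x, Rmin a b <= x <= Rmax a b -> is_derive (V := CR) f x (f' x)) ->
  (forall x, Rmin a b <= x <= Rmax a b -> is_derive (V := CR) f' x (f'' x)) ->
  (forall x, Rmin a b <= x <= Rmax a b -> continuous (U := CR) f'' x) ->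
  (forall x, Rmin a b <= x <= Rmax a b -> Cmod (f'' x) <= M) ->
  Cmod (f b - f a - RtoC (b - a) * f' a)%C <= M * ((b - a) * (b - a)).
Proof.
  intros H1 H2 H3 H4.
  set (g := fun x => (f x + (- f a + RtoC (x - a) * (- f' a)))%C).
  set (g' := fun x => (f' x - f' a)%C).
  assert (Ia : Rmin a b <= a <= Rmax a b)
    by (unfold Rmin, Rmax; destruct Rle_dec; lra).
  assert (HM : 0 <= M) by (eapply Rle_trans; [apply Cmod_ge_0|apply (H4 a Ia)]).
  assert (G : Cmod (g b - g a)%C <= (M * Rabs (b - a)) * Rabs (b - a)).
  { apply (Cmod_MVT g g').
    - intros x Hx. unfold g, g'. eapply is_derive_Ceq.
      apply is_derive_Cplus. apply H1, Hx. apply is_derive_Cplus.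
      apply is_derive_Cconst. apply is_derive_Cmult.
      apply is_derive_RtoC. apply (is_derive_minus (fun x => x) (fun _ => a)).
      apply (is_derive_id (K := R_AbsRing)). apply (is_derive_const (V := R_NormedModule)).
      apply is_derive_Cconst. cbv beta. unfold minus, plus, opp, zero, one; simpl.
      replace (1 + - 0) with 1 by ring. ring.
    - intros x Hx. unfold g'. apply (continuous_minus (V := CR)).
      eapply (derive_continuous (V := CR)), H2, Hx.
      apply continuous_const.
    - intros x Hx. unfold g'.
      assert (Sub : forall y, Rmin a x <= y <= Rmax a x -> Rmin a b <= y <= Rmax a b).
      { revert Hx. unfold Rmin, Rmax. repeat destruct Rle_dec; intros; lra. }
      apply Rle_trans with (M * Rabs (x - a)).
      apply (Cmod_MVT f' f''); auto.
      apply Rmult_le_compat_l; auto. revert Hx. unfold Rmin, Rmax.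
      destruct (Rle_dec a b); intros.
      rewrite !Rabs_pos_eq; lra. rewrite !Rabs_left1; lra. }
  replace (f b - f a - RtoC (b - a) * f' a)%C with (g b - g a)%C.
  2:{ unfold g. replace (a - a) with 0 by ring. ring. }
  rewrite Rmult_assoc, <- Rabs_mult, (Rabs_pos_eq ((b - a) * (b - a))) in G
    by apply Rle_0_sqr. exact G.
Qed.

(** A quadratic error is o(|y - x|). This is the form in which an integrated second-order Taylor
    estimate gives the derivative of an integral depending on a parameter. *)
Lemma is_derive_quadratic (f : R -> C) (x d H : R) (l : C) : 0 < d -> 0 <= H ->
  (forall y, Rabs (y - x) < d ->
    Cmod (f y - f x - RtoC (y - x) * l)%C <= H * ((y - x) * (y - x))) ->
  is_derive (V := CR) f x l.
Proof.
  intros Hd HH Hf. split. apply is_linear_scal_l.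
  intros y Hy. apply (is_filter_lim_locally_unique (V := AbsRing_NormedModule R_AbsRing)) in Hy.
  subst y. intros eps.
  (* The denominator is [H + 1] because [H] may be 0. *)
  assert (He : 0 < Rmin d (eps / (H + 1))).
  { apply Rmin_glb_lt; auto. apply Rdiv_lt_0_compat. apply cond_pos. lra. }
  exists (mkposreal _ He). intros y Hy.
  change (Rabs (y - x) < Rmin d (eps / (H + 1))) in Hy.
  change (norm ((f y - f x - @scal R_Ring CR (y - x)%R l)%C : CR) <= eps * Rabs (y - x)).
  rewrite norm_CR, scal_CR.
  eapply Rle_trans; [apply Hf|].
  - eapply Rlt_le_trans; [exact Hy|apply Rmin_l].
  - assert (L : Rabs (y - x) <= eps / (H + 1)).
    { left; eapply Rlt_le_trans; [exact Hy|apply Rmin_r]. }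
    replace ((y - x) * (y - x)) with (Rabs (y - x) * Rabs (y - x))
      by (rewrite <- Rabs_mult; apply Rabs_pos_eq, Rle_0_sqr).
    rewrite <- Rmult_assoc. apply Rmult_le_compat_r. apply Rabs_pos.
    apply Rle_trans with (H * (eps / (H + 1))). apply Rmult_le_compat_l; auto.
    assert (0 < eps) by apply cond_pos.
    replace (H * (eps / (H + 1))) with (eps * (H / (H + 1))) by (field; lra).
    rewrite <- (Rmult_1_r eps) at 2. apply Rmult_le_compat_l. lra.
    apply Rmult_le_reg_r with (H + 1). lra.
    unfold Rdiv. rewrite Rmult_assoc, Rinv_l; lra.
Qed.

(** * Integrals over rays *)

Lemma Cexp_i (x : R) : Cexp (Ci * RtoC x) = (cos x, sin x).
Proof.
  unfold Cexp, Ci, Cmult, RtoC; simpl.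
  replace (0 * x - 1 * 0) with 0 by ring. replace (0 * 0 + 1 * x) with x by ring.
  rewrite exp_0. f_equal; ring.
Qed.

Lemma is_derive_Cpow (f : R -> C) (x : R) (l : C) (n : nat) :
  is_derive (V := CR) f x l ->
  is_derive (V := CR) (fun t => Cpow (f t) n) x
    (RtoC (INR n) * Cpow (f x) (n - 1) * l)%C.
Proof.
  intros H. induction n.
  - simpl. eapply is_derive_Ceq. apply is_derive_Cconst. ring.
  - apply (is_derive_ext (V := CR) (fun t => (f t * Cpow (f t) n)%C)).
    { intros; symmetry; apply Cpow_S. }
    eapply is_derive_Ceq. apply is_derive_Cmult; [exact H|exact IHn].
    cbv beta. rewrite S_INR, RtoC_plus. replace (S n - 1)%nat with n by lia.
    destruct n. simpl. ring.
    replace (S n - 1)%nat with n by lia. rewrite !Cpow_S. ring.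
Qed.

(** What the comparison test asks of a majorant on (0, oo). The class is stable under the sums and
    nonnegative multiples that differentiating [form] produces. *)
Definition dominating (h : R -> R) : Prop :=
  (forall t, 0 < t -> continuous h t) /\ (forall t, 0 < t -> 0 <= h t) /\
  ex_RInt_gen (V := RR) h (at_right 0) (Rbar_locally p_infty).

Lemma dominating_plus (f g : R -> R) :
  dominating f -> dominating g -> dominating (fun t => f t + g t).
Proof.
  intros [F1 [F2 [lf F3]]] [G1 [G2 [lg G3]]]. split; [|split].
  - intros; apply continuous_Rplus; auto.
  - intros; apply Rplus_le_le_0_compat; auto.
  - eexists. apply (is_RInt_gen_plus (V := RR)); eassumption.
Qed.

Lemma dominating_scal (a : R) (f : R -> R) : 0 <= a ->
  dominating f -> dominating (fun t => a * f t).
Proof.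
  intros Ha [F1 [F2 [lf F3]]]. split; [|split].
  - intros; apply continuous_Rmult; auto. apply continuous_const.
  - intros; apply Rmult_le_pos; auto.
  - eexists. apply (is_RInt_gen_scal (V := RR)); eassumption.
Qed.

Lemma dominating_powexp (w rho c : R) : 0 < w -> 0 < rho -> 0 < c ->
  dominating (powexp w rho c).
Proof.
  intros. split; [|split].
  - intros; apply powexp_continuous; auto.
  - intros; left; apply powexp_pos.
  - eexists; apply is_RInt_gen_powexp; auto.
Qed.

Lemma Cmod_le_RInt_gen (f : R -> C) (h : R -> R) (lf : C) (lh : R) :
  (forall t, 0 < t -> Cmod (f t) <= h t) ->
  is_RInt_gen (V := CR) f (at_right 0) (Rbar_locally p_infty) lf ->
  is_RInt_gen (V := RR) h (at_right 0) (Rbar_locally p_infty) lh ->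
  Cmod lf <= lh.
Proof.
  intros H. apply (Cmod_RInt_gen_le f h (fun t => 0 < t)); auto.
  apply le_at_right_p_infty. apply convex_gt. apply at_right_gt. apply p_infty_gt.
Qed.

Lemma pow_Rpower (t : R) (n : nat) : 0 < t -> t ^ n = Rpower t (INR n).
Proof. intros; symmetry; apply Rpower_pow; auto. Qed.

Section Ray.
Variables (sg rho w : R).
Hypothesis Hsg : sg = 1 \/ sg = -1.
Hypothesis Hrho : 1 <= rho.
Hypothesis Hw : 0 < w.

(** The angle for which (t e^(i theta))^rho = i t^rho. As rho >= 1 it is at most pi/2, so the rays
    from points s >= 0 stay in the closed right half-plane. *)
Definition theta : R := PI / (2 * rho).
Definition dir : C := Cexp (Ci * RtoC (sg * theta)).
Definition ray (s t : R) : C := (RtoC s + RtoC t * dir)%C.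
Definition osc (c : R) (z : C) : C :=
  (Cpowr z c * Cexp (RtoC sg * Ci * RtoC w * Cpowr z rho))%C.

Lemma theta_bounds : 0 < theta <= PI / 2.
Proof.
  unfold theta. assert (H := PI_RGT_0). split. apply Rdiv_lt_0_compat; lra.
  unfold Rdiv. apply Rmult_le_compat_l. lra. apply Rinv_le_contravar; lra.
Qed.

Lemma theta_cos : 0 <= cos theta.
Proof. destruct theta_bounds. assert (H1 := PI_RGT_0). apply cos_ge_0; lra. Qed.

Lemma theta_sin : 0 < sin theta.
Proof. destruct theta_bounds. assert (H1 := PI_RGT_0). apply sin_gt_0; lra. Qed.

Lemma sg_sqr : sg * sg = 1.
Proof. destruct Hsg; subst sg; ring. Qed.

Lemma sg_sin (x : R) : sin (sg * x) = sg * sin x.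
Proof.
  destruct Hsg as [H|H]; rewrite H. rewrite !Rmult_1_l; auto.
  replace (-1 * x) with (- x) by ring. rewrite sin_neg; ring.
Qed.

Lemma sg_cos (x : R) : cos (sg * x) = cos x.
Proof.
  destruct Hsg as [H|H]; rewrite H. rewrite !Rmult_1_l; auto.
  replace (-1 * x) with (- x) by ring. apply cos_neg.
Qed.

Lemma sg_atan (x : R) : atan (sg * x) = sg * atan x.
Proof.
  destruct Hsg as [H|H]; rewrite H. rewrite !Rmult_1_l; auto.
  replace (-1 * x) with (- x) by ring. rewrite atan_opp; ring.
Qed.

Lemma dir_eq : dir = (cos theta, sg * sin theta).
Proof. unfold dir. rewrite Cexp_i, sg_cos, sg_sin. reflexivity. Qed.

Lemma dir_Cmod : Cmod dir = 1.
Proof.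
  unfold dir. rewrite Cmod_Cexp. simpl. rewrite <- exp_0. f_equal. ring.
Qed.

Lemma ray_eq (s t : R) : ray s t = (s + t * cos theta, sg * (t * sin theta)).
Proof.
  unfold ray. rewrite dir_eq. unfold Cplus, Cmult, RtoC; simpl. f_equal; ring.
Qed.

(** The law of cosines. Its cross term is nonnegative because theta <= pi/2, which is why |z| is at
    least [s] and at least [t]. *)
Lemma ray_Cmod_sqr (s t : R) :
  Cmod (ray s t) * Cmod (ray s t) = s * s + 2 * s * t * cos theta + t * t.
Proof.
  rewrite Cmod_sqr, ray_eq; simpl.
  replace (sg * (t * sin theta) * (sg * (t * sin theta)))
    with ((sg * sg) * (t * t) * (sin theta * sin theta)) by ring.
  rewrite sg_sqr. assert (H := sin2_cos2 theta). unfold Rsqr in H.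
  replace (sin theta * sin theta) with (1 - cos theta * cos theta) by lra. ring.
Qed.

Lemma ray_ge_s (s t : R) : 0 <= s -> 0 <= t -> s <= Cmod (ray s t).
Proof.
  intros. assert (Q := ray_Cmod_sqr s t). assert (C := theta_cos).
  assert (P := Cmod_ge_0 (ray s t)).
  apply Rsqr_incr_0; auto. unfold Rsqr. rewrite Q.
  assert (0 <= s * t * cos theta) by (apply Rmult_le_pos; auto; apply Rmult_le_pos; auto).
  nra.
Qed.

Lemma ray_ge_t (s t : R) : 0 <= s -> 0 <= t -> t <= Cmod (ray s t).
Proof.
  intros. assert (Q := ray_Cmod_sqr s t). assert (C := theta_cos).
  assert (P := Cmod_ge_0 (ray s t)).
  apply Rsqr_incr_0; auto. unfold Rsqr. rewrite Q.
  assert (0 <= s * t * cos theta) by (apply Rmult_le_pos; auto; apply Rmult_le_pos; auto).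
  nra.
Qed.

Lemma ray_le (s t : R) : 0 <= s -> 0 <= t -> Cmod (ray s t) <= s + t.
Proof.
  intros. unfold ray. eapply Rle_trans; [apply Cmod_triangle|].
  rewrite Cmod_mult, dir_Cmod, !Cmod_R, !Rabs_pos_eq; lra.
Qed.

Lemma ray_Crp (s t : R) : 0 <= s -> 0 <= t -> 0 < s + t -> Crp (ray s t).
Proof.
  intros. unfold Crp.
  assert (A := ray_ge_s s t H H0). assert (B := ray_ge_t s t H H0).
  rewrite ray_eq at 2; simpl. assert (C := theta_cos).
  assert (0 <= t * cos theta) by (apply Rmult_le_pos; auto). lra.
Qed.

Lemma ray_Cmod_pos (s t : R) : 0 <= s -> 0 <= t -> 0 < s + t -> 0 < Cmod (ray s t).
Proof.
  intros. assert (A := ray_ge_s s t H H0). assert (B := ray_ge_t s t H H0). lra.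
Qed.

Lemma half_tan : sin theta / (1 + cos theta) = tan (theta / 2).
Proof.
  assert (E1 : sin theta = 2 * sin (theta / 2) * cos (theta / 2)).
  { rewrite <- sin_2a. f_equal. field. }
  assert (E2 : cos theta = 2 * cos (theta / 2) * cos (theta / 2) - 1).
  { rewrite <- cos_2a_cos. f_equal. field. }
  destruct theta_bounds. assert (P := PI_RGT_0).
  assert (0 < cos (theta / 2)) by (apply cos_gt_0; lra).
  rewrite E1, E2. unfold tan. field. split; apply Rgt_not_eq; nra.
Qed.

(** The tangent of half the argument is t sin theta / (|z| + Re z) up to sign. As |z| >= t and Re z
    >= t cos theta, it is at most its value tan (theta/2) on the ray from 0. *)
Lemma ray_Carg_bounds (s t : R) : 0 <= s -> 0 < t -> 0 <= sg * Carg (ray s t) <= theta.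
Proof.
  intros Hs Ht. destruct theta_bounds as [T1 T2]. assert (P := PI_RGT_0).
  assert (C := theta_cos). assert (S := theta_sin).
  assert (R1 := ray_ge_t s t Hs ltac:(lra)).
  assert (0 <= t * cos theta) by (apply Rmult_le_pos; lra).
  assert (0 < t * sin theta) by (apply Rmult_lt_0_compat; lra).
  unfold Carg. set (r := Cmod (ray s t)) in *. rewrite ray_eq; simpl.
  set (u := t * sin theta / (r + (s + t * cos theta))).
  replace (sg * (t * sin theta) / (r + (s + t * cos theta))) with (sg * u)
    by (unfold u; field; lra).
  rewrite sg_atan. replace (sg * (2 * (sg * atan u))) with ((sg * sg) * 2 * atan u) by ring.
  rewrite sg_sqr.
  assert (0 <= u).
  { apply Rmult_le_pos. lra. left; apply Rinv_0_lt_compat; lra. }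
  assert (u <= tan (theta / 2)).
  { rewrite <- half_tan.
    replace (sin theta / (1 + cos theta)) with (t * sin theta / (t + t * cos theta)) by (field; lra).
    apply Rmult_le_compat_l. lra. apply Rinv_le_contravar; lra. }
  assert (atan 0 <= atan u).
  { destruct H1 as [L|<-]; [left; apply atan_increasing; auto|lra]. }
  rewrite atan_0 in H3.
  assert (atan u <= atan (tan (theta / 2))).
  { destruct H2 as [L|L]; [left; apply atan_increasing; auto|rewrite L; lra]. }
  rewrite atan_tan in H4 by lra. lra.
Qed.

Lemma Clog_ray_0 (t : R) : 0 < t -> Clog (ray 0 t) = (ln t, sg * theta).
Proof.
  intros Ht. destruct theta_bounds as [T1 T2]. assert (P := PI_RGT_0).
  assert (C := theta_cos).
  assert (E : Cmod (ray 0 t) = t).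
  { assert (Q := ray_Cmod_sqr 0 t). assert (Q2 := Cmod_ge_0 (ray 0 t)).
    apply Rsqr_inj; auto. lra. unfold Rsqr. rewrite Q. ring. }
  unfold Clog, Carg. rewrite E, ray_eq; simpl. f_equal.
  replace (sg * (t * sin theta) / (t + (0 + t * cos theta)))
    with (sg * (sin theta / (1 + cos theta))) by (field; repeat split; apply Rgt_not_eq; nra).
  rewrite sg_atan, half_tan, atan_tan by lra. field.
Qed.

Lemma is_derive_ray_s (s t : R) : is_derive (V := CR) (fun s => ray s t) s (RtoC 1).
Proof.
  unfold ray. eapply is_derive_Ceq.
  apply is_derive_Cplus. apply is_derive_RtoC, (is_derive_id (K := R_AbsRing)).
  apply is_derive_Cconst. unfold one; simpl. ring.
Qed.

Lemma is_derive_ray_t (s t : R) : is_derive (V := CR) (fun t => ray s t) t dir.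
Proof.
  unfold ray. eapply is_derive_Ceq.
  apply is_derive_Cplus. apply is_derive_Cconst. apply is_derive_Cmult.
  apply is_derive_RtoC, (is_derive_id (K := R_AbsRing)).
  apply is_derive_Cconst. unfold one; simpl. ring.
Qed.

(** Moving the base point to the right increases [Im z^rho], as
    [Im z^(rho-1) >= 0] in the sector. *)
Lemma ray_Im_power (s t : R) : 0 <= s -> 0 < t ->
  Rpower t rho <= sg * snd (Cpowr (ray s t) rho).
Proof.
  intros Hs Ht. destruct theta_bounds as [T1 T2]. assert (P := PI_RGT_0).
  assert (E0 : sg * snd (Cpowr (ray 0 t) rho) = Rpower t rho).
  { unfold Cpowr. rewrite Clog_ray_0 by auto. unfold Cexp, Cmult, RtoC, Rpower; simpl.
    replace (rho * ln t - 0 * (sg * theta)) with (rho * ln t) by ring.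
    replace (rho * (sg * theta) + 0 * ln t) with (sg * (PI / 2)) by (unfold theta; field; lra).
    rewrite sg_sin, sin_PI2.
    replace (sg * (exp (rho * ln t) * (sg * 1))) with ((sg * sg) * exp (rho * ln t)) by ring.
    rewrite sg_sqr. ring. }
  destruct Hs as [Hs|<-]; [|rewrite E0; lra].
  rewrite <- E0.
  set (H := fun s => sg * snd (Cpowr (ray s t) rho)).
  set (H' := fun s => sg * snd (RtoC rho * (Cpowr (ray s t) (rho - 1) * RtoC 1))%C).
  change (H 0 <= H s).
  destruct (MVT_cor2 H H' 0 s Hs) as [c [E Hc]].
  { intros c Hc. apply is_derive_Reals. apply (is_derive_scal (fun s => snd (Cpowr (ray s t) rho))).
    apply is_derive_C_snd, (is_derive_Cpowr (fun s => ray s t) c (RtoC 1) rho).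
    apply is_derive_ray_s.
    apply ray_Crp; lra. }
  assert (0 <= H' c).
  { unfold H', Cpowr, Cexp, Cmult, RtoC, Clog; simpl.
    destruct (ray_Carg_bounds c t ltac:(lra) Ht) as [B1 B2].
    set (A := Carg (ray c t)) in *. set (L := ln (Cmod (ray c t))).
    replace ((rho - 1) * A + 0 * L) with (sg * ((rho - 1) * (sg * A)))
      by (replace (sg * ((rho - 1) * (sg * A))) with ((sg * sg) * (rho - 1) * A) by ring;
          rewrite sg_sqr; ring).
    rewrite sg_sin. set (X := exp _).
    assert (HX : 0 < X) by apply exp_pos.
    set (S := sin ((rho - 1) * (sg * A))).
    (* The angle (rho - 1) arg z lies between 0 and rho theta = pi/2. *)
    assert (0 <= S).
    { apply sin_ge_0. apply Rmult_le_pos; lra.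
      apply Rle_trans with (rho * theta). apply Rmult_le_compat; lra.
      unfold theta. replace (rho * (PI / (2 * rho))) with (PI / 2) by (field; lra). lra. }
    match goal with |- 0 <= ?e => replace e with ((sg * sg) * rho * (X * S)) by ring end.
    rewrite sg_sqr. apply Rmult_le_pos. lra. apply Rmult_le_pos; lra. }
  nra.
Qed.

(** The exponential has modulus exp (-w |Im z^rho|), since Im z^rho carries the sign [sg]. The decay
    in [t] is thus independent of the base point [s], which makes majorants uniform in [s]. *)
Lemma osc_Cmod (c s t : R) : 0 <= s -> 0 < t ->
  Cmod (osc c (ray s t)) <= Rpower (Cmod (ray s t)) c * exp (- (w * Rpower t rho)).
Proof.
  intros Hs Ht. unfold osc. rewrite Cmod_mult, Cmod_Cpowr, Cmod_Cexp.
  apply Rmult_le_compat_l. left; apply Rpower_pos.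
  assert (B := ray_Im_power s t Hs Ht).
  set (z := Cpowr (ray s t) rho) in *.
  replace (fst (RtoC sg * Ci * RtoC w * z)%C) with (- (w * (sg * snd z)))
    by (simpl; ring).
  assert (w * Rpower t rho <= w * (sg * snd z)) by (apply Rmult_le_compat_l; lra).
  destruct H as [H|H]. left; apply exp_increasing; lra. rewrite H; lra.
Qed.

(** The factor in the derivative of the exponent: d/dz (i sg w z^rho) = kap z^(rho-1). *)
Definition kap : C := (RtoC sg * Ci * RtoC w * RtoC rho)%C.

Lemma kap_Cmod : Cmod kap = w * rho.
Proof.
  unfold kap. rewrite !Cmod_mult, !Cmod_R, (Rabs_pos_eq w), (Rabs_pos_eq rho) by lra.
  replace (Cmod Ci) with 1.
  - replace (Rabs sg) with 1. ring.
    destruct Hsg as [->| ->]; unfold Rabs; destruct Rcase_abs; lra.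
  - unfold Cmod, Ci; simpl. replace (0 * (0 * 1) + 1 * (1 * 1)) with 1 by ring.
    symmetry; apply sqrt_1.
Qed.

Lemma is_derive_osc (c : R) (f : R -> C) (x : R) (l : C) :
  is_derive (V := CR) f x l -> Crp (f x) ->
  is_derive (V := CR) (fun x => osc c (f x)) x
    ((RtoC c * osc (c - 1) (f x) + kap * osc (c + rho - 1) (f x)) * l)%C.
Proof.
  intros H Hp. unfold osc.
  eapply is_derive_Ceq.
  - apply is_derive_Cmult. apply is_derive_Cpowr; eassumption.
    apply is_derive_Cexp, is_derive_Cmult_l, is_derive_Cpowr; eassumption.
  - cbv beta. unfold kap. replace (c + rho - 1) with (c + (rho - 1)) by ring.
    rewrite Cpowr_plus. ring.
Qed.

Lemma osc_ray_0 (c t : R) : 0 < t ->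
  osc c (ray 0 t) =
  (RtoC (Rpower t c * exp (- (w * Rpower t rho))) * Cexp (Ci * RtoC (sg * theta * c)))%C.
Proof.
  intros Ht. unfold osc, Cpowr. rewrite Clog_ray_0 by auto.
  assert (E : Cexp (RtoC rho * (ln t, sg * theta)) = (RtoC (Rpower t rho) * (RtoC sg * Ci))%C).
  { unfold Cexp, Cmult, RtoC, Rpower, Ci; simpl.
    replace (rho * ln t - 0 * (sg * theta)) with (rho * ln t) by ring.
    replace (rho * (sg * theta) + 0 * ln t) with (sg * (PI / 2)) by (unfold theta; field; lra).
    rewrite sg_sin, sg_cos, sin_PI2, cos_PI2. f_equal; ring. }
  rewrite E.
  replace (RtoC sg * Ci * RtoC w * (RtoC (Rpower t rho) * (RtoC sg * Ci)))%C
    with (RtoC (- (w * Rpower t rho))).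
  2:{ unfold RtoC, Cmult, Ci; simpl. f_equal; [|ring].
      transitivity (- ((sg * sg) * (w * Rpower t rho))); [rewrite sg_sqr|]; ring. }
  replace (Cexp (RtoC c * (ln t, sg * theta))) with
    (RtoC (Rpower t c) * Cexp (Ci * RtoC (sg * theta * c)))%C.
  2:{ rewrite Cexp_i. unfold Cexp, Cmult, RtoC, Rpower; simpl.
      replace (c * ln t - 0 * (sg * theta)) with (c * ln t) by ring.
      replace (c * (sg * theta) + 0 * ln t) with (sg * theta * c) by ring. f_equal; ring. }
  replace (Cexp (RtoC (- (w * Rpower t rho)))) with (RtoC (exp (- (w * Rpower t rho)))).
  2:{ unfold Cexp, RtoC; simpl. rewrite cos_0, sin_0. f_equal; ring. }
  rewrite (RtoC_mult (Rpower t c)). ring.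
Qed.

(** On the ray z - s = t dir, so this is the pull-back of (z-s)^n z^c exp (i sg w z^rho) dz. In
    these coordinates the factor (z-s)^n no longer depends on [s]. *)
Definition form (n : nat) (c s t : R) : C :=
  (Cpow (RtoC t * dir) n * (osc c (ray s t) * dir))%C.

(** The derivative of [form] in [s]: only [osc] depends on [s], and the two terms come from
    differentiating the power and the exponential. *)
Definition form' (n : nat) (c s t : R) : C :=
  (RtoC c * form n (c - 1) s t + kap * form n (c + rho - 1) s t)%C.

Definition Phi (n : nat) (c s : R) : C :=
  RInt_gen (V := CR) (form n c s) (at_right 0) (Rbar_locally p_infty).

Lemma form_Cmod (n : nat) (c s t : R) : 0 <= s -> 0 < t ->
  Cmod (form n c s t) <= Rpower t (INR n) * (Rpower (Cmod (ray s t)) c * exp (- (w * Rpower t rho))).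
Proof.
  intros Hs Ht. unfold form. rewrite !Cmod_mult, Cmod_pow, Cmod_mult, Cmod_R.
  rewrite dir_Cmod, Rabs_pos_eq, !Rmult_1_r, pow_Rpower by lra.
  apply Rmult_le_compat_l. left; apply Rpower_pos.
  apply osc_Cmod; auto.
Qed.

Lemma is_derive_form_s (n : nat) (c s t : R) : 0 <= s -> 0 <= t -> 0 < s + t ->
  is_derive (V := CR) (fun s => form n c s t) s (form' n c s t).
Proof.
  intros. unfold form, form'. eapply is_derive_Ceq.
  - apply is_derive_Cmult_l. apply is_derive_Cmult.
    apply (is_derive_osc c (fun s => ray s t) s (RtoC 1)).
    apply is_derive_ray_s. apply ray_Crp; auto. apply is_derive_Cconst.
  - unfold form. cbv beta. ring.
Qed.

Lemma is_derive_form'_s (n : nat) (c s t : R) : 0 <= s -> 0 <= t -> 0 < s + t ->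
  is_derive (V := CR) (fun s => form' n c s t) s
    (RtoC c * form' n (c - 1) s t + kap * form' n (c + rho - 1) s t)%C.
Proof.
  intros. unfold form' at 1.
  apply is_derive_Cplus; apply is_derive_Cmult_l;
    apply (is_derive_form_s n _ s t); auto.
Qed.

Lemma form_continuous_s (n : nat) (c s t : R) : 0 <= s -> 0 <= t -> 0 < s + t ->
  continuous (U := CR) (fun s => form n c s t) s.
Proof.
  intros. eapply (derive_continuous (V := CR)), (is_derive_form_s n c s t); auto.
Qed.

Definition prim (n : nat) (c s t : R) : C :=
  (Cpow (RtoC t * dir) n * osc c (ray s t))%C.

Lemma is_derive_prim (n : nat) (c s t : R) : 0 <= s -> 0 <= t -> 0 < s + t ->
  is_derive (V := CR) (prim n c s) t
    (RtoC (INR n) * form (n - 1) c s t + form' n c s t)%C.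
Proof.
  intros. unfold prim. eapply is_derive_Ceq.
  - apply is_derive_Cmult. apply is_derive_Cpow.
    apply is_derive_Cmult. apply is_derive_RtoC, (is_derive_id (K := R_AbsRing)).
    apply is_derive_Cconst.
    apply (is_derive_osc c (fun t => ray s t) t (dir)).
    apply is_derive_ray_t. apply ray_Crp; auto.
  - unfold form', form, one; simpl. ring.
Qed.

Lemma form_continuous (n : nat) (c s t : R) : 0 <= s -> 0 <= t -> 0 < s + t ->
  continuous (U := CR) (form n c s) t.
Proof.
  intros. apply (continuous_ext (T := R_UniformSpace) (U := CR)
    (fun t => (prim n c s t * dir)%C)).
  { intros; unfold prim, form. ring_C. }
  apply (filterlim_Cmult (F := locally t)); [|apply filterlim_const].
  eapply (derive_continuous (V := CR)), is_derive_prim; auto.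
Qed.

(** For c >= 0, |z| <= s + t is at most 4 s0 or at most 2 t, according to whether t <= 2 s0. For c <
    0, |z| >= s0/2. The bound is uniform near [s0], as differentiation under the integral
    requires. *)
Lemma ray_power_bound (c s0 : R) : 0 < s0 ->
  exists A B q, 0 <= A /\ 0 <= B /\ 0 <= q /\
    forall s t, s0 / 2 <= s <= 2 * s0 -> 0 < t ->
      Rpower (Cmod (ray s t)) c <= A + B * Rpower t q.
Proof.
  intros Hs0. destruct (Rle_dec 0 c) as [Hc|Hc].
  - exists (Rpower (4 * s0) c), (Rpower 2 c), c.
    split; [left; apply Rpower_pos|]. split; [left; apply Rpower_pos|]. split; auto.
    intros s t Hs Ht.
    assert (P := ray_Cmod_pos s t ltac:(lra) ltac:(lra) ltac:(lra)).
    assert (L := ray_le s t ltac:(lra) ltac:(lra)).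
    rewrite Rpower_mult_distr by lra.
    assert (0 < Rpower (4 * s0) c) by apply Rpower_pos.
    assert (0 < Rpower (2 * t) c) by apply Rpower_pos.
    destruct (Rle_dec t (2 * s0)).
    + assert (Rpower (Cmod (ray s t)) c <= Rpower (4 * s0) c); [|lra].
      apply Rpower_le_base; auto. lra.
    + assert (Rpower (Cmod (ray s t)) c <= Rpower (2 * t) c); [|lra].
      apply Rpower_le_base; auto. lra.
  - exists (Rpower (s0 / 2) c), 0, 0.
    split; [left; apply Rpower_pos|]. split; [lra|]. split; [lra|].
    intros s t Hs Ht.
    assert (L := ray_ge_s s t ltac:(lra) ltac:(lra)).
    rewrite Rmult_0_l, Rplus_0_r.
    replace c with (- - c) by ring. rewrite !(Rpower_Ropp _ (- c)).
    apply Rinv_le_contravar. apply Rpower_pos. apply Rpower_le_base; lra.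
Qed.

Lemma form_dominated (n : nat) (c s0 : R) : 0 < s0 ->
  exists h, dominating h /\ forall s t, s0 / 2 <= s <= 2 * s0 -> 0 < t ->
    Cmod (form n c s t) <= h t.
Proof.
  intros Hs0. destruct (ray_power_bound c s0 Hs0) as [A [B [q [HA [HB [Hq H]]]]]].
  assert (Hn := pos_INR n).
  exists (fun t => A * powexp w rho (INR n + 1) t + B * powexp w rho (INR n + q + 1) t).
  split.
  - apply dominating_plus; apply dominating_scal; auto; apply dominating_powexp; lra.
  - intros s t Hs Ht. eapply Rle_trans; [apply form_Cmod; lra|].
    unfold powexp. replace (INR n + 1 - 1) with (INR n) by ring.
    replace (INR n + q + 1 - 1) with (INR n + q) by ring. rewrite Rpower_plus.
    set (E := exp _). assert (HE : 0 < E) by apply exp_pos.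
    set (T := Rpower t (INR n)). assert (HT : 0 < T) by apply Rpower_pos.
    replace (A * (T * E) + B * (T * Rpower t q * E))
      with (T * ((A + B * Rpower t q) * E)) by ring.
    apply Rmult_le_compat_l. lra. apply Rmult_le_compat_r. lra. apply H; auto.
Qed.

Lemma form'_dominated (n : nat) (c s0 : R) : 0 < s0 ->
  exists h, dominating h /\ forall s t, s0 / 2 <= s <= 2 * s0 -> 0 < t ->
    Cmod (form' n c s t) <= h t.
Proof.
  intros Hs0. destruct (form_dominated n (c - 1) s0 Hs0) as [h1 [D1 H1]].
  destruct (form_dominated n (c + rho - 1) s0 Hs0) as [h2 [D2 H2]].
  exists (fun t => Cmod c * h1 t + Cmod (kap) * h2 t). split.
  - apply dominating_plus; apply dominating_scal; auto; apply Cmod_ge_0.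
  - intros s t Hs Ht. unfold form'. eapply Rle_trans; [apply Cmod_triangle|].
    rewrite !Cmod_mult. apply Rplus_le_compat; apply Rmult_le_compat_l;
      auto; apply Cmod_ge_0.
Qed.

Lemma ex_form_dominated (n : nat) (c s : R) (h : R -> R) : 0 <= s -> dominating h ->
  (forall t, 0 < t -> Cmod (form n c s t) <= h t) ->
  ex_RInt_gen (V := CR) (form n c s) (at_right 0) (Rbar_locally p_infty).
Proof.
  intros Hs [D1 [D2 D3]] H.
  apply (ex_RInt_gen_dominated (V := CR) (fun t => 0 < t) _ h); auto.
  - apply convex_gt.
  - apply at_right_gt.
  - apply p_infty_gt.
  - intros; apply form_continuous; lra.
  - intros; rewrite norm_CR; auto.
Qed.

Lemma ex_form (n : nat) (c s : R) : 0 < s ->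
  ex_RInt_gen (V := CR) (form n c s) (at_right 0) (Rbar_locally p_infty).
Proof.
  intros Hs. destruct (form_dominated n c s Hs) as [h [D H]].
  apply (ex_form_dominated n c s h); auto. lra. intros; apply H; lra.
Qed.

Lemma is_Phi (n : nat) (c s : R) : 0 < s ->
  is_RInt_gen (V := CR) (form n c s) (at_right 0) (Rbar_locally p_infty) (Phi n c s).
Proof. intros; apply RInt_gen_correct, ex_form; auto. Qed.

Lemma is_Phi' (n : nat) (c s : R) : 0 < s ->
  is_RInt_gen (V := CR) (form' n c s) (at_right 0) (Rbar_locally p_infty)
    (RtoC c * Phi n (c - 1) s + kap * Phi n (c + rho - 1) s)%C.
Proof.
  intros. unfold form'.
  apply (is_RInt_gen_Cplus (fun t => (RtoC c * form n (c - 1) s t)%C)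
    (fun t => (kap * form n (c + rho - 1) s t)%C));
  apply is_RInt_gen_Cmult_l, is_Phi; auto.
Qed.

Lemma prim_vanish (n : nat) (c s : R) : 0 < s ->
  filterlim (prim n c s) (Rbar_locally p_infty) (locally (T := CR) (RtoC 0)).
Proof.
  intros Hs. destruct (ray_power_bound c s Hs) as [A [B [q [HA [HB [Hq H]]]]]].
  apply (filterlim_norm_zero (V := CR)).
  apply (filterlim_le_le (fun _ => 0) _
    (fun t => A * (Rpower t (INR n) * exp (- (w * Rpower t rho)))
       + B * (Rpower t (INR n + q) * exp (- (w * Rpower t rho)))) (Finite 0)).
  - generalize (p_infty_gt 0). apply filter_imp. intros t Ht.
    split. apply norm_ge_0. rewrite norm_CR.
    assert (L : Cmod (prim n c s t) = Cmod (form n c s t)).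
    { unfold prim, form. rewrite !Cmod_mult, dir_Cmod. ring. }
    rewrite L. eapply Rle_trans; [apply form_Cmod; lra|].
    set (E := exp _). assert (HE : 0 < E) by apply exp_pos.
    rewrite Rpower_plus.
    set (T := Rpower t (INR n)). assert (HT : 0 < T) by apply Rpower_pos.
    replace (A * (T * E) + B * (T * Rpower t q * E))
      with (T * ((A + B * Rpower t q) * E)) by ring.
    apply Rmult_le_compat_l. lra. apply Rmult_le_compat_r. lra. apply H; lra.
  - apply filterlim_const.
  - apply (filterlim_Req _ (A * 0 + B * 0)); [|ring].
    apply (filterlim_Rplus (F := Rbar_locally p_infty));
    apply (filterlim_Rmult (F := Rbar_locally p_infty));
      try apply filterlim_const; apply Rpower_exp_vanish; auto.
Qed.

(** [form' n c s t] is the [t]-derivative of [prim n c s t] up to a multiple of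
    [form (n - 1) c s t]. *)
Lemma Phi_by_parts (n : nat) (c s : R) : 0 < s ->
  (RtoC c * Phi n (c - 1) s + kap * Phi n (c + rho - 1) s)%C =
  match n with
  | O => (- osc c (RtoC s))%C
  | S m => (- RtoC (INR n) * Phi m c s)%C
  end.
Proof.
  intros Hs.
  (* The boundary value at t = 0: the factor (t dir)^n survives only for n = 0. *)
  set (v := match n with O => osc c (RtoC s) | S _ => RtoC 0 end).
  assert (Ev : prim n c s 0 = v).
  { unfold prim, v, ray. rewrite Cmult_0_l, Cplus_0_r. destruct n; simpl; ring. }
  assert (I : is_RInt_gen (V := CR)
    (fun t => (RtoC (INR n) * form (n - 1) c s t + form' n c s t)%C)
    (at_right 0) (Rbar_locally p_infty) (RtoC 0 - v)%C).
  { apply (is_RInt_gen_primitive_derive (V := CR) (fun t => 0 < t) _ (prim n c s)).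
    - apply convex_gt.
    - apply at_right_gt.
    - apply p_infty_gt.
    - intros; apply is_derive_prim; lra.
    - intros. apply (filterlim_Cplus (F := locally x)).
      + apply (filterlim_Cmult (F := locally x)). apply filterlim_const.
        apply form_continuous; lra.
      + unfold form'. apply (filterlim_Cplus (F := locally x));
          apply (filterlim_Cmult (F := locally x)); try apply filterlim_const;
          apply form_continuous; lra.
    - rewrite <- Ev. apply (continuous_at_right (V := CR) (prim n c s)).
      eapply (derive_continuous (V := CR)), is_derive_prim; lra.
    - apply prim_vanish; auto. }
  assert (J := is_RInt_gen_Cplus _ _ _ _
    (is_RInt_gen_Cmult_l (RtoC (INR n)) _ _ (is_Phi (n - 1) c s Hs)) (is_Phi' n c s Hs)).
  assert (E := is_RInt_gen_unique (V := CR) _ _ I).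
  rewrite (is_RInt_gen_unique (V := CR) _ _ J) in E.
  destruct n as [|m].
  (* For n = 0 the index n - 1 is truncated to 0; the factor [INR 0] removes that term. *)
  - unfold v in E. simpl INR in E. 
    rewrite <- (Cplus_0_l (RtoC c * _ + _)%C).
    replace (RtoC 0) with (RtoC 0 * Phi (0 - 1) c s)%C at 1 by ring.
    rewrite E. ring.
  - unfold v in E. replace (S m - 1)%nat with m in E by lia.
    replace (RtoC c * Phi (S m) (c - 1) s + kap * Phi (S m) (c + rho - 1) s)%C
      with ((RtoC (INR (S m)) * Phi m c s +
        (RtoC c * Phi (S m) (c - 1) s + kap * Phi (S m) (c + rho - 1) s))
        - RtoC (INR (S m)) * Phi m c s)%C by ring.
    rewrite E. ring.
Qed.

(** The second-order Taylor remainder in [s] has a majorant integrable in [t]. *)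
Lemma is_derive_Phi_aux (n : nat) (c s : R) : 0 < s ->
  is_derive (V := CR) (Phi n c) s
    (RtoC c * Phi n (c - 1) s + kap * Phi n (c + rho - 1) s)%C.
Proof.
  intros Hs.
  destruct (form'_dominated n (c - 1) s Hs) as [h1 [D1 H1]].
  destruct (form'_dominated n (c + rho - 1) s Hs) as [h2 [D2 H2]].
  set (h := fun t => Cmod c * h1 t + Cmod (kap) * h2 t).
  assert (Dh : dominating h).
  { apply dominating_plus; apply dominating_scal; auto; apply Cmod_ge_0. }
  destruct Dh as [_ [hpos [lh Ih]]].
  assert (Hlh : 0 <= lh).
  { eapply Rle_trans; [apply Cmod_ge_0|].
    apply (Cmod_le_RInt_gen (fun t => RtoC (h t)) h (RtoC lh) lh); auto.
    intros; rewrite Cmod_R, Rabs_pos_eq; auto. lra.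
    apply is_RInt_gen_RtoC; exact Ih. }
  (* Radius s/2 keeps every intermediate base point in [s/2, 2s], where the majorant [h] of the
     second derivative holds; the constant is the integral of [h]. *)
  apply (is_derive_quadratic _ s (s / 2) lh); auto. lra.
  intros y Hy. apply Rabs_lt_between in Hy.
  assert (Hy0 : 0 < y) by lra.
  assert (Ilin := is_RInt_gen_Cminus _ _ _ _
    (is_RInt_gen_Cminus _ _ _ _ (is_Phi n c y Hy0) (is_Phi n c s Hs))
    (is_RInt_gen_Cmult_l (RtoC (y - s)) _ _ (is_Phi' n c s Hs))).
  rewrite Rmult_comm.
  eapply Cmod_le_RInt_gen; [|exact Ilin|
    apply (is_RInt_gen_scal (V := RR) h ((y - s) * (y - s)) lh Ih)].
  intros t Ht. cbv beta. unfold scal; simpl; unfold mult; simpl.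
  rewrite (Rmult_comm _ (h t)).
  assert (B : forall x, Rmin s y <= x <= Rmax s y -> s / 2 <= x <= 2 * s).
  { intros x. unfold Rmin, Rmax. destruct Rle_dec; lra. }
  apply (Cmod_Taylor2 (fun s => form n c s t) (fun s => form' n c s t)
    (fun s => (RtoC c * form' n (c - 1) s t + kap * form' n (c + rho - 1) s t)%C));
    intros x Hx; apply B in Hx.
  - apply (is_derive_form_s n c x t); lra.
  - apply (is_derive_form'_s n c x t); lra.
  - assert (K : forall d, continuous (U := CR) (fun s => form' n d s t) x).
    { intros d. eapply (derive_continuous (V := CR)), (is_derive_form'_s n d x t); lra. }
    apply (filterlim_Cplus (F := locally x)); apply (filterlim_Cmult (F := locally x));
      try apply filterlim_const; apply K.
  - unfold h. eapply Rle_trans; [apply Cmod_triangle|].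
    rewrite !Cmod_mult. apply Rplus_le_compat; apply Rmult_le_compat_l;
      auto; apply Cmod_ge_0.
Qed.

Lemma is_derive_Phi_0 (c s : R) : 0 < s ->
  is_derive (V := CR) (Phi 0 c) s (- osc c (RtoC s))%C.
Proof.
  intros Hs. eapply is_derive_Ceq. apply is_derive_Phi_aux; auto.
  apply (Phi_by_parts 0); auto.
Qed.

Lemma is_derive_Phi_S (n : nat) (c s : R) : 0 < s ->
  is_derive (V := CR) (Phi (S n) c) s (- RtoC (INR (S n)) * Phi n c s)%C.
Proof.
  intros Hs. eapply is_derive_Ceq. apply is_derive_Phi_aux; auto.
  apply (Phi_by_parts (S n)); auto.
Qed.

(** As c <= 0 and |z| >= s, the factor |z|^c is at most s^c and leaves the integral. What remains is
    a Gamma integral of parameter n + 1. *)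
Lemma Phi_Cmod (n : nat) (c s : R) : 0 < s -> c <= 0 ->
  Cmod (Phi n c s) <=
  Rpower s c * (/ rho * Gamma ((INR n + 1) / rho) * Rpower w (- ((INR n + 1) / rho))).
Proof.
  intros Hs Hc. assert (Hn := pos_INR n).
  apply (Cmod_le_RInt_gen (form n c s) (fun t => Rpower s c * powexp w rho (INR n + 1) t)).
  - intros t Ht. eapply Rle_trans; [apply form_Cmod; lra|].
    unfold powexp. replace (INR n + 1 - 1) with (INR n) by ring.
    set (E := exp _). assert (HE : 0 < E) by apply exp_pos.
    set (T := Rpower t (INR n)). assert (HT : 0 < T) by apply Rpower_pos.
    replace (Rpower s c * (T * E)) with (T * (Rpower s c * E)) by ring.
    apply Rmult_le_compat_l. lra. apply Rmult_le_compat_r. lra.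
    assert (L := ray_ge_s s t ltac:(lra) ltac:(lra)).
    replace c with (- - c) by ring. rewrite !(Rpower_Ropp _ (- c)).
    apply Rinv_le_contravar. apply Rpower_pos. apply Rpower_le_base; lra.
  - apply is_Phi; auto.
  - apply (is_RInt_gen_scal (V := RR)), is_RInt_gen_powexp; lra.
Qed.

(** Closed form of the ray integral from the base point 0; it converges for c > -1. *)
Definition Phi_0 (n : nat) (c : R) : C :=
  (RtoC (/ rho * Gamma ((INR n + c + 1) / rho) * Rpower w (- ((INR n + c + 1) / rho)))
   * Cexp (Ci * RtoC (sg * theta * (INR n + c + 1))))%C.

Lemma dir_pow (n : nat) :
  (Cpow (dir) n * dir)%C =
  Cexp (Ci * RtoC (sg * theta * (INR n + 1))).
Proof.
  induction n.
  - simpl. unfold dir. rewrite Cmult_1_l. f_equal. f_equal. f_equal. ring.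
  - rewrite Cpow_S, <- Cmult_assoc, IHn. unfold dir. rewrite <- Cexp_add.
    f_equal. rewrite <- Cmult_plus_distr_l, <- RtoC_plus. f_equal. f_equal.
    rewrite S_INR. ring.
Qed.

Lemma form_0 (n : nat) (c t : R) : 0 < t ->
  form n c 0 t =
  (Cexp (Ci * RtoC (sg * theta * (INR n + c + 1)))
   * RtoC (powexp w rho (INR n + c + 1) t))%C.
Proof.
  intros Ht. unfold form. rewrite osc_ray_0 by auto.
  rewrite Cpow_mult_l, <- RtoC_pow, pow_Rpower by auto.
  replace (sg * theta * (INR n + c + 1)) with
    (sg * theta * (INR n + 1) + sg * theta * c) by ring.
  rewrite RtoC_plus, Cmult_plus_distr_l, Cexp_add, <- dir_pow.
  unfold powexp. replace (INR n + c + 1 - 1) with (INR n + c) by ring.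
  rewrite Rpower_plus.
  rewrite (RtoC_mult (Rpower t (INR n) * Rpower t c)),
    (RtoC_mult (Rpower t (INR n))), (RtoC_mult (Rpower t c)).
  ring.
Qed.

Lemma is_Phi_0 (n : nat) (c : R) : -1 < c ->
  is_RInt_gen (V := CR) (form n c 0) (at_right 0) (Rbar_locally p_infty)
    (Phi_0 n c).
Proof.
  intros Hc. assert (Hn := pos_INR n). unfold Phi_0. rewrite Cmult_comm.
  apply (is_RInt_gen_ext_on (V := CR) (fun t => 0 < t) (fun t =>
   (Cexp (Ci * RtoC (sg * theta * (INR n + c + 1)))
   * RtoC (powexp w rho (INR n + c + 1) t))%C)).
  apply convex_gt. apply at_right_gt. apply p_infty_gt.
  intros; symmetry; apply form_0; auto.
  apply is_RInt_gen_Cmult_l.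
  apply is_RInt_gen_RtoC, is_RInt_gen_powexp; lra.
Qed.

(** * The limit of the ray integrals as the base point tends to 0 *)

Section Limit.
Variables (n : nat) (c : R).
Hypothesis Hc : -1 < c <= 0.
(** Halves the singular exponent: c - 1 = 2 (be - 1) with be > 0, so s^(be-1) is integrable in [s]
    near 0 and t^(n+be-1) in [t] near 0. *)
Let be := (c + 1) / 2.

Definition Kdom (t : R) : R :=
  (Rabs c + w * rho * Rpower 2 rho) * powexp w rho (INR n + be) t
  + w * rho * Rpower 2 rho * powexp w rho (INR n + be + rho) t.

Lemma Kdom_dominating : dominating Kdom.
Proof.
  assert (Hn := pos_INR n). assert (H2 := Rpower_pos 2 rho). assert (Ha := Rabs_pos c).
  assert (0 < w * rho) by nra.
  apply dominating_plus; apply dominating_scal; try (apply dominating_powexp; unfold be; lra).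
  - nra.
  - nra.
Qed.

(** [|z|^(c-1) = (|z|^(be-1))^2], with one factor bounded by [s^(be-1)] and the
    other by [t^(be-1)] *)
Lemma form'_Kdom (s t : R) : 0 < s <= 1 -> 0 < t ->
  Cmod (form' n c s t) <= Kdom t * Rpower s (be - 1).
Proof.
  intros Hs Ht. unfold form'. eapply Rle_trans; [apply Cmod_triangle|].
  rewrite !Cmod_mult, Cmod_R, kap_Cmod.
  assert (F1 := form_Cmod n (c - 1) s t ltac:(lra) Ht).
  assert (F2 := form_Cmod n (c + rho - 1) s t ltac:(lra) Ht).
  set (z := Cmod (ray s t)) in *.
  assert (Zs : s <= z) by (apply ray_ge_s; auto; lra).
  assert (Zt : t <= z) by (apply ray_ge_t; auto; lra).
  assert (Zst : z <= s + t) by (apply ray_le; lra).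
  set (E := exp (- (w * Rpower t rho))) in *. assert (HE : 0 < E) by apply exp_pos.
  set (T := Rpower t (INR n)) in *. assert (HT : 0 < T) by apply Rpower_pos.
  set (S := Rpower s (be - 1)). assert (HS : 0 < S) by apply Rpower_pos.
  set (U := Rpower t (be - 1)). assert (HU : 0 < U) by apply Rpower_pos.
  assert (A1 : Rpower z (c - 1) <= S * U).
  { replace (c - 1) with ((be - 1) + (be - 1)) by (unfold be; field).
    rewrite Rpower_plus.
    assert (Inv : forall x, 0 < x <= z -> Rpower z (be - 1) <= Rpower x (be - 1)).
    { intros x Hx. replace (be - 1) with (- (1 - be)) by ring. rewrite !Rpower_Ropp.
      apply Rinv_le_contravar. apply Rpower_pos. apply Rpower_le_base; unfold be; lra. }
    apply Rmult_le_compat; try (left; apply Rpower_pos); apply Inv; lra. }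
  (* As s <= 1, the modulus is at most 1 + t, hence at most 2 or at most 2 t. *)
  assert (A2 : Rpower z rho <= Rpower 2 rho * (1 + Rpower t rho)).
  { assert (0 < Rpower t rho) by apply Rpower_pos.
    assert (0 < Rpower 2 rho) by apply Rpower_pos.
    destruct (Rle_dec t 1).
    - apply Rle_trans with (Rpower 2 rho). apply Rpower_le_base; lra. nra.
    - apply Rle_trans with (Rpower (2 * t) rho). apply Rpower_le_base; lra.
      rewrite <- Rpower_mult_distr by lra. nra. }
  assert (A3 : Rpower z (c + rho - 1) <= S * U * (Rpower 2 rho * (1 + Rpower t rho))).
  { replace (c + rho - 1) with ((c - 1) + rho) by ring. rewrite Rpower_plus.
    apply Rmult_le_compat; auto; left; apply Rpower_pos. }
  unfold Kdom, powexp.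
  replace (INR n + be - 1) with (INR n + (be - 1)) by ring.
  replace (INR n + be + rho - 1) with (INR n + (be - 1) + rho) by ring.
  rewrite !Rpower_plus. fold E T U.
  replace (((Rabs c + w * rho * Rpower 2 rho) * (T * U * E)
     + w * rho * Rpower 2 rho * (T * U * Rpower t rho * E)) * S)
    with (Rabs c * (T * (S * U * E))
      + w * rho * (T * (S * U * (Rpower 2 rho * (1 + Rpower t rho)) * E))) by ring.
  apply Rplus_le_compat; apply Rmult_le_compat_l.
  - apply Rabs_pos.
  - eapply Rle_trans; [exact F1|]. apply Rmult_le_compat_l. lra.
    apply Rmult_le_compat_r; lra.
  - nra.
  - eapply Rle_trans; [exact F2|]. apply Rmult_le_compat_l. lra.
    apply Rmult_le_compat_r; lra.
Qed.

(** The bound on the [s]-derivative is singular at 0. It is integrated from s0 > 0 to s, where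
    s^(be-1) has the primitive s^be/be, and then s0 tends to 0 at fixed [t]. *)
Lemma form_diff_Kdom (s t : R) : 0 < s <= 1 -> 0 < t ->
  Cmod (form n c s t - form n c 0 t)%C <= Rpower s be / be * Kdom t.
Proof.
  intros Hs Ht. assert (Hbe : 0 < be) by (unfold be; lra).
  assert (HK : 0 <= Kdom t) by (apply Kdom_dominating; auto).
  assert (W : forall s0, 0 < s0 < s ->
    Cmod (form n c s t - form n c s0 t)%C <= Rpower s be / be * Kdom t).
  { intros s0 Hs0.
    assert (I := is_RInt_derive (V := CR) (fun s => form n c s t)
      (fun s => form' n c s t) s0 s).
    assert (J := is_RInt_derive (V := RR) (fun x => Kdom t * (Rpower x be / be))
      (fun x => Kdom t * Rpower x (be - 1)) s0 s).
    rewrite Rmin_left, Rmax_right in I, J by lra.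
    assert (L : norm (minus (form n c s t : CR) (form n c s0 t)) <=
      minus (Kdom t * (Rpower s be / be)) (Kdom t * (Rpower s0 be / be))).
    { apply (norm_RInt_le (V := CR) (fun s => form' n c s t)
        (fun x => Kdom t * Rpower x (be - 1)) s0 s). lra.
      - intros x Hx. rewrite norm_CR. apply form'_Kdom; lra.
      - apply I.
        + intros x Hx. apply (is_derive_form_s n c x t); lra.
        + intros x Hx. eapply (derive_continuous (V := CR)), (is_derive_form'_s n c x t); lra.
      - apply J.
        + intros x Hx. eapply is_derive_Req.
          * apply (is_derive_scal (fun x => Rpower x be / be)).
            apply (is_derive_ext (fun x => / be * Rpower x be)).
            intros; apply Rmult_comm.
            apply (is_derive_scal (fun x => Rpower x be)).
            apply (is_derive_Rpower (fun x => x)). apply (is_derive_id (K := R_AbsRing)). lra.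
          * unfold one; simpl. field. lra.
        + intros x Hx. apply continuous_Rmult. apply continuous_const.
          apply continuous_Rpower; lra. }
    rewrite norm_CR in L. eapply Rle_trans; [exact L|].
    unfold minus, plus, opp; simpl.
    assert (0 <= Kdom t * (Rpower s0 be / be)).
    { apply Rmult_le_pos; auto. left. apply Rdiv_lt_0_compat; auto. apply Rpower_pos. }
    lra. }
  assert (Lim : filterlim (fun s0 => norm ((form n c s t - form n c s0 t)%C : CR))
    (at_right 0) (locally (norm ((form n c s t - form n c 0 t)%C : CR)))).
  { eapply filterlim_comp; [|apply (filterlim_norm (V := CR))].
    apply (continuous_at_right (V := CR)
      (fun s0 => (form n c s t - form n c s0 t)%C)).
    apply (continuous_minus (V := CR)). apply continuous_const.
    apply (form_continuous_s n c 0 t); lra. }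
  rewrite <- norm_CR.
  apply (filterlim_le (F := at_right 0) (fun s0 =>
    norm ((form n c s t - form n c s0 t)%C : CR))
    (fun _ => Rpower s be / be * Kdom t) (norm ((form n c s t - form n c 0 t)%C : CR))
    (Rpower s be / be * Kdom t)).
  - generalize (filter_and _ _ (at_right_gt 0) (at_right_lt 0 s (proj1 Hs))).
    apply filter_imp. intros s0 Hs0. rewrite norm_CR. apply W; auto.
  - exact Lim.
  - apply filterlim_const.
Qed.

Lemma Phi_limit_0 :
  filterlim (Phi n c) (at_right 0) (locally (T := CR) (Phi_0 n c)).
Proof.
  assert (Hbe : 0 < be) by (unfold be; lra).
  destruct Kdom_dominating as [_ [_ [lK IK]]].
  assert (Est : forall s, 0 < s <= 1 ->
    Cmod (Phi n c s - Phi_0 n c)%C <= Rpower s be / be * lK).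
  { intros s Hs.
    apply (Cmod_le_RInt_gen (fun t => (form n c s t - form n c 0 t)%C)
      (fun t => Rpower s be / be * Kdom t)).
    - intros; apply form_diff_Kdom; auto.
    - apply is_RInt_gen_Cminus. apply is_Phi; auto; lra. apply is_Phi_0; lra.
    - apply (is_RInt_gen_scal (V := RR)); auto. }
  assert (L : filterlim (fun s => (Phi n c s - Phi_0 n c)%C) (at_right 0)
    (locally (T := CR) (RtoC 0))).
  { apply (filterlim_norm_zero (V := CR)).
    apply (filterlim_le_le (fun _ => 0) _ (fun s => Rpower s be * (/ be * lK)) (Finite 0)).
    - generalize (filter_and _ _ (at_right_gt 0) (at_right_lt 0 1 Rlt_0_1)).
      apply filter_imp. intros s [H1 H2]. split. apply norm_ge_0.
      rewrite norm_CR. eapply Rle_trans; [apply Est; lra|]. right; field. lra.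
    - apply filterlim_const.
    - apply (filterlim_Req _ (0 * (/ be * lK))); [|ring].
      apply (filterlim_Rmult (F := at_right 0)); [|apply filterlim_const].
      apply filterlim_Rpower_0; auto. }
  assert (L2 := filterlim_Cplus (F := at_right 0) _ (fun _ => Phi_0 n c) _ _ L (filterlim_const _)).
  rewrite Cplus_0_l in L2.
  revert L2. apply filterlim_ext. intros s.
  ring_C.
Qed.
End Limit.

(** [Phi_by_parts] at the exponent [1 - rho], which makes [Phi n 0] appear. *)
Lemma Phi_oscillation_bound (n : nat) (s : R) : 0 < s ->
  w * rho * Cmod (Phi n 0 s) <=
  (rho - 1) * (Rpower s (- rho)
    * (/ rho * Gamma ((INR n + 1) / rho) * Rpower w (- ((INR n + 1) / rho))))
  + match n with
    | O => Rpower s (1 - rho)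
    | S m => INR n * (Rpower s (1 - rho)
        * (/ rho * Gamma ((INR m + 1) / rho) * Rpower w (- ((INR m + 1) / rho))))
    end.
Proof.
  intros Hs. rewrite <- kap_Cmod, <- Cmod_mult.
  assert (E := Phi_by_parts n (1 - rho) s Hs).
  replace (1 - rho + rho - 1) with 0 in E by ring.
  replace (1 - rho - 1) with (- rho) in E by ring.
  set (v := match n with O => (- osc (1 - rho) (RtoC s))%C
    | S m => (- RtoC (INR n) * Phi m (1 - rho) s)%C end) in E.
  replace (kap * Phi n 0 s)%C
    with (RtoC (rho - 1) * Phi n (- rho) s + v)%C.
  2:{ rewrite <- E, !RtoC_minus. ring. }
  eapply Rle_trans; [apply Cmod_triangle|]. apply Rplus_le_compat.
  - rewrite Cmod_mult, Cmod_R, Rabs_pos_eq by lra. apply Rmult_le_compat_l. lra.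
    apply Phi_Cmod; auto. lra.
  - unfold v. destruct n as [|m].
    + rewrite Cmod_opp. unfold osc. rewrite !Cpowr_RtoC by auto.
      rewrite Cmod_mult, Cmod_R, Rabs_pos_eq by (left; apply Rpower_pos).
      (* At a real point the exponent is purely imaginary, so the oscillating factor has modulus
         1. *)
      rewrite Cmod_Cexp. simpl.
      match goal with |- _ * exp ?x <= _ => replace x with 0 by ring end.
      rewrite exp_0. lra.
    + rewrite Cmod_mult, Cmod_opp, Cmod_R, Rabs_pos_eq by apply pos_INR.
      apply Rmult_le_compat_l. apply pos_INR. apply Phi_Cmod; auto. lra.
Qed.

End Ray.

(** * The refined kernel bound *)

Section Root.
Variables (a b c rho : R).
Hypotheses (Ha : 0 < a) (Hb : 0 <= b) (Hc : 0 < c) (Hrho : 2 <= rho).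

(** [(a K^rho - b K - c) / K], which is increasing *)
Let q K := a * Rpower K (rho - 1) - b - c * / K.

Lemma root_iff (K : R) : 0 < K ->
  (a * rpow K rho - b * K - c = 0 <-> q K = 0).
Proof.
  intros HK. rewrite rpow_pos_base by auto.
  replace (a * Rpower K rho - b * K - c) with (q K * K).
  - split; intros H. apply Rmult_integral in H. destruct H; lra. rewrite H; ring.
  - unfold q. replace rho with ((rho - 1) + 1) at 2 by ring.
    rewrite Rpower_plus, Rpower_1 by auto. field. lra.
Qed.

Lemma root_quotient_increasing (x y : R) : 0 < x -> x < y -> q x < q y.
Proof.
  intros Hx Hxy. unfold q.
  assert (Rpower x (rho - 1) < Rpower y (rho - 1)) by (apply Rpower_lt_base; lra).
  assert (/ y < / x) by (apply Rinv_lt_contravar; [nra|auto]).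
  nra.
Qed.

Lemma root_unique : exists K,
  unique (fun K => 0 < K /\ a * rpow K rho - b * K - c = 0) K.
Proof.
  (* At [K0] one has a K0^(rho-1) <= a <= c/K0, so [q] is at most 0. At [K1] one has a K1^(rho-1) >=
     a K1 >= b + c >= b + c/K1, using rho >= 2. *)
  set (K0 := Rmin 1 (c / a)). set (K1 := Rmax 1 ((b + c) / a)).
  assert (H0 : 0 < K0) by (apply Rmin_glb_lt; [lra|apply Rdiv_lt_0_compat; auto]).
  assert (H01 : K0 <= 1) by apply Rmin_l.
  assert (H02 : K0 <= c / a) by apply Rmin_r.
  assert (H11 : 1 <= K1) by apply Rmax_l.
  assert (H12 : (b + c) / a <= K1) by apply Rmax_r.
  assert (Q0 : q K0 <= 0).
  { unfold q.
    assert (Rpower K0 (rho - 1) <= 1).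
    { rewrite <- (Rpower_1l (rho - 1)) || replace 1 with (Rpower 1 (rho - 1)) at 2
        by (unfold Rpower; rewrite ln_1, Rmult_0_r; apply exp_0).
      apply Rpower_le_base; lra. }
    assert (a <= c * / K0).
    { apply Rmult_le_reg_r with K0; auto. rewrite Rmult_assoc, Rinv_l, Rmult_1_r by lra.
      apply (Rmult_le_compat_l a) in H02; [|lra].
      replace (a * (c / a)) with c in H02 by (field; lra). lra. }
    nra. }
  assert (Q1 : 0 <= q K1).
  { unfold q.
    assert (K1 <= Rpower K1 (rho - 1)).
    { rewrite <- (Rpower_1 K1) at 1 by lra. apply Rle_Rpower; lra. }
    assert (/ K1 <= 1) by (rewrite <- Rinv_1; apply Rinv_le_contravar; lra).
    apply (Rmult_le_compat_l a) in H12; [|lra].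
    replace (a * ((b + c) / a)) with (b + c) in H12 by (field; lra). nra. }
  assert (HK : K0 <= K1) by lra.
  (* [q] is singular at 0; clamping its argument at [K0] makes it continuous on the whole line
     without changing it on [K0, K1]. *)
  set (q' := fun K => q (Rmax K0 K)).
  destruct (IVT_gen q' K0 K1 0) as [K [HK1 HK2]].
  - intros x. apply continuity_pt_filterlim. unfold q'.
    apply (continuous_comp (fun K => Rmax K0 K) q).
    + apply continuous_Rmax_l.
    + assert (P : 0 < Rmax K0 x) by (eapply Rlt_le_trans; [exact H0|apply Rmax_l]).
      unfold q. apply (continuous_minus (V := R_NormedModule)).
      * apply (continuous_minus (V := R_NormedModule)); [|apply continuous_const].
        apply continuous_Rmult. apply continuous_const. apply continuous_Rpower; auto.
      * apply continuous_Rmult. apply continuous_const.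
        apply (ex_derive_continuous (V := R_NormedModule)). auto_derive. lra.
  - unfold q'. rewrite !Rmax_right by lra. rewrite Rmin_left; lra.
  - rewrite Rmin_left, Rmax_right in HK1 by lra. unfold q' in HK2.
    rewrite Rmax_right in HK2 by lra.
    exists K. split.
    + split. lra. apply root_iff; auto. lra.
    + intros K' [H1 H2]. apply root_iff in H2; auto.
      destruct (Rtotal_order K K') as [L|[L|L]]; auto.
      generalize (root_quotient_increasing K K'). lra. generalize (root_quotient_increasing K' K). lra.
Qed.

(** For X <= K, a <= a (K/X)^ga. For X > K, multiply the second bound by X^ga: the exponents 1 - rho
    + ga and -rho + ga are negative, since rho >= 2 and ga < 1, so X may be replaced by K, and the
    equation for K turns the result into a K^ga. *)
Lemma two_regime_bound (K ga X f : R) : 0 < ga < 1 -> 0 < X -> 0 < K ->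
  a * rpow K rho - b * K - c = 0 ->
  f <= a -> f <= b * Rpower X (1 - rho) + c * Rpower X (- rho) ->
  f <= a * rpow K ga * Rpower X (- ga).
Proof.
  intros Hga HX HK E F1 F2.
  rewrite !rpow_pos_base in * by auto.
  assert (PX := Rpower_pos X ga). assert (PK := Rpower_pos K ga).
  rewrite Rpower_Ropp.
  destruct (Rle_dec X K) as [L|L].
  - eapply Rle_trans; [exact F1|]. rewrite Rmult_assoc.
    rewrite <- (Rmult_1_r a) at 1. apply Rmult_le_compat_l. lra.
    apply Rmult_le_reg_r with (Rpower X ga); auto.
    rewrite Rmult_assoc, Rinv_l, Rmult_1_l, Rmult_1_r by lra.
    apply Rpower_le_base; lra.
  - eapply Rle_trans; [exact F2|].
    assert (D : forall d, d <= 0 -> Rpower X d <= Rpower K d).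
    { intros d Hd. replace d with (- - d) by ring. rewrite !(Rpower_Ropp _ (- d)).
      apply Rinv_le_contravar. apply Rpower_pos. apply Rpower_le_base; lra. }
    replace (1 - rho) with ((1 - rho + ga) + - ga) by ring.
    replace (- rho) with ((- rho + ga) + - ga) by ring.
    rewrite (Rpower_plus (1 - rho + ga)), (Rpower_plus (- rho + ga)), Rpower_Ropp.
    assert (PI : 0 < / Rpower X ga) by (apply Rinv_0_lt_compat; auto).
    apply Rle_trans with ((b * Rpower K (1 - rho + ga) + c * Rpower K (- rho + ga)) * / Rpower X ga).
    + rewrite Rmult_plus_distr_r, <- !Rmult_assoc.
      apply Rplus_le_compat; apply Rmult_le_compat_r; try lra;
        apply Rmult_le_compat_l; try lra; apply D; lra.
    + apply Rmult_le_compat_r. lra. right.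
      replace (a * Rpower K ga) with (a * Rpower K rho * Rpower K (- rho + ga)).
      * replace (a * Rpower K rho) with (b * K + c) by lra.
        replace (1 - rho + ga) with (1 + (- rho + ga)) by ring.
        rewrite (Rpower_plus 1), Rpower_1 by auto. ring.
      * rewrite Rmult_assoc, <- Rpower_plus. f_equal. f_equal. ring.
Qed.
End Root.

(** * Origin of the constants in the refined bound *)

Section Constants.
Variables (rho : R) (N : nat).
Hypotheses (Hrho : 1 <= rho) (HN : (1 <= N)%nat).

Lemma INR_N_pos : 0 < INR N.
Proof. apply lt_0_INR. lia. Qed.

Lemma fact_pos (n : nat) : 0 < INR (fact n).
Proof. apply INR_fact_lt_0. Qed.

Lemma a_cst_pos : 0 < a_cst rho N.
Proof.
  unfold a_cst. assert (H := fact_pos (N - 1)). assert (HN' := INR_N_pos).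
  apply Rdiv_lt_0_compat.
  - apply Gamma_pos. apply Rdiv_lt_0_compat; lra.
  - apply Rmult_lt_0_compat; lra.
Qed.

Lemma b_cst_pos : 0 < b_cst rho N.
Proof.
  unfold b_cst. destruct Nat.eq_dec.
  - apply Rinv_0_lt_compat; lra.
  - assert (H := fact_pos (N - 2)).
    assert (1 < INR N) by (apply (lt_INR 1); lia).
    apply Rdiv_lt_0_compat.
    + apply Gamma_pos. apply Rdiv_lt_0_compat; lra.
    + apply Rmult_lt_0_compat; auto. apply pow_lt; lra.
Qed.

Lemma c_cst_pos : 1 < rho -> 0 < c_cst rho N.
Proof.
  intros. unfold c_cst. assert (HN' := INR_N_pos). assert (Hf := fact_pos (N - 1)).
  apply Rdiv_lt_0_compat.
  - apply Rmult_lt_0_compat. lra. apply Gamma_pos. apply Rdiv_lt_0_compat; lra.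
  - apply Rmult_lt_0_compat; auto. apply pow_lt; lra.
Qed.

Variables (sg w s : R).
Hypotheses (Hsg : sg = 1 \/ sg = -1) (Hw : 0 < w) (Hs : 0 < s).

(** Multiplied by w^(N/rho) and read in the variable X = s w^(1/rho), the kernel for mu = 1 obeys
    bounds whose constants no longer contain [w]. *)
Let f := / INR (fact (N - 1)) * Cmod (Phi sg rho w (N - 1) 0 s) * Rpower w (INR N / rho).
Let X := s * Rpower w (/ rho).

Lemma INR_pred : INR (N - 1) + 1 = INR N.
Proof. rewrite minus_INR by lia. simpl. ring. Qed.

(** This is [Phi_Cmod] at c = 0, where s^c = 1; [a_cst] is the constant it leaves. *)
Lemma Phi_first_regime : f <= a_cst rho N.
Proof.
  assert (B := Phi_Cmod sg rho w Hsg Hrho Hw (N - 1) 0 s Hs (Rle_refl 0)).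
  rewrite INR_pred, Rpower_O, Rmult_1_l in B by auto.
  assert (Hf := fact_pos (N - 1)). assert (P := Rpower_pos w (INR N / rho)).
  unfold f, a_cst.
  replace (Gamma (INR N / rho) / (INR (fact (N - 1)) * rho)) with
    (/ INR (fact (N - 1)) * (/ rho * Gamma (INR N / rho) * Rpower w (- (INR N / rho)))
     * Rpower w (INR N / rho)).
  - apply Rmult_le_compat_r. lra. apply Rmult_le_compat_l; auto.
    left; apply Rinv_0_lt_compat; auto.
  - rewrite Rpower_Ropp. field. repeat split; lra.
Qed.

(** This is [Phi_oscillation_bound] divided by w rho (N-1)!. The term with rho - 1 gives [c_cst].
    The other gives [b_cst]: for N = 1 it is a boundary term and carries no Gamma factor. *)
Lemma Phi_second_regime :
  f <= b_cst rho N * Rpower X (1 - rho) + c_cst rho N * Rpower X (- rho).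
Proof.
  assert (B := Phi_oscillation_bound sg rho w Hsg Hrho Hw (N - 1) s Hs).
  rewrite INR_pred in B.
  assert (Hf := fact_pos (N - 1)). assert (P := Rpower_pos w (INR N / rho)).
  assert (EX : forall d, Rpower X d = Rpower s d * Rpower w (d / rho)).
  { intros d. unfold X. rewrite <- Rpower_mult_distr by (auto; apply Rpower_pos).
    rewrite Rpower_mult. f_equal. f_equal. field; lra. }
  set (F := / (INR (fact (N - 1)) * (w * rho)) * Rpower w (INR N / rho)).
  assert (HF : 0 < F).
  { unfold F. apply Rmult_lt_0_compat; auto. apply Rinv_0_lt_compat.
    apply Rmult_lt_0_compat; auto. nra. }
  replace f with (w * rho * Cmod (Phi sg rho w (N - 1) 0 s) * F).
  2:{ unfold f, F. field. repeat split; lra. }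
  apply (Rmult_le_compat_r F) in B; [|lra].
  eapply Rle_trans; [exact B|]. right.
  rewrite Rmult_plus_distr_r, Rplus_comm, !EX. f_equal.
  - unfold b_cst. destruct Nat.eq_dec as [->|n].
    + simpl. unfold F. simpl.
      replace ((1 - rho) / rho) with (- (1) + 1 / rho) by (field; lra).
      rewrite Rpower_plus, Rpower_Ropp, Rpower_1 by auto. field. repeat split; lra.
    (* The factor N - 1 from the integration by parts reduces 1/(N-1)! to the 1/(N-2)! of
       [b_cst]. *)
    + destruct N as [|[|m]]; [lia|lia|].
      replace (S (S m) - 1)%nat with (S m) in * by lia.
      replace (S (S m) - 2)%nat with m by lia.
      unfold F. replace (S (S m) - 1)%nat with (S m) in * by lia.
      replace (INR (S (S m)) - 1) with (INR (S m)) by (rewrite (S_INR (S m)); ring).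
      rewrite <- (S_INR m).
      replace ((1 - rho) / rho) with (- (1) + / rho) by (field; lra).
      replace (INR (S (S m)) / rho) with (INR (S m) / rho + / rho)
        by (rewrite (S_INR (S m)); field; lra).
      rewrite !Rpower_plus, !Rpower_Ropp, Rpower_1 by auto.
      rewrite fact_simpl, mult_INR.
      assert (0 < INR (S m)) by (apply lt_0_INR; lia).
      assert (Hm := fact_pos m). assert (P1 := Rpower_pos w (INR (S m) / rho)).
      field. repeat split; lra.
  - unfold c_cst, F.
    replace (- rho / rho) with (- (1)) by (field; lra).
    rewrite !(Rpower_Ropp w), Rpower_1 by auto. field. repeat split; lra.
Qed.

(** Undoing the scaling: X^(-ga) contributes s^(-ga) and w^(-ga/rho), and the normalization
    contributes w^(-N/rho). Together the powers of [w] give the exponent -(ga + N)/rho. *)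
Lemma Phi_refined (ga K : R) : 2 <= rho -> 0 < ga < 1 -> K_root rho N K ->
  / INR (fact (N - 1)) * Cmod (Phi sg rho w (N - 1) 0 s) <=
  L_cst ga rho N K * Rpower s (- ga) * Rpower w (- ((ga + INR N) / rho)).
Proof.
  intros H2 Hga [HK E].
  assert (HX : 0 < X) by (apply Rmult_lt_0_compat; auto; apply Rpower_pos).
  assert (Hb := b_cst_pos). assert (Hc := c_cst_pos ltac:(lra)).
  assert (B := two_regime_bound (a_cst rho N) (b_cst rho N) (c_cst rho N) rho
    a_cst_pos (Rlt_le _ _ Hb) Hc H2 K ga X f Hga HX HK E Phi_first_regime Phi_second_regime).
  assert (P := Rpower_pos w (- (INR N / rho))).
  apply (Rmult_le_compat_r (Rpower w (- (INR N / rho)))) in B; [|lra].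
  replace (/ INR (fact (N - 1)) * Cmod (Phi sg rho w (N - 1) 0 s))
    with (f * Rpower w (- (INR N / rho))).
  - eapply Rle_trans; [exact B|]. right. unfold L_cst, X.
    rewrite <- (Rpower_mult_distr s) by (auto; apply Rpower_pos). rewrite Rpower_mult.
    replace (- ((ga + INR N) / rho)) with (/ rho * - ga + - (INR N / rho)) by (field; lra).
    rewrite Rpower_plus. ring.
  - unfold f. rewrite Rpower_Ropp. field.
    assert (Hf := fact_pos (N - 1)). assert (P' := Rpower_pos w (INR N / rho)).
    split; lra.
Qed.
End Constants.

Lemma sgn_cases (l : endpoint) : sgn l = 1 \/ sgn l = -1.
Proof. destruct l; unfold sgn; simpl; [left|right]; ring. Qed.

(** * The kernels of the statement as ray integrals *)

Section Kernel.
Variables (rho mu : endpoint -> R) (l : endpoint) (N : nat) (s w : R).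
Hypotheses (Hrho : 1 <= rho l) (Hw : 0 < w) (Hs : 0 < s).

(** The integrands agree pointwise, because z - s = t dir on the ray. As s > 0 the integrand is
    continuous at t = 0, so the lower end may be the point 0 instead of a right limit. *)
Lemma is_ray_integral :
  is_RInt_gen (V := CR) (ray_form rho l s (kernel_integrand rho mu l (N - 1) s w))
    (at_point 0) (Rbar_locally p_infty) (Phi (sgn l) (rho l) w (N - 1) (mu l - 1) s).
Proof.
  assert (E : forall t, ray_form rho l s (kernel_integrand rho mu l (N - 1) s w) t =
    form (sgn l) (rho l) w (N - 1) (mu l - 1) s t).
  { intros t. unfold ray_form, kernel_integrand, form, osc, ray, ray_dir, dir, theta.
    set (d := Cexp _).
    replace (RtoC s + RtoC t * d - RtoC s)%C with (RtoC t * d)%C by ring. ring. }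
  apply (is_RInt_gen_ext_on (V := CR) (fun t => 0 <= t)
    (form (sgn l) (rho l) w (N - 1) (mu l - 1) s)).
  - intros x y z; lra.
  - unfold at_point; lra.
  - apply (filter_imp (fun t => 0 < t)). intros; lra. apply p_infty_gt.
  - intros; symmetry; apply E.
  - apply (is_RInt_gen_at_right_point (V := CR)). apply p_infty_gt.
    + intros. apply form_continuous; auto. apply sgn_cases. lra. lra.
    + apply is_Phi; auto. apply sgn_cases.
Qed.

Lemma kernel_Phi : kernel rho mu l N s w =
  (RtoC ((-1) ^ N / INR (fact (N - 1)))
   * Phi (sgn l) (rho l) w (N - 1) (mu l - 1) s)%C.
Proof.
  unfold kernel, ray_integral. f_equal.
  apply (is_RInt_gen_unique (V := CR)), is_ray_integral.
Qed.

Lemma kernel_Cmod : Cmod (kernel rho mu l N s w) =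
  / INR (fact (N - 1)) * Cmod (Phi (sgn l) (rho l) w (N - 1) (mu l - 1) s).
Proof.
  rewrite kernel_Phi, Cmod_mult, Cmod_R. f_equal.
  assert (Hf := fact_pos (N - 1)).
  unfold Rdiv. rewrite Rabs_mult, pow_1_abs, Rmult_1_l, Rabs_pos_eq; auto.
  left; apply Rinv_0_lt_compat; auto.
Qed.
End Kernel.

(** * Smoothness of the amplitudes *)

Lemma continuous_continuity_2d (f : R -> R) (u v : R) :
  (forall x, continuous f x) -> continuity_2d_pt (fun y t => f (y * t)) u v.
Proof.
  intros Cf. apply continuity_2d_pt_filterlim.
  apply (filterlim_comp _ _ _ (fun z : R * R => fst z * snd z) f _ (locally (u * v))); [|apply Cf].
  apply (filterlim_Rmult (F := locally (u, v))).
  apply (continuous_fst u v). apply (continuous_snd u v).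
Qed.

Lemma continuous_continuity_2d_snd (f : R -> R) (u v : R) :
  (forall x, continuous f x) -> continuity_2d_pt (fun y t => f t) u v.
Proof.
  intros Cf. apply continuity_2d_pt_filterlim.
  apply (filterlim_comp _ _ _ (fun z : R * R => snd z) f _ (locally v)); [|apply Cf].
  apply (continuous_snd u v).
Qed.

Lemma hardy_integrand_continuous (wt f : R -> R) (y t : R) :
  (forall x, continuous wt x) -> (forall x, continuous f x) ->
  continuous (fun t => wt t * f (y * t)) t.
Proof.
  intros Hw Hf. apply continuous_Rmult; auto.
  apply (continuous_comp (fun t => y * t) f); auto.
  apply continuous_Rmult. apply continuous_const. apply continuous_id.
Qed.

(** Differentiating in [y] under the integral replaces [f] by its derivative and the weight [wt t]
    by [wt t * t]; hence the induction is over all continuous weights. *)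
Lemma Cg_hardy (n : nat) (wt f : R -> R) :
  (forall x, continuous wt x) -> Cg (V := RR) n f ->
  Cg (V := RR) n (fun y => RInt (fun t => wt t * f (y * t)) 0 1).
Proof.
  revert wt f; induction n; intros wt f Hw Hf.
  - intros y0. assert (Cf : forall x, continuous f x) by exact Hf.
    assert (EI : forall y, ex_RInt (V := RR) (fun t => wt t * f (y * t)) 0 1).
    { intros y. apply ex_RInt_continuous. intros; apply hardy_integrand_continuous; auto. }
    apply filterlim_R_eps. intros eps He.
    assert (He2 : 0 < eps / 2) by lra.
    destruct (uniform_continuity_2d_1d' (fun y t => wt t * f (y * t)) 0 1 y0) with (eps := mkposreal _ He2)
      as [d Hd].
    { intros x _. apply continuity_2d_pt_mult.
      apply (continuous_continuity_2d_snd wt); auto.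
      apply continuous_continuity_2d; auto. }
    exists d. intros y Hy. change (Rabs (y - y0) < d) in Hy.
    apply Rabs_lt_between in Hy. assert (Hd0 := cond_pos d).
    apply Rle_lt_trans with (eps / 2); [|lra].
    replace (eps / 2) with ((1 - 0) * (eps / 2)) by ring.
    apply (norm_RInt_le_const (V := RR) (fun t => minus (wt t * f (y * t)) (wt t * f (y0 * t))) 0 1).
    + lra.
    + intros t Ht. left. apply (Hd t y0 t y); try lra. rewrite Rminus_diag, Rabs_R0. auto.
    + apply (is_RInt_minus (V := RR)); apply RInt_correct, EI.
  - destruct Hf as [f' [H1 H2]].
    assert (Cf : forall x, continuous f x).
    { intros x. eapply (derive_continuous (V := RR)), H1. }
    assert (Cf' : forall x, continuous f' x) by exact (Cg_continuous _ _ H2).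
    assert (DR : forall y t, is_derive (fun u => wt t * f (u * t)) y (wt t * t * f' (y * t))).
    { intros y t. eapply is_derive_Req.
      apply (is_derive_scal (fun u => f (u * t))).
      apply (is_derive_comp f (fun u => u * t)). apply H1.
      apply (is_derive_ext (fun u => t * u)). intros; apply Rmult_comm.
      apply (is_derive_scal (fun u => u)). apply (is_derive_id (K := R_AbsRing)).
      unfold scal, one; simpl; unfold mult; simpl. ring. }
    assert (Hw' : forall x, continuous (fun t => wt t * t) x).
    { intros. apply continuous_Rmult; auto. apply continuous_id. }
    exists (fun y => RInt (fun t => wt t * t * f' (y * t)) 0 1). split.
    + intros y.
      replace (RInt (fun t => wt t * t * f' (y * t)) 0 1)
        with (RInt (fun t => Derive (fun u => wt t * f (u * t)) y) 0 1).
      2:{ apply RInt_ext. intros t _. apply is_derive_unique, DR. }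
      apply is_derive_RInt_param.
      * apply filter_forall. intros u t _. eexists; apply DR.
      * intros t _. apply continuity_2d_pt_ext with (fun u v => (wt v * v) * f' (u * v)).
        { intros u v. symmetry. apply is_derive_unique, DR. }
        apply continuity_2d_pt_mult.
        apply (continuous_continuity_2d_snd (fun v => wt v * v)); auto.
        apply continuous_continuity_2d; auto.
      * apply filter_forall. intros u. apply (ex_RInt_continuous (V := RR)).
        intros; apply hardy_integrand_continuous; auto.
    + apply (IHn (fun t => wt t * t)); auto.
Qed.

(** Extends the weight t^a from t >= 0 to a function continuous on the whole line for every a >= 0;
    for a = 0 it is the constant 1. *)
Definition pos_power (a t : R) : R := rpow (Rmax 0 t) a.

Lemma pos_power_continuous (a x : R) : 0 <= a -> continuous (pos_power a) x.
Proof.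
  intros Ha. destruct (Req_dec a 0) as [->|Na].
  { apply (continuous_ext (fun _ => 1)); [|apply continuous_const].
    intros t. unfold pos_power, rpow. destruct Req_EM_T.
    destruct Req_EM_T; lra. rewrite Rpower_O; auto.
    assert (H := Rmax_l 0 t). lra. }
  destruct (Rle_dec x 0) as [L|L].
  - assert (E : pos_power a x = 0).
    { unfold pos_power, rpow. rewrite Rmax_left by auto.
      destruct Req_EM_T; [|lra]. destruct Req_EM_T; lra. }
    unfold continuous. rewrite E. apply filterlim_R_eps. intros eps He.
    assert (P := Rpower_pos eps (/ a)).
    exists (mkposreal _ P). intros t Ht.
    change (Rabs (t - x) < Rpower eps (/ a)) in Ht. apply Rabs_lt_between in Ht.
    unfold pos_power, rpow. destruct Req_EM_T as [Ez|Nz].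
    + destruct Req_EM_T. lra. rewrite Rminus_diag, Rabs_R0. auto.
    + assert (H := Rmax_l 0 t). rewrite Rminus_0_r, Rabs_pos_eq by (left; apply Rpower_pos).
      rewrite <- (Rpower_inv_cancel eps a) by lra. apply Rpower_lt_base; try lra.
      unfold Rmax. destruct Rle_dec; lra.
  - apply (continuous_ext_loc _ (fun t => Rpower t a)).
    + assert (Hx : 0 < x) by lra.
      apply (filter_imp (fun t => 0 < t)). 2: apply (open_gt 0 x Hx).
      intros t Ht. unfold pos_power. rewrite Rmax_right, rpow_pos_base; lra.
    + apply continuous_Rpower. lra.
Qed.

Lemma pos_power_eq (a t : R) : 0 <= t -> pos_power a t = rpow t a.
Proof. intros. unfold pos_power. rewrite Rmax_right; auto. Qed.

Section Amplitude.
Variables (n : nat) (rho L : R) (Psi g : R -> R).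
Hypotheses (Hn : (1 <= n)%nat) (Hrho : 1 <= rho) (HL : 0 < L).
Hypothesis Cgg : Ck_on (V := RR) n 0 L g.
Hypothesis Pg : forall y, Icc 0 L y -> 0 < g y.
Hypothesis Psi0 : Psi 0 = 0.
Hypothesis DPsi : forall y, Icc 0 L y ->
  is_derive_on (V := RR) 0 L Psi y (rpow y (rho - 1) * g y).

(** For non-integer rho, [Psi] need not be smooth at 0. Once the power is divided out, a positive
    factor as smooth as [g] remains, and real powers of it stay smooth. *)
Lemma amplitude_exists : exists J, Ck_on (V := RR) n 0 L J /\
  (forall y, Icc 0 L y -> 0 < J y) /\
  (forall y, Icc 0 L y -> Psi y = rpow y rho * J y).
Proof.
  destruct (Ck_on_extend _ _ _ _ HL Cgg) as [G [G1 G2]].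
  set (wt := pos_power (rho - 1)).
  assert (Cw : forall x, continuous wt x) by (intros; apply pos_power_continuous; lra).
  assert (CG : forall x, continuous G x) by exact (Cg_continuous _ _ G1).
  set (J := fun y => RInt (fun t => wt t * G (y * t)) 0 1).
  exists J. split; [|split].
  - apply (Cg_Ck_on (V := RR) n 0 L J J); auto. apply Cg_hardy; auto.
  - intros y [Hy1 Hy2]. apply RInt_gt_0. lra.
    + intros t Ht. apply Rmult_lt_0_compat.
      * unfold wt. rewrite pos_power_eq, rpow_pos_base by lra. apply Rpower_pos.
      * assert (Icc 0 L (y * t)) by (unfold Icc; split; nra).
        rewrite G2; auto.
    + intros; apply hardy_integrand_continuous; auto.
  - assert (K : Ck_on (V := RR) 1 0 L Psi).
    { exists (fun y => rpow y (rho - 1) * g y). split; auto.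
      apply (Ck_on_ext (V := RR) 0 0 L (fun y => wt y * G y)); auto.
      - intros y Hy. unfold wt. rewrite pos_power_eq, G2; auto. apply Hy.
      - apply (continuous_on_of (V := RR)). intros. apply continuous_Rmult; auto. }
    destruct (Ck_on_extend _ _ _ _ HL K) as [F [[F' [F1 F2]] F3]].
    assert (EF : forall y, Icc 0 L y -> F' y = wt y * G y).
    { intros y Hy. apply (is_derive_on_unique (V := RR) 0 L F y); auto.
      - apply (is_derive_on_of (V := RR)), F1.
      - apply (is_derive_on_ext (V := RR) 0 L Psi); auto.
        + intros; symmetry; apply F3; auto.
        + unfold wt. rewrite pos_power_eq, G2; auto. apply Hy. }
    intros y Hy. destruct (Req_dec y 0) as [->|Ny].
    { rewrite Psi0. unfold rpow. destruct Req_EM_T; [|lra]. destruct Req_EM_T; lra. }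
    assert (Hy0 : 0 < y) by (destruct Hy; lra). destruct Hy as [Hy1 Hy2].
    assert (I : is_RInt (V := RR) (fun u => wt u * G u) 0 y (Psi y)).
    { replace (Psi y) with (minus (F y) (F 0)).
      2:{ rewrite !F3, Psi0 by (unfold Icc; lra). unfold minus, plus, opp; simpl. ring. }
      apply (is_RInt_ext (V := RR) F').
      - rewrite Rmin_left, Rmax_right by lra. intros x Hx. apply EF. unfold Icc; lra.
      - apply (is_RInt_derive (V := RR)); intros; auto. }
    (* The substitution u = y t moves the dependence on [y] from the interval into the integrand. *)
    assert (I2 : is_RInt (V := RR) (fun t => y * (wt (y * t + 0) * G (y * t + 0))) 0 1 (Psi y)).
    { apply (is_RInt_comp_lin (V := RR) (fun u => wt u * G u) y 0 0 1).
      replace (y * 0 + 0) with 0 by ring. replace (y * 1 + 0) with y by ring. auto. }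
    assert (I3 : is_RInt (V := RR) (fun t => rpow y rho * (wt t * G (y * t))) 0 1 (Psi y)).
    { apply (is_RInt_ext (V := RR) (fun t => y * (wt (y * t + 0) * G (y * t + 0)))); auto.
      rewrite Rmin_left, Rmax_right by lra. intros t Ht. rewrite Rplus_0_r.
      assert (0 < y * t) by nra.
      unfold wt. rewrite !pos_power_eq, !rpow_pos_base by lra.
      rewrite <- Rpower_mult_distr by lra.
      replace rho with ((rho - 1) + 1) at 3 by ring.
      rewrite Rpower_plus, Rpower_1 by auto.
      ring_R. }
    assert (I4 : is_RInt (V := RR) (fun t => rpow y rho * (wt t * G (y * t))) 0 1 (rpow y rho * J y)).
    { apply (is_RInt_scal (V := RR)). apply RInt_correct.
      apply ex_RInt_continuous. intros; apply hardy_integrand_continuous; auto. }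
    rewrite <- (is_RInt_unique _ _ _ _ I3). apply (is_RInt_unique _ _ _ _ I4).
Qed.

Definition phih (J : R -> R) (y : R) : R := y * Rpower (J y) (/ rho).
(** The derivative of [phih] written without J'. In this form it is visibly of class C^n, so [phih]
    and its inverse are C^(n+1), and the amplitude, which contains the derivative of the inverse,
    keeps all n derivatives. *)
Definition dphih (J : R -> R) (y : R) : R := / rho * Rpower (J y) (/ rho - 1) * g y.

Section WithJ.
Variable J : R -> R.
Hypothesis CJ : Ck_on (V := RR) n 0 L J.
Hypothesis PJ : forall y, Icc 0 L y -> 0 < J y.
Hypothesis EJ : forall y, Icc 0 L y -> Psi y = rpow y rho * J y.

Lemma phih_root (y : R) : Icc 0 L y -> rpow (Psi y) (/ rho) = phih J y.
Proof.
  intros Hy. assert (P := PJ y Hy). assert (Hr : 0 < / rho) by (apply Rinv_0_lt_compat; lra).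
  unfold phih. destruct (Req_dec y 0) as [->|Ny].
  - rewrite Psi0. unfold rpow. destruct Req_EM_T; [|lra]. destruct Req_EM_T; lra.
  - assert (0 < y) by (destruct Hy; lra).
    rewrite EJ, (rpow_pos_base y) by auto.
    rewrite rpow_pos_base by (apply Rmult_lt_0_compat; auto; apply Rpower_pos).
    rewrite <- Rpower_mult_distr by (auto; apply Rpower_pos).
    rewrite Rpower_mult, Rinv_r, Rpower_1; auto. lra.
Qed.

Lemma phih_power (y : R) : Icc 0 L y -> 0 < y -> Rpower (phih J y) rho = Psi y.
Proof.
  intros Hy Hy0. assert (P := PJ y Hy). unfold phih.
  rewrite <- Rpower_mult_distr by (auto; apply Rpower_pos).
  rewrite Rpower_mult, Rinv_l, Rpower_1 by (auto; lra).
  rewrite EJ, rpow_pos_base; auto.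
Qed.

(** Differentiating [Psi = y^rho J] gives [rho J + y J' = g]. *)
Lemma phih_derive (y : R) : Icc 0 L y ->
  is_derive_on (V := RR) 0 L (phih J) y (dphih J y).
Proof.
  assert (CJ1 : Ck_on (V := RR) 1 0 L J) by (apply (Ck_on_le n); auto).
  destruct (Ck_on_extend _ _ _ _ HL CJ1) as [F [[F' [F1 F2]] F3]].
  assert (C0 : forall x, continuous F x).
  { intros x. eapply (derive_continuous (V := RR)), F1. }
  (* Two expressions of Psi' are compared at interior points, where y^(rho-1) can be cancelled; the
     endpoints follow by continuity. *)
  assert (Id : forall y, Icc 0 L y -> rho * F y + y * F' y = g y).
  { apply (eq_on_closure (V := RR) 0 L (fun y => rho * F y + y * F' y) g HL).
    - intros x Hx.
      assert (D1 : is_derive (V := RR) Psi x (rpow x (rho - 1) * g x)).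
      { apply (is_derive_on_interior (V := RR) 0 L); auto. apply DPsi. unfold Icc; lra. }
      assert (D2 : is_derive (V := RR) Psi x
        (rho * Rpower x (rho - 1) * 1 * F x + Rpower x rho * F' x)).
      { apply (is_derive_ext_loc (V := RR) (fun y => Rpower y rho * F y)).
        - assert (L1 : locally x (fun y => 0 < y < L)).
          { apply (open_and (fun y => 0 < y) (fun y => y < L)); auto.
            apply open_gt. apply open_lt. }
          revert L1. apply filter_imp. intros z Hz.
          rewrite EJ, F3, rpow_pos_base by (unfold Icc; lra). auto.
        - apply (is_derive_Rmult (fun y => Rpower y rho) F); [|apply F1].
          apply (is_derive_Rpower (fun z => z) x 1 rho).
          apply (is_derive_id (K := R_AbsRing)). lra. }
      assert (E := is_derive_unique _ _ _ D1). rewrite (is_derive_unique _ _ _ D2) in E.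
      rewrite rpow_pos_base in E by lra.
      replace rho with ((rho - 1) + 1) in E at 3 by ring.
      rewrite Rpower_plus, Rpower_1 in E by lra.
      apply Rmult_eq_reg_l with (Rpower x (rho - 1)).
      rewrite <- E. ring_R.
      apply Rgt_not_eq, Rpower_pos.
    - apply (continuous_on_of (V := RR)). intros x _.
      apply continuous_Rplus; apply continuous_Rmult; auto.
      apply continuous_const. apply continuous_id.
    - apply (Ck_on_le (V := RR) n 0 0 L g HL); auto. lia. }
  intros Hy. assert (P := PJ y Hy).
  apply (is_derive_on_ext (V := RR) 0 L (fun y => y * Rpower (F y) (/ rho))); auto.
  { intros z Hz. unfold phih. rewrite F3; auto. }
  apply (is_derive_on_of (V := RR)). 
  assert (PF : 0 < F y) by (rewrite F3; auto).
  eapply is_derive_Req.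
  - apply is_derive_Rmult. apply (is_derive_id (K := R_AbsRing)).
    apply is_derive_Rpower. apply F1. auto.
  - unfold dphih, one; simpl. rewrite <- (Id y Hy), <- F3 by auto.
    replace (Rpower (F y) (/ rho)) with (Rpower (F y) (/ rho - 1) * F y).
    field; lra.
    rewrite <- (Rpower_1 (F y)) at 2 by auto. rewrite <- Rpower_plus. f_equal. ring.
Qed.

Lemma dphih_Ck : Ck_on (V := RR) n 0 L (dphih J).
Proof.
  unfold dphih. apply (Ck_on_Rmult n 0 L (fun y => / rho * Rpower (J y) (/ rho - 1)) g); auto.
  apply (Ck_on_Rmult n 0 L (fun y => / rho)); auto. apply (Ck_on_const (V := RR)).
  apply Ck_on_Rpower; auto.
Qed.

Lemma dphih_pos (y : R) : Icc 0 L y -> 0 < dphih J y.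
Proof.
  intros Hy. unfold dphih. apply Rmult_lt_0_compat; auto.
  apply Rmult_lt_0_compat. apply Rinv_0_lt_compat; lra. apply Rpower_pos.
Qed.

Lemma phih_0 : phih J 0 = 0.
Proof. unfold phih. ring. Qed.
End WithJ.
End Amplitude.

Definition other (l : endpoint) : endpoint := match l with Pt1 => Pt2 | Pt2 => Pt1 end.

Lemma sgn_Pt1 : sgn Pt1 = 1. Proof. unfold sgn; simpl; ring. Qed.
Lemma sgn_Pt2 : sgn Pt2 = -1. Proof. unfold sgn; simpl; ring. Qed.

Lemma is_derive_on_affine (a b u c : R) (f : R -> R) (x d : R) :
  is_derive_on (V := RR) a b f x d ->
  is_derive_on (V := RR) a b (fun t => u + c * f t) x (c * d).
Proof.
  intros H.
  assert (F1 : Filter (within (Icc a b) (locally' x)))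
    by (apply within_filter, within_filter, locally_filter).
  unfold is_derive_on.
  apply (filterlim_ext (fun y => c * scal (/ (y - x)) (minus (f y) (f x)))).
  - intros y. unfold scal, minus, plus, opp; simpl. unfold mult; simpl. ring.
  - apply (filterlim_Rmult (F := within (Icc a b) (locally' x))).
    apply filterlim_const. exact H.
Qed.

Lemma sgn_sqr (l : endpoint) : sgn l * sgn l = 1.
Proof. destruct l; rewrite ?sgn_Pt1, ?sgn_Pt2; ring. Qed.

(** * The change of variables near one endpoint *)

Section Local.
Variables (p rho mu : endpoint -> R) (psi : R -> R) (U : R -> C).
Variables (eta : R) (nu : R -> R) (N : nat) (l : endpoint).
Hypotheses
  (hN : (1 <= N)%nat) (hp : p Pt1 < p Pt2)
  (hrho : forall l, 1 <= rho l) (hmu : forall l, 0 < mu l <= 1)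
  (hpsi : assumption_P p rho N psi) (hU : assumption_A p mu N U)
  (heta : 0 < eta < (p Pt2 - p Pt1) / 2)
  (hnu_smooth : forall n, Ck_on (V := RR) n (p Pt1) (p Pt2) nu)
  (hnu1 : forall x, p Pt1 <= x <= p Pt1 + eta -> nu x = 1)
  (hnu0 : forall x, p Pt2 - eta <= x <= p Pt2 -> nu x = 0).

(** [L] is the length of the interval I_l. [L'] lies strictly between [L] and [D]: it leaves room
    beyond [L], yet stays away from the far endpoint, so powers of [D - y] remain smooth. *)
Let D := p Pt2 - p Pt1.
Let L := D - eta.
Let L' := D - eta / 2.
(** Here [y] is the distance to [p l], which places either endpoint at 0 with the interval to its
    right. *)
Definition pt (y : R) : R := p l + sgn l * y.

Lemma length_facts : 0 < D /\ eta < L /\ 0 < L /\ L < L' /\ L' < D /\ 0 < L'.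
Proof. unfold L', L, D. lra. Qed.

Lemma pt_Icc (y : R) : Icc 0 D y -> Icc (p Pt1) (p Pt2) (pt y).
Proof.
  unfold Icc, pt, D. destruct l; rewrite ?sgn_Pt1, ?sgn_Pt2; lra.
Qed.

Lemma pt_left (y : R) :
  (pt y - p Pt1, p Pt2 - pt y) =
  match l with Pt1 => (y, D - y) | Pt2 => (D - y, y) end.
Proof. unfold pt, D. destruct l; rewrite ?sgn_Pt1, ?sgn_Pt2; f_equal; ring. Qed.

Lemma powers_pt (a : endpoint -> R) (y : R) :
  rpow (pt y - p Pt1) (a Pt1) * rpow (p Pt2 - pt y) (a Pt2)
  = rpow y (a l) * rpow (D - y) (a (other l)).
Proof.
  generalize (pt_left y). destruct l; simpl; intros H; injection H; intros -> ->.
  auto. apply Rmult_comm.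
Qed.

Lemma Cg_pt (n : nat) : Cg (V := RR) n pt.
Proof. apply Cg_affine. Qed.

Lemma Ck_on_pt {V : CompleteNormedModule R_AbsRing} (n : nat) (f : R -> V) :
  Ck_on n (p Pt1) (p Pt2) f -> Ck_on n 0 L' (fun y => f (pt y)).
Proof.
  intros H. destruct length_facts as [H1 [H2 [H3 [H4 [H5 H6]]]]].
  apply (Ck_on_comp n 0 L' (p Pt1) (p Pt2) f pt); auto.
  - apply (Cg_Ck_on (V := RR) n 0 L' pt pt); auto. apply Cg_pt.
  - intros y Hy. apply pt_Icc. unfold Icc in *; lra.
Qed.

Lemma Ck_on_rpow_far (n : nat) (a : R) :
  Ck_on (V := RR) n 0 L' (fun y => rpow (D - y) a).
Proof.
  destruct length_facts as [H1 [H2 [H3 [H4 [H5 H6]]]]].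
  apply (Ck_on_ext (V := RR) n 0 L' (fun y => Rpower (D - y) a)); auto.
  - intros y Hy. symmetry. apply rpow_pos_base. unfold Icc in Hy; lra.
  - apply (Ck_on_Rpower n 0 L' (fun y => D - y)); auto.
    + apply (Cg_Ck_on (V := RR) n 0 L' _ (fun y => D + -1 * y)). apply Cg_affine.
      intros; ring_R.
    + intros y Hy. unfold Icc in Hy; lra.
Qed.

Definition Psi (y : R) : R := sgn l * (psi (pt y) - psi (p l)).

Definition cutoff (y : R) : R :=
  match l with Pt1 => nu (pt y) | Pt2 => 1 - nu (pt y) end.

Lemma cutoff_Ck (n : nat) : Ck_on (V := RR) n 0 L' cutoff.
Proof.
  destruct length_facts as [H1 [H2 [H3 [H4 [H5 H6]]]]].
  assert (H := Ck_on_pt n nu (hnu_smooth n)).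
  unfold cutoff. destruct l; auto.
  destruct (Ck_on_extend _ _ _ _ H6 H) as [F [F1 F2]].
  apply (Cg_Ck_on (V := RR) n 0 L' _ (fun y => plus 1 (scal (-1) (F y)))).
  - apply (Cg_plus (V := RR)). apply (Cg_const (V := RR)).
    apply (Cg_scal (V := RR)); auto. apply (Cg_const (V := RR)).
  - intros y Hy. rewrite F2 by auto. unfold plus, scal; simpl; unfold mult; simpl.
    ring_R.
Qed.

Lemma cutoff_near (y : R) : 0 <= y <= eta -> cutoff y = 1.
Proof.
  intros Hy. unfold cutoff, pt. destruct l; rewrite ?sgn_Pt1, ?sgn_Pt2.
  apply hnu1; lra. rewrite hnu0; lra.
Qed.

Lemma cutoff_far (y : R) : L <= y <= D -> cutoff y = 0.
Proof.
  unfold L, D. intros Hy. unfold cutoff, pt. destruct l; rewrite ?sgn_Pt1, ?sgn_Pt2.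
  apply hnu0; lra. rewrite hnu1; lra.
Qed.

Lemma phi_pt (y : R) : phi p rho psi l (pt y) = rpow (Psi y) (/ rho l).
Proof.
  unfold phi, Psi. destruct l; rewrite ?sgn_Pt1, ?sgn_Pt2; f_equal; ring.
Qed.

Lemma s_max_pt : s_max p rho psi eta l = rpow (Psi L) (/ rho l).
Proof.
  rewrite <- phi_pt. unfold s_max, pt, L, D.
  destruct l; rewrite ?sgn_Pt1, ?sgn_Pt2; f_equal; ring.
Qed.

(** The power attached to the far endpoint is smooth on [0, L'] and is absorbed into [g]. The sign
    enters twice, through [Psi] and through [pt], and cancels. *)
Lemma local_amplitude : exists g,
  Ck_on (V := RR) N 0 L' g /\ (forall y, Icc 0 L' y -> 0 < g y) /\
  forall y, Icc 0 L' y ->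
    is_derive_on (V := RR) 0 L' Psi y (rpow y (rho l - 1) * g y).
Proof.
  destruct length_facts as [H1 [H2 [H3 [H4 [H5 H6]]]]].
  destruct hpsi as [C1 [psit [C2 [P2 D2]]]].
  exists (fun y => rpow (D - y) (rho (other l) - 1) * psit (pt y)).
  split; [|split].
  - apply Ck_on_Rmult; auto. apply Ck_on_rpow_far. apply (Ck_on_pt (V := RR)); auto.
  - intros y Hy. apply Rmult_lt_0_compat.
    rewrite rpow_pos_base. apply Rpower_pos. unfold Icc in Hy; lra.
    apply P2, pt_Icc. unfold Icc in *; lra.
  - intros y Hy. assert (Hy' : Icc 0 D y) by (unfold Icc in *; lra).
    destruct (Ck_on_extend _ _ _ _ hp C1) as [F [[F' [F1 F2]] F3]].
    assert (E : F' (pt y) = rpow y (rho l - 1) * (rpow (D - y) (rho (other l) - 1) * psit (pt y))).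
    { apply (is_derive_on_unique (V := RR) (p Pt1) (p Pt2) F (pt y)); auto.
      - apply pt_Icc; auto.
      - apply (is_derive_on_of (V := RR)), F1.
      - apply (is_derive_on_ext (V := RR) (p Pt1) (p Pt2) psi).
        intros; symmetry; auto. apply pt_Icc; auto.
        rewrite <- Rmult_assoc, <- (powers_pt (fun l => rho l - 1)). apply D2, pt_Icc; auto. }
    rewrite <- E.
    apply (is_derive_on_ext (V := RR) 0 L' (fun y => sgn l * (F (pt y) - F (p l)))); auto.
    { intros z Hz. unfold Psi. rewrite !F3; auto.
      unfold Icc; destruct l; lra. apply pt_Icc. unfold Icc in *; lra. }
    apply (is_derive_on_of (V := RR)). eapply is_derive_Req.
    + apply (is_derive_scal (fun y => F (pt y) - F (p l))).
      apply (is_derive_minus (V := R_NormedModule) (fun y => F (pt y)) (fun _ => F (p l))).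
      apply (is_derive_comp F pt). apply F1.
      unfold pt. apply (is_derive_plus (V := R_NormedModule) (fun _ => p l)).
      apply (is_derive_const (V := R_NormedModule)).
      apply (is_derive_scal (fun y => y)). apply (is_derive_id (K := R_AbsRing)).
      apply (is_derive_const (V := R_NormedModule)).
    + unfold minus, plus, opp, scal, zero, one; simpl; unfold mult; simpl.
      destruct l; rewrite ?sgn_Pt1, ?sgn_Pt2; ring.
Qed.

Lemma Psi_0 : Psi 0 = 0.
Proof. unfold Psi, pt. rewrite Rmult_0_r, Rplus_0_r. ring. Qed.

Section WithAmplitude.
Variables (g J : R -> R).
Hypotheses (Cgg : Ck_on (V := RR) N 0 L' g) (Pg : forall y, Icc 0 L' y -> 0 < g y)
  (DPsi : forall y, Icc 0 L' y ->
    is_derive_on (V := RR) 0 L' Psi y (rpow y (rho l - 1) * g y))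
  (CJ : Ck_on (V := RR) N 0 L' J) (PJ : forall y, Icc 0 L' y -> 0 < J y)
  (EJ : forall y, Icc 0 L' y -> Psi y = rpow y (rho l) * J y).

Let ph := phih (rho l) J.
Let dp := dphih (rho l) g J.
Let h := inverse_on 0 L' ph.
Let s1 := s_max p rho psi eta l.
Let s1' := ph L'.

Lemma L'_pos : 0 < L'. Proof. apply length_facts. Qed.

Lemma ph_derive (y : R) : Icc 0 L' y -> is_derive_on (V := RR) 0 L' ph y (dp y).
Proof.
  apply (phih_derive N (rho l) L' Psi g hN (hrho l) L'_pos Cgg DPsi J CJ PJ EJ).
Qed.

Lemma dp_Ck : Ck_on (V := RR) N 0 L' dp.
Proof. apply (dphih_Ck N (rho l) L' g L'_pos Cgg J CJ PJ). Qed.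

Lemma dp_pos (y : R) : Icc 0 L' y -> 0 < dp y.
Proof. apply (dphih_pos (rho l) L' g (hrho l) Pg J). Qed.

Lemma ph_0 : ph 0 = 0. Proof. apply phih_0. Qed.

Lemma ph_L : ph L = s1.
Proof.
  unfold s1. rewrite s_max_pt. symmetry.
  destruct length_facts as [H1 [H2 [H3 [H4 [H5 H6]]]]].
  apply (phih_root (rho l) L' Psi (hrho l) Psi_0 J PJ EJ). unfold Icc; lra.
Qed.

Lemma ph_lt (x y : R) : 0 <= x -> x < y -> y <= L' -> ph x < ph y.
Proof. apply (inverse_strict N 0 L' ph dp L'_pos ph_derive dp_Ck dp_pos). Qed.

Lemma s1_facts : 0 < ph eta /\ ph eta < s1 /\ s1 < s1'.
Proof.
  destruct length_facts as [H1 [H2 [H3 [H4 [H5 H6]]]]].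
  rewrite <- ph_L, <- ph_0. unfold s1'. repeat split; apply ph_lt; lra.
Qed.

Lemma h_spec (s : R) : Icc 0 s1' s -> Icc 0 L' (h s) /\ ph (h s) = s.
Proof.
  intros Hs. apply (inverse_spec N 0 L' ph dp L'_pos ph_derive dp_Ck).
  rewrite ph_0. exact Hs.
Qed.

Lemma h_left (y : R) : Icc 0 L' y -> h (ph y) = y.
Proof. apply (inverse_left N 0 L' ph dp L'_pos ph_derive dp_Ck dp_pos). Qed.

Lemma h_le (s y : R) : Icc 0 s1' s -> Icc 0 L' y -> s <= ph y -> h s <= y.
Proof.
  intros Hs Hy Hsy. destruct (h_spec s Hs) as [[A1 A2] A3].
  destruct (Rle_dec (h s) y) as [|n]; auto. exfalso.
  assert (ph y < ph (h s)) by (apply ph_lt; unfold Icc in *; lra). lra.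
Qed.

Lemma h_ge (s y : R) : Icc 0 s1' s -> Icc 0 L' y -> ph y <= s -> y <= h s.
Proof.
  intros Hs Hy Hsy. destruct (h_spec s Hs) as [[A1 A2] A3].
  destruct (Rle_dec y (h s)) as [|n]; auto. exfalso.
  assert (ph (h s) < ph y) by (apply ph_lt; unfold Icc in *; lra). lra.
Qed.

Lemma h_pos (s : R) : Icc 0 s1' s -> 0 < s -> 0 < h s.
Proof.
  intros Hs Hs0. destruct (h_spec s Hs) as [[A1 A2] A3].
  destruct A1 as [|E]; auto. rewrite <- E, ph_0 in A3. lra.
Qed.

Lemma h_Ck : Ck_on (V := RR) (S N) 0 s1' h.
Proof.
  assert (H := inverse_Ck N 0 L' ph dp L'_pos ph_derive dp_Ck dp_pos). rewrite ph_0 in H. exact H.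
Qed.

Lemma h_derive (s : R) : Icc 0 s1' s -> is_derive_on (V := RR) 0 s1' h s (/ dp (h s)).
Proof.
  intros Hs. assert (H := inverse_derive N 0 L' ph dp L'_pos ph_derive dp_Ck dp_pos s).
  rewrite ph_0 in H. apply H. exact Hs.
Qed.

(** Two choices of preimage are compared, one in I_l and one in [0, L']; strict monotonicity of [ph]
    makes them coincide. *)
Lemma phi_inv_pt (s : R) : Icc 0 s1 s -> phi_inv p rho psi eta l s = pt (h s).
Proof.
  intros Hs. destruct s1_facts as [S1 [S2 S3]].
  destruct length_facts as [H1 [H2 [H3 [H4 [H5 H6]]]]].
  assert (Hs' : Icc 0 s1' s) by (unfold Icc in *; lra).
  destruct (h_spec s Hs') as [[A1 A2] A3].
  assert (Hl : h s <= L).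
  { apply h_le; auto. unfold Icc; lra. rewrite ph_L. apply Hs. }
  assert (Iff : forall y, Icc 0 L y <-> Icc (I_lo p eta l) (I_hi p eta l) (pt y)).
  { intros y. unfold Icc, I_lo, I_hi, pt, L, D.
    destruct l; rewrite ?sgn_Pt1, ?sgn_Pt2; lra. }
  assert (Ph : forall y, Icc 0 L y -> phi p rho psi l (pt y) = ph y).
  { intros y Hy. rewrite phi_pt.
    apply (phih_root (rho l) L' Psi (hrho l) Psi_0 J PJ EJ). unfold Icc in *; lra. }
  unfold phi_inv, inverse_on.
  assert (E := epsilon_spec (inhabits 0)
    (fun x => Icc (I_lo p eta l) (I_hi p eta l) x /\ phi p rho psi l x = s)).
  destruct E as [E1 E2].
  { exists (pt (h s)). split. apply Iff. unfold Icc; lra. rewrite Ph; auto. unfold Icc; lra. }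
  set (x0 := epsilon _ _) in *.
  set (y0 := sgn l * (x0 - p l)).
  assert (Ex : x0 = pt y0).
  { unfold y0, pt. destruct l; rewrite ?sgn_Pt1, ?sgn_Pt2; ring. }
  rewrite Ex in E1, E2 |- *. apply Iff in E1. rewrite Ph in E2 by auto.
  f_equal. rewrite <- E2. symmetry. apply h_left. unfold Icc in *; lra.
Qed.

Lemma Derive_phi_inv (s : R) : Icc 0 s1 s ->
  Derive_on (V := RR) 0 s1 (phi_inv p rho psi eta l) s = sgn l * / dp (h s).
Proof.
  intros Hs. destruct s1_facts as [S1 [S2 S3]].
  apply (Derive_on_eq (V := RR)); auto. lra.
  apply (is_derive_on_ext (V := RR) 0 s1 (fun s => p l + sgn l * h s)); auto.
  - intros t Ht. symmetry. rewrite phi_inv_pt; auto.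
  - apply is_derive_on_affine. apply (is_derive_on_sub (V := RR) 0 s1'); try lra.
    apply h_derive. unfold Icc in *; lra.
Qed.

Variable ut : R -> C.
Hypotheses (Cut : Ck_on (V := CR) N (p Pt1) (p Pt2) ut)
  (EU : forall x, p Pt1 < x < p Pt2 ->
      U x = (RtoC (rpow (x - p Pt1) (mu Pt1 - 1) * rpow (p Pt2 - x) (mu Pt2 - 1)) * ut x)%C).

(** The amplitude k_l in the variable [y]. The singular factor y^(mu-1) of [U] has cancelled against
    s^(1-mu) = y^(1-mu) J^((1-mu)/rho), leaving a product of C^N factors. *)
Definition amp (y : R) : C :=
  (RtoC (rpow (D - y) (mu (other l) - 1)) * ut (pt y)
   * RtoC (Rpower (J y) ((1 - mu l) / rho l) * (sgn l * / dphih (rho l) g J y)))%C.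

Lemma amp_Ck : Ck_on (V := CR) N 0 L' amp.
Proof.
  assert (HL := L'_pos).
  unfold amp. apply Ck_on_Cmult; auto; [apply Ck_on_Cmult; auto|].
  - apply Ck_on_RtoC; auto. apply Ck_on_rpow_far.
  - apply (Ck_on_pt (V := CR)); auto.
  - apply Ck_on_RtoC; auto. apply Ck_on_Rmult; auto.
    + apply Ck_on_Rpower; auto.
    + apply (Ck_on_Rmult N 0 L' (fun _ => sgn l)); auto. apply (Ck_on_const (V := RR)).
      apply (Ck_on_ext (V := RR) N 0 L' (fun y => Rpower (dp y) (- (1)))); auto.
      * intros y Hy. rewrite Rpower_Ropp, Rpower_1; auto. apply dp_pos; auto.
      * apply Ck_on_Rpower; auto. apply dp_Ck. apply dp_pos.
Qed.

Lemma U_pt (y : R) : 0 < y <= L' ->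
  U (pt y) = (RtoC (Rpower y (mu l - 1)) * RtoC (rpow (D - y) (mu (other l) - 1)) * ut (pt y))%C.
Proof.
  intros Hy. destruct length_facts as [H1 [H2 [H3 [H4 [H5 H6]]]]].
  rewrite EU.
  - rewrite (powers_pt (fun l => mu l - 1)), rpow_pos_base, RtoC_mult by lra. auto.
  - unfold pt. unfold D in *. destruct l; rewrite ?sgn_Pt1, ?sgn_Pt2; lra.
Qed.

Lemma ph_Rpower (y a : R) : 0 < y <= L' -> Rpower (ph y) a = Rpower y a * Rpower (J y) (a / rho l).
Proof.
  intros Hy. unfold ph, phih. rewrite <- Rpower_mult_distr by (try apply Rpower_pos; lra).
  rewrite Rpower_mult. f_equal. f_equal. field. specialize (hrho l). lra.
Qed.

Lemma k_pos_amp (s : R) : 0 < s <= s1 -> k_pos p rho mu psi U eta l s = amp (h s).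
Proof.
  intros Hs. destruct s1_facts as [S1 [S2 S3]].
  assert (Hs1 : Icc 0 s1 s) by (unfold Icc in *; lra).
  assert (Hs' : Icc 0 s1' s) by (unfold Icc in *; lra).
  destruct (h_spec s Hs') as [[A1 A2] A3]. assert (A4 := h_pos s Hs' (proj1 Hs)).
  unfold k_pos. fold s1. rewrite Derive_phi_inv, phi_inv_pt by auto.
  rewrite U_pt by lra. rewrite (rpow_pos_base s) by lra.
  replace (Rpower s (1 - mu l)) with (Rpower (ph (h s)) (1 - mu l)) by (rewrite A3; auto).
  rewrite ph_Rpower by lra. unfold amp. fold dp.
  replace (1 - mu l) with (- (mu l - 1)) at 1 by ring. rewrite Rpower_Ropp.
  rewrite !(RtoC_mult (/ _)), (RtoC_mult (Rpower (J (h s)) _)).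
  assert (P := Rpower_pos (h s) (mu l - 1)).
  rewrite RtoC_inv by lra. field. intros Z. apply RtoC_inj in Z. lra.
Qed.

Lemma amp_h_Ck : Ck_on (V := CR) N 0 s1' (fun s => amp (h s)).
Proof.
  destruct s1_facts as [S1 [S2 S3]].
  apply (Ck_on_comp (V := CR) N 0 s1' 0 L' amp h); auto. lra. apply L'_pos. apply amp_Ck.
  apply (Ck_on_le (V := RR) (S N)); auto. lra. apply h_Ck.
  intros; apply h_spec; auto.
Qed.

(** For s > 0 this is [k_pos_amp]. At s = 0 the value of [k] is defined as a limit, which continuity
    of the smooth right side identifies. *)
Lemma k_amp (s : R) : Icc 0 s1 s -> k p rho mu psi U eta l s = amp (h s).
Proof.
  intros Hs. destruct s1_facts as [S1 [S2 S3]].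
  unfold k. destruct Rlt_dec as [H|H]. apply k_pos_amp; unfold Icc in Hs; lra.
  assert (s = 0) as -> by (unfold Icc in Hs; lra).
  assert (Hlt : 0 < s1') by lra.
  destruct (Ck_on_extend _ _ _ _ Hlt amp_h_Ck) as [F [F1 F2]].
  apply (iota_filterlim_locally (V := CR) (F := at_right 0)).
  rewrite <- F2 by (unfold Icc; lra).
  apply (filterlim_ext_loc F).
  - assert (H0 : 0 < s1) by lra.
    generalize (filter_and _ _ (at_right_gt 0) (at_right_lt 0 s1 H0)).
    apply filter_imp. intros t Ht. rewrite k_pos_amp by lra. apply F2. unfold Icc; lra.
  - apply (continuous_at_right (V := CR) F), (Cg_continuous _ _ F1).
Qed.

Lemma nuk_amp (s : R) : Icc 0 s1 s ->
  nuk p rho mu psi U eta nu l s = (RtoC (cutoff (h s)) * amp (h s))%C.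
Proof.
  intros Hs. unfold nuk. rewrite k_amp by auto. f_equal. f_equal.
  unfold nu_, cutoff. assert (E := phi_inv_pt s Hs).
  destruct l; rewrite E; reflexivity.
Qed.

Lemma cutoff_amp_h_Ck : Ck_on (V := CR) N 0 s1' (fun s => (RtoC (cutoff (h s)) * amp (h s))%C).
Proof.
  destruct s1_facts as [S1 [S2 S3]]. assert (H0 : 0 < s1') by lra.
  apply Ck_on_Cmult; auto. 2: apply amp_h_Ck.
  apply Ck_on_RtoC; auto.
  apply (Ck_on_comp (V := RR) N 0 s1' 0 L' cutoff h); auto. apply L'_pos. apply cutoff_Ck.
  apply (Ck_on_le (V := RR) (S N)); auto. apply h_Ck.
  intros; apply h_spec; auto.
Qed.

(** The substitution s = ph y at the level of integrands; the factor [sgn l] comes from the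
    derivative of [phi_inv] inside the amplitude. *)
Lemma amp_identity (y : R) : 0 < y <= L' ->
  (RtoC (Rpower (ph y) (mu l - 1)) * (RtoC (cutoff (h (ph y))) * amp (h (ph y))) * RtoC (dp y))%C
  = (RtoC (sgn l) * (RtoC (cutoff y) * U (pt y)))%C.
Proof.
  intros Hy. rewrite h_left by (unfold Icc; lra). rewrite U_pt by auto.
  rewrite ph_Rpower by auto. unfold amp. fold dp.
  assert (P := dp_pos y ltac:(unfold Icc; lra)).
  replace ((mu l - 1) / rho l) with (- ((1 - mu l) / rho l))
    by (field; specialize (hrho l); lra).
  rewrite Rpower_Ropp. assert (PJ' := Rpower_pos (J y) ((1 - mu l) / rho l)).
  rewrite !RtoC_mult, !RtoC_inv by lra. field. split; intros Z; apply RtoC_inj in Z; lra.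
Qed.
End WithAmplitude.

(** The local change of variables is carried out on [0, L2] with [L2 > L], so that
    [nu_l k_l] vanishes on a whole interval beyond [s_max] and all its derivatives
    vanish at [s_max]. *)
Definition local_data (se s1' L2 : R) (ph dp : R -> R) (Kj Fj : nat -> R -> C) : Prop :=
  (0 < se /\ se < s_max p rho psi eta l /\ s_max p rho psi eta l < s1') /\
  (L < L2 /\ L2 < D) /\
  (jet (V := CR) N Kj /\ jet (V := CR) N Fj) /\
  (forall s, Icc 0 (s_max p rho psi eta l) s ->
    k p rho mu psi U eta l s = Kj O s /\ nuk p rho mu psi U eta nu l s = Fj O s) /\
  (forall s, Icc 0 se s -> Fj O s = Kj O s) /\
  (forall s, Icc (s_max p rho psi eta l) s1' s -> Fj O s = RtoC 0) /\
  ph L = s_max p rho psi eta l /\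
  filterlim ph (at_right 0) (locally 0) /\
  (forall y, continuous dp y) /\
  (forall y, 0 < y < L2 ->
    0 < ph y < s1' /\ is_derive ph y (dp y) /\
    psi (pt y) = psi (p l) + sgn l * Rpower (ph y) (rho l) /\
    (RtoC (Rpower (ph y) (mu l - 1)) * Fj O (ph y) * RtoC (dp y))%C
    = (RtoC (sgn l) * (RtoC (cutoff y) * U (pt y)))%C).

Lemma local_structure : exists se s1' L2 ph dp Kj Fj,
  local_data se s1' L2 ph dp Kj Fj.
Proof.
  destruct length_facts as [H1 [H2 [H3 [H4 [H5 H6]]]]].
  destruct local_amplitude as [g [Cgg [Pg DPsi]]].
  destruct (amplitude_exists N (rho l) L' Psi g (hrho l) H6 Cgg Pg Psi_0 DPsi)
    as [J [CJ [PJ EJ]]].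
  destruct hU as [ut [Cut [EU _]]].
  set (ph := phih (rho l) J).
  set (h := inverse_on 0 L' ph).
  destruct (s1_facts g J Cgg Pg DPsi CJ PJ EJ) as [S1 [S2 S3]]. fold ph in S1, S2, S3.
  set (s1 := s_max p rho psi eta l) in *. set (s1' := ph L') in *.
  assert (S0 : 0 < s1') by lra.
  destruct (Ck_on_extend (V := RR) _ _ _ _ H6 (dp_Ck g J Cgg CJ PJ)) as [dp [dp1 dp2]].
  destruct (Ck_on_extend (V := CR) _ _ _ _ S0
    (amp_h_Ck g J Cgg Pg DPsi CJ PJ EJ ut Cut)) as [K [K1 K2]].
  destruct (Ck_on_extend (V := CR) _ _ _ _ S0
    (cutoff_amp_h_Ck g J Cgg Pg DPsi CJ PJ EJ ut Cut)) as [F [F1 F2]].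
  destruct (Cg_jet _ _ K1) as [Kj [EK JK]]. destruct (Cg_jet _ _ F1) as [Fj [EF JF]].
  (* Up to [ph eta] the cut-off equals 1, so there the cut-off amplitude is the amplitude itself. *)
  exists (ph eta), s1', L', ph, dp, Kj, Fj. unfold local_data. fold s1.
  rewrite EK, EF.
  assert (EL : ph L = s1) by apply (ph_L J PJ EJ).
  split; [lra|]. split; [lra|]. split; [auto|]. split.
  { intros s H. split.
  - rewrite K2 by (unfold Icc in *; lra).
    apply (k_amp g J Cgg Pg DPsi CJ PJ EJ ut Cut EU). exact H.
  - rewrite F2 by (unfold Icc in *; lra).
    apply (nuk_amp g J Cgg Pg DPsi CJ PJ EJ ut Cut EU). exact H. }
  split.
  { intros s Hs. assert (Hs' : Icc 0 s1' s) by (unfold Icc in *; lra).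
    destruct (h_spec g J Cgg DPsi CJ PJ EJ s Hs') as [[A1 A2] _].
    assert (A3 : h s <= eta).
    { apply (h_le g J Cgg Pg DPsi CJ PJ EJ); auto. unfold Icc; lra. apply Hs. }
    rewrite K2, F2 by auto. fold ph h. rewrite cutoff_near by (split; auto).
    ring_C. }
  split.
  { intros s Hs. assert (Hs' : Icc 0 s1' s) by (unfold Icc in *; lra).
    destruct (h_spec g J Cgg DPsi CJ PJ EJ s Hs') as [[A1 A2] _].
    fold ph in A1, A2. fold h in A1, A2.
    assert (A3 : L <= h s).
    { apply (h_ge g J Cgg Pg DPsi CJ PJ EJ); auto. unfold Icc; lra.
      change (ph L <= s). rewrite EL. apply Hs. }
    rewrite F2 by auto. fold ph h. rewrite cutoff_far by lra.
    ring_C. }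
  split; [exact EL|]. split.
  { assert (I0 : Icc 0 L' 0) by (unfold Icc; lra).
    assert (C0 := is_derive_on_continuous (V := RR) 0 L' ph 0 _ (ph_derive g J Cgg DPsi CJ PJ EJ 0 I0)).
    rewrite (ph_0 J : ph 0 = 0) in C0. intros Q HQ. generalize (C0 Q HQ).
    unfold filtermap, at_right, within. intros G.
    assert (G2 : locally 0 (fun y => y < L')) by (apply (open_lt L' 0); lra).
    generalize (filter_and _ _ G G2). apply filter_imp. intros y [A B] Hy. apply A.
    unfold Icc; lra. }
  split; [exact (Cg_continuous _ _ dp1)|].
  intros y H. split; [split|split; [|split]].
  - rewrite <- (ph_0 J : ph 0 = 0). apply (ph_lt g J Cgg Pg DPsi CJ PJ EJ); lra.
  - apply (ph_lt g J Cgg Pg DPsi CJ PJ EJ); lra.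
  - rewrite dp2 by (unfold Icc; lra). apply (is_derive_on_interior (V := RR) 0 L' ph y (dphih (rho l) g J y)); auto.
    apply (ph_derive g J Cgg DPsi CJ PJ EJ). unfold Icc; lra.
  - replace (Rpower (ph y) (rho l)) with (Psi y)
      by (symmetry; apply (phih_power (rho l) L' Psi (hrho l) J PJ EJ); unfold Icc; lra).
    unfold Psi. rewrite <- Rmult_assoc, sgn_sqr. ring.
  - assert (Hy : 0 < y <= L') by lra. rewrite <- (amp_identity g J Cgg Pg DPsi CJ PJ EJ ut EU y Hy).
    fold ph h. rewrite dp2 by (unfold Icc; lra).
    assert (B1 : 0 < ph y).
    { rewrite <- (ph_0 J : ph 0 = 0). apply (ph_lt g J Cgg Pg DPsi CJ PJ EJ); lra. }
    assert (B2 : ph y < s1') by (apply (ph_lt g J Cgg Pg DPsi CJ PJ EJ); lra).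
    rewrite F2 by (unfold Icc; lra). reflexivity.
Qed.
End Local.

(** * Repeated integration by parts *)

Section Parts.
Variables (sg rho w mu : R) (N : nat) (s1 : R) (F : nat -> R -> C).
Hypotheses (Hsg : sg = 1 \/ sg = -1) (Hrho : 1 <= rho) (Hw : 0 < w)
  (Hmu : 0 < mu <= 1) (HN : (1 <= N)%nat) (Hs1 : 0 < s1)
  (JF : jet (V := CR) N F)
  (F0 : forall n, (n < N)%nat -> F n s1 = RtoC 0).

(** Indexed by the power of z - s, so the kernel of order N is [phin (N - 1)]. With this prefactor
    each function is the derivative of the next, and [phin 0] is a primitive of the oscillating
    factor. *)
Definition phin (n : nat) (s : R) : C :=
  (RtoC ((-1) ^ S n / INR (fact n)) * Phi sg rho w n (mu - 1) s)%C.

Lemma is_derive_phin_0 (s : R) : 0 < s ->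
  is_derive (V := CR) (phin 0) s (osc sg rho w (mu - 1) (RtoC s)).
Proof.
  intros Hs. unfold phin. eapply is_derive_Ceq.
  apply is_derive_Cmult_l, is_derive_Phi_0; auto.
  simpl. replace (-1 * 1 / 1) with (-1) by field. ring.
Qed.

Lemma is_derive_phin_S (n : nat) (s : R) : 0 < s ->
  is_derive (V := CR) (phin (S n)) s (phin n s).
Proof.
  intros Hs. unfold phin. eapply is_derive_Ceq.
  apply is_derive_Cmult_l, is_derive_Phi_S; auto.
  rewrite fact_simpl, mult_INR.
  assert (H1 : INR (S n) <> 0) by (apply not_0_INR; lia).
  assert (H2 := INR_fact_neq_0 n).
  replace ((-1) ^ S (S n) / (INR (S n) * INR (fact n)))
    with (- ((-1) ^ S n / INR (fact n)) * / INR (S n)) by (simpl pow; field; auto).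
  rewrite RtoC_mult, RtoC_opp, RtoC_inv by auto. field.
  intros Z. apply RtoC_inj in Z. auto.
Qed.

Lemma phin_continuous (n : nat) (s : R) : 0 < s -> continuous (U := CR) (phin n) s.
Proof.
  intros Hs. apply (ex_derive_continuous (V := CR)). destruct n; eexists.
  apply is_derive_phin_0; auto. apply is_derive_phin_S; auto.
Qed.

Lemma phin_limit_0 (n : nat) :
  filterlim (phin n) (at_right 0) (locally (T := CR)
    (RtoC ((-1) ^ S n / INR (fact n)) * Phi_0 sg rho w n (mu - 1))%C).
Proof.
  apply (filterlim_Cmult (F := at_right 0)). apply filterlim_const.
  apply Phi_limit_0; auto. lra.
Qed.

Lemma F_at_right_0 (n : nat) : (n <= N)%nat ->
  filterlim (F n) (at_right 0) (locally (T := CR) (F n 0)).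
Proof.
  intros Hn. apply (continuous_at_right (V := CR)), (jet_continuous (V := CR) N F JF); auto.
Qed.

Definition partial (m : nat) (s : R) : C :=
  sum_n (G := C_AbelianMonoid) (fun n => (RtoC ((-1) ^ n) * (phin n s * F n s))%C) m.

Lemma partial_S (m : nat) (s : R) :
  partial (S m) s = (partial m s + RtoC ((-1) ^ S m) * (phin (S m) s * F (S m) s))%C.
Proof. unfold partial. rewrite sum_Sn. reflexivity. Qed.

(** The sum telescopes: differentiating the kernel in a new term cancels the remainder left by the
    previous ones, and differentiating [F] leaves the next remainder. *)
Lemma is_derive_partial (m : nat) (s : R) : 0 < s -> (m < N)%nat ->
  is_derive (V := CR) (partial m) s
    (osc sg rho w (mu - 1) (RtoC s) * F O s
     + RtoC ((-1) ^ m) * (phin m s * F (S m) s))%C.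
Proof.
  intros Hs. induction m; intros Hm.
  - apply (is_derive_ext (V := CR) (fun s => (phin 0 s * F O s)%C)).
    { intros t. unfold partial. rewrite sum_O. simpl.
      ring_C. }
    eapply is_derive_Ceq. apply is_derive_Cmult. apply is_derive_phin_0; auto.
    apply (jet_derive (V := CR) N F JF); auto. simpl. ring.
  - apply (is_derive_ext (V := CR)
      (fun s => (partial m s + RtoC ((-1) ^ S m) * (phin (S m) s * F (S m) s))%C)).
    { intros t. symmetry. apply partial_S. }
    eapply is_derive_Ceq. apply is_derive_Cplus. apply IHm; lia.
    apply is_derive_Cmult_l, is_derive_Cmult. apply is_derive_phin_S; auto.
    apply (jet_derive (V := CR) N F JF); auto.
    change ((-1) ^ S m) with (-1 * (-1) ^ m). rewrite !RtoC_mult. ring.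
Qed.

Lemma partial_s1 (m : nat) : (m < N)%nat -> partial m s1 = RtoC 0.
Proof.
  induction m; intros Hm.
  - unfold partial. rewrite sum_O, F0 by auto. ring.
  - rewrite partial_S, IHm, F0 by lia. ring.
Qed.

Definition partial_0 (m : nat) : C :=
  sum_n (G := C_AbelianMonoid) (fun n => (RtoC ((-1) ^ n) *
    (RtoC ((-1) ^ S n / INR (fact n)) * Phi_0 sg rho w n (mu - 1) * F n 0))%C) m.

Lemma partial_limit_0 (m : nat) : (m < N)%nat ->
  filterlim (partial m) (at_right 0) (locally (T := CR) (partial_0 m)).
Proof.
  assert (T : forall n, (n < N)%nat -> filterlim
    (fun s => (RtoC ((-1) ^ n) * (phin n s * F n s))%C) (at_right 0)
    (locally (T := CR) (RtoC ((-1) ^ n) *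
    (RtoC ((-1) ^ S n / INR (fact n)) * Phi_0 sg rho w n (mu - 1) * F n 0))%C)).
  { intros n Hn. apply (filterlim_Cmult (F := at_right 0)). apply filterlim_const.
    apply (filterlim_Cmult (F := at_right 0)). apply phin_limit_0.
    apply F_at_right_0. lia. }
  induction m; intros Hm.
  - unfold partial, partial_0. rewrite sum_O.
    apply (filterlim_ext (fun s => (RtoC ((-1) ^ 0) * (phin 0 s * F O s))%C)).
    { intros s. rewrite sum_O. reflexivity. } apply T; auto.
  - apply (filterlim_ext
      (fun s => (partial m s + RtoC ((-1) ^ S m) * (phin (S m) s * F (S m) s))%C)).
    { intros s. symmetry. apply partial_S. }
    unfold partial_0. rewrite sum_Sn.
    apply (filterlim_Cplus (F := at_right 0)). apply IHm; lia. apply T; auto.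
Qed.

Definition rem (s : R) : C := (phin (N - 1) s * F N s)%C.

Lemma rem_continuous (s : R) : 0 < s -> continuous (U := CR) rem s.
Proof.
  intros Hs. apply (filterlim_Cmult (F := locally s)). apply phin_continuous; auto.
  apply (jet_continuous (V := CR) N F JF); auto.
Qed.

Lemma phin_Cmod (n : nat) (s : R) : 0 < s ->
  Cmod (phin n s) <= / INR (fact n) *
    (Rpower s (mu - 1) * (/ rho * Gamma ((INR n + 1) / rho) * Rpower w (- ((INR n + 1) / rho)))).
Proof.
  intros Hs. unfold phin. rewrite Cmod_mult, Cmod_R.
  assert (Hf := INR_fact_lt_0 n).
  assert (Hi : 0 < / INR (fact n)) by (apply Rinv_0_lt_compat; auto).
  replace (Rabs ((-1) ^ S n / INR (fact n))) with (/ INR (fact n)).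
  - apply Rmult_le_compat_l. lra. apply Phi_Cmod; auto. lra.
  - unfold Rdiv. rewrite Rabs_mult, pow_1_abs, Rmult_1_l, Rabs_pos_eq; lra.
Qed.

Lemma F_bounded (n : nat) : (n <= N)%nat ->
  exists M, 0 <= M /\ forall s, 0 <= s <= s1 -> Cmod (F n s) <= M.
Proof.
  intros Hn.
  destruct (bounded_continuity (V := CR) (F n) 0 s1) as [M HM].
  { intros x _. apply (jet_continuous (V := CR) N F JF); auto. }
  exists M. split.
  - left. eapply Rle_lt_trans; [apply (norm_ge_0 (F n 0 : CR))|apply (HM 0); lra].
  - intros s Hs. rewrite <- norm_CR. left. apply HM; auto.
Qed.

(** [F N] is bounded on the compact interval, and s^e is integrable at 0 for e > -1. *)
Lemma ex_bound_integral (e : R) : -1 < e ->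
  ex_RInt_gen (V := RR) (fun s => Rpower s e * Cmod (F N s)) (at_right 0) (at_point s1).
Proof.
  intros He. destruct (F_bounded N (le_n N)) as [M [HM HF]].
  apply (ex_RInt_gen_dominated (V := RR) (fun s => 0 < s <= s1) _ (fun s => M * Rpower s e)).
  - intros x y z; lra.
  - generalize (filter_and _ _ (at_right_gt 0) (at_right_lt 0 s1 Hs1)).
    apply filter_imp; intros; lra.
  - unfold at_point; lra.
  - intros x Hx. apply continuous_Rmult. apply continuous_Rpower; lra.
    apply (continuous_ext (fun s => norm (F N s : CR))).
    { intros; apply norm_CR. }
    apply (continuous_comp (F N : R -> CR) (norm : CR -> R)).
    apply (jet_continuous (V := CR) N F JF); auto.
    apply (filterlim_norm (V := CR)).
  - intros x Hx. apply continuous_Rmult. apply continuous_const. apply continuous_Rpower; lra.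
  - intros x Hx. unfold norm; simpl; unfold abs; simpl.
    assert (P := Rpower_pos x e). assert (C := Cmod_ge_0 (F N x)).
    rewrite Rabs_pos_eq by (apply Rmult_le_pos; lra).
    rewrite Rmult_comm. apply Rmult_le_compat_r. lra. apply HF; lra.
  - eexists. apply (is_RInt_gen_scal (V := RR)). apply is_RInt_gen_Rpower_0; auto.
Qed.

Lemma ex_rem : ex_RInt_gen (V := CR) rem (at_right 0) (at_point s1).
Proof.
  assert (He : -1 < mu - 1) by lra.
  set (Cst := / INR (fact (N - 1)) * (/ rho * Gamma ((INR (N - 1) + 1) / rho)
    * Rpower w (- ((INR (N - 1) + 1) / rho)))).
  destruct (ex_bound_integral (mu - 1) He) as [lb Ib].
  apply (ex_RInt_gen_dominated (V := CR) (fun s => 0 < s <= s1) _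
    (fun s => Cst * (Rpower s (mu - 1) * Cmod (F N s)))).
  - intros x y z; lra.
  - generalize (filter_and _ _ (at_right_gt 0) (at_right_lt 0 s1 Hs1)).
    apply filter_imp; intros; lra.
  - unfold at_point; lra.
  - intros x Hx. apply rem_continuous; lra.
  - intros x Hx. apply continuous_Rmult. apply continuous_const.
    apply continuous_Rmult. apply continuous_Rpower; lra.
    apply (continuous_ext (fun s => norm (F N s : CR))).
    { intros; apply norm_CR. }
    apply (continuous_comp (F N : R -> CR) (norm : CR -> R)).
    apply (jet_continuous (V := CR) N F JF); auto.
    apply (filterlim_norm (V := CR)).
  - intros x Hx. rewrite norm_CR. unfold rem. rewrite Cmod_mult.
    rewrite <- Rmult_assoc. apply Rmult_le_compat_r. apply Cmod_ge_0.
    eapply Rle_trans; [apply phin_Cmod; lra|]. unfold Cst. lra.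
  - eexists. apply (is_RInt_gen_scal (V := RR)). exact Ib.
Qed.

(** A primitive of the whole oscillating integrand: boundary terms minus the integrated remainder.
    It is based at [s1], where the kernels are regular and the amplitude is flat, so only its limit
    at 0 contributes. *)
Definition Vprim (s : R) : C :=
  (partial (N - 1) s - RtoC ((-1) ^ (N - 1)) * RInt (V := CR) rem s1 s)%C.

Lemma is_derive_Vprim (s : R) : 0 < s ->
  is_derive (V := CR) Vprim s (osc sg rho w (mu - 1) (RtoC s) * F O s)%C.
Proof.
  intros Hs. unfold Vprim.
  assert (D : is_derive (V := CR) (fun s => RInt (V := CR) rem s1 s) s (rem s)).
  { apply (is_derive_RInt (V := CR)) with s1; [|apply rem_continuous; auto].
    apply (filter_imp (fun s => 0 < s)). 2: apply (open_gt 0 s Hs).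
    intros t Ht. apply (RInt_correct (V := CR)).
    apply (ex_RInt_convex (V := CR) (fun t => 0 < t)); auto. apply convex_gt.
    intros; apply rem_continuous; auto. }
  apply (is_derive_ext (V := CR) (fun s => (partial (N - 1) s
    + RtoC (- (-1) ^ (N - 1)) * RInt (V := CR) rem s1 s)%C)).
  { intros t. match goal with |- ?a = ?b => change (@eq C a b) end.
    rewrite RtoC_opp. ring. }
  eapply is_derive_Ceq. apply is_derive_Cplus. apply is_derive_partial; auto. lia.
  apply is_derive_Cmult_l. exact D.
  unfold rem. replace (S (N - 1)) with N by lia. rewrite RtoC_opp. ring.
Qed.

Lemma Vprim_s1 : Vprim s1 = RtoC 0.
Proof.
  unfold Vprim. rewrite partial_s1 by lia. rewrite RInt_point.
  change (@zero (CompleteNormedModule.AbelianMonoid R_AbsRing CR)) with (RtoC 0). ring.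
Qed.

Lemma Vprim_limit_0 (I : C) :
  is_RInt_gen (V := CR) rem (at_right 0) (at_point s1) I ->
  filterlim Vprim (at_right 0) (locally (T := CR)
    (partial_0 (N - 1) + RtoC ((-1) ^ (N - 1)) * I)%C).
Proof.
  intros HI.
  assert (Cr : forall x, 0 < x -> continuous (U := CR) rem x)
    by (intros; apply rem_continuous; auto).
  destruct (RInt_gen_limits (V := CR) (fun t => 0 < t) rem s1 (convex_gt 0) Hs1
    (at_right_gt 0) Hs1 Cr (ex_intro _ I HI)) as [[la La] _].
  (* [I] integrates from 0 to [s1], while [la] is the limit of the integrals from [s1] down to 0. *)
  assert (E : I = (RtoC 0 - la)%C).
  { rewrite <- (is_RInt_gen_unique (V := CR) rem I HI).
    apply (is_RInt_gen_unique (V := CR)).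
    apply (is_RInt_gen_primitive (V := CR) (fun t => 0 < t) _ (RInt (V := CR) rem s1)); auto.
    apply at_right_gt.
    - intros. apply (is_RInt_convex (V := CR) (fun t => 0 < t) rem s1 (convex_gt 0) Hs1 Cr); auto.
    - intros Q [d HQ]. apply HQ. rewrite RInt_point. apply (ball_center (M := CR)). }
  replace (partial_0 (N - 1) + RtoC ((-1) ^ (N - 1)) * I)%C
    with (partial_0 (N - 1) + (- RtoC ((-1) ^ (N - 1))) * la)%C by (rewrite E; ring).
  apply (filterlim_ext (fun s => (partial (N - 1) s
    + (- RtoC ((-1) ^ (N - 1))) * RInt (V := CR) rem s1 s)%C)).
  { intros t. match goal with |- ?a = ?b => change (@eq C a b) end. unfold Vprim. ring. }
  apply (filterlim_Cplus (F := at_right 0)). apply partial_limit_0; lia.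
  apply (filterlim_Cmult (F := at_right 0)). apply filterlim_const. exact La.
Qed.
End Parts.

Lemma Ck_on_jet {V : CompleteNormedModule R_AbsRing} (n : nat) (a b : R) (f : R -> V)
  (F : nat -> R -> V) : jet n F -> (forall x, Icc a b x -> f x = F O x) -> Ck_on n a b f.
Proof.
  intros J E. apply (Cg_Ck_on n a b f (F O)). apply jet_Cg; auto. intros; symmetry; auto.
Qed.

Lemma jet_zero {V : CompleteNormedModule R_AbsRing} (n : nat) : jet (V := V) n (fun _ _ => zero).
Proof.
  induction n; simpl. intros; apply continuous_const.
  split; auto. intros; apply (is_derive_const (V := V)).
Qed.

(** * The contribution of one endpoint *)

Section Endpoint.
Variables (p rho mu : endpoint -> R) (psi : R -> R) (U : R -> C).
Variables (eta : R) (nu : R -> R) (N : nat) (l : endpoint).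
Hypotheses
  (hN : (1 <= N)%nat) (hp : p Pt1 < p Pt2)
  (hrho : forall l, 1 <= rho l) (hmu : forall l, 0 < mu l <= 1)
  (heta : 0 < eta < (p Pt2 - p Pt1) / 2)
  (hnu1 : forall x, p Pt1 <= x <= p Pt1 + eta -> nu x = 1)
  (hnu0 : forall x, p Pt2 - eta <= x <= p Pt2 -> nu x = 0).
Variables (se s1' L2 : R) (ph dp : R -> R) (Kj Fj : nat -> R -> C).
Hypothesis LD : local_data p rho mu psi U eta nu N l se s1' L2 ph dp Kj Fj.

Let s1 := s_max p rho psi eta l.
Let sg := sgn l.

Lemma s1_pos : 0 < s1.
Proof. destruct LD as [H _]. unfold s1. lra. Qed.

Lemma Fj_jet : jet (V := CR) N Fj.
Proof. apply LD. Qed.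

Lemma k_Ck : Ck_on (V := CR) N 0 s1 (k p rho mu psi U eta l).
Proof.
  destruct LD as [_ [_ [[JK JF] [E _]]]].
  apply (Ck_on_jet (V := CR) N 0 s1 _ Kj); auto. intros; apply E; auto.
Qed.

Lemma nuk_Ck : Ck_on (V := CR) N 0 s1 (nuk p rho mu psi U eta nu l).
Proof.
  destruct LD as [_ [_ [[JK JF] [E _]]]].
  apply (Ck_on_jet (V := CR) N 0 s1 _ Fj); auto. intros; apply E; auto.
Qed.

Lemma DN_nuk_Fj (s : R) : Icc 0 s1 s -> DN_nuk p rho mu psi U eta nu l N s = Fj N s.
Proof.
  intros Hs. destruct LD as [_ [_ [[JK JF] [E _]]]].
  apply (jet_Derive_on_n (V := CR) N 0 s1 _ Fj s1_pos JF); auto. intros; apply E; auto.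
Qed.

(** The amplitude with and without cut-off agree on [0, se], hence so do their derivatives at 0;
    this is why the expansion coefficients do not depend on [nu]. *)
Lemma Dk_Fj (n : nat) : (n <= N)%nat ->
  Derive_on_n (V := CR) n 0 s1 (k p rho mu psi U eta l) 0 = Fj n 0.
Proof.
  intros Hn. assert (P := s1_pos).
  destruct LD as [S1 [_ [[JK JF] [E [EF _]]]]].
  rewrite (jet_Derive_on_n (V := CR) N 0 s1 (k p rho mu psi U eta l) Kj P JK); auto.
  - symmetry. apply (jet_unique (V := CR) N 0 se Fj Kj); auto. lra. unfold Icc; lra.
  - intros; apply E; auto.
  - unfold Icc; lra.
Qed.

(** The extended amplitude vanishes on [s1, s1'], an interval beginning at [s1]. This removes the
    boundary terms of the integrations by parts there. *)
Lemma Fj_flat (n : nat) : (n < N)%nat -> Fj n s1 = RtoC 0.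
Proof.
  intros Hn. assert (P := s1_pos).
  destruct LD as [S1 [_ [[JK JF] [E [EF [EZ _]]]]]].
  apply (jet_unique (V := CR) N s1 s1' Fj (fun _ _ => RtoC 0)); auto; try lia.
  - unfold s1; lra.
  - apply (jet_zero (V := CR)).
  - unfold s1, Icc; lra.
Qed.

Variable w : R.
Hypothesis Hw : 0 < w.

Let remn := rem sg (rho l) w (mu l) N Fj.

Lemma kernel_phin (s : R) : 0 < s ->
  kernel rho mu l N s w = phin sg (rho l) w (mu l) (N - 1) s.
Proof.
  intros Hs. rewrite kernel_Phi by auto. unfold phin.
  replace (S (N - 1)) with N by lia. reflexivity.
Qed.

Lemma R_integrand_rem (s : R) : 0 < s <= s1 ->
  R_integrand p rho mu psi U eta nu l N w s = remn s.
Proof.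
  intros Hs. unfold R_integrand, remn, rem. rewrite kernel_phin, DN_nuk_Fj; auto. 
  unfold Icc; lra. lra.
Qed.

Lemma at_right_Ioc : at_right 0 (fun s => 0 < s <= s1).
Proof.
  generalize (filter_and _ _ (at_right_gt 0) (at_right_lt 0 s1 s1_pos)).
  apply filter_imp; intros; lra.
Qed.

Lemma convex_Ioc : convex (fun s => 0 < s <= s1).
Proof. intros x y z; lra. Qed.

Lemma at_point_Ioc : at_point s1 (fun s => 0 < s <= s1).
Proof. assert (P := s1_pos). unfold at_point; lra. Qed.

Lemma ex_remn : ex_RInt_gen (V := CR) remn (at_right 0) (at_point s1).
Proof.
  apply ex_rem; auto. apply sgn_cases. apply s1_pos. apply Fj_jet.
Qed.

Lemma is_R_integral : is_RInt_gen (V := CR) (R_integrand p rho mu psi U eta nu l N w)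
  (at_right 0) (at_point s1) (RInt_gen (V := CR) remn (at_right 0) (at_point s1)).
Proof.
  apply (is_RInt_gen_ext_on (V := CR) (fun s => 0 < s <= s1) remn).
  apply convex_Ioc. apply at_right_Ioc. apply at_point_Ioc.
  intros; symmetry; apply R_integrand_rem; auto.
  apply (RInt_gen_correct (V := CR)), ex_remn.
Qed.

Lemma bound_integrand_Fj (e s : R) : 0 < s <= s1 ->
  bound_integrand p rho mu psi U eta nu l N e s = Rpower s e * Cmod (Fj N s).
Proof.
  intros Hs. unfold bound_integrand. rewrite rpow_pos_base, DN_nuk_Fj by (unfold Icc; lra).
  reflexivity.
Qed.

Lemma ex_bound (e : R) : -1 < e ->
  ex_RInt_gen (V := RR) (bound_integrand p rho mu psi U eta nu l N e) (at_right 0) (at_point s1).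
Proof.
  intros He.
  destruct (ex_bound_integral N s1 Fj s1_pos Fj_jet e He) as [I HI].
  exists I. revert HI.
  apply (is_RInt_gen_ext_on (V := RR) (fun s => 0 < s <= s1)).
  apply convex_Ioc. apply at_right_Ioc. apply at_point_Ioc.
  intros; symmetry; apply bound_integrand_Fj; auto.
Qed.

(** Both remainder estimates come from here, with e = mu - 1 for the first and e = -gamma for the
    refined one; the powers of [w] sit in [B]. *)
Lemma R_term_Cmod (e B : R) : -1 < e ->
  (forall s, 0 < s -> Cmod (kernel rho mu l N s w) <= B * Rpower s e) ->
  Cmod (R_term p rho mu psi U eta nu l N w)
  <= B * bound_integral p rho mu psi U eta nu l N e.
Proof.
  intros He HB. unfold R_term. fold s1.
  rewrite !Cmod_mult, Cmod_R, pow_1_abs. unfold phase at 1. rewrite Cmod_Cexp.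
  match goal with |- 1 * exp ?x * _ <= _ => replace x with 0 by (simpl; ring) end.
  rewrite exp_0, !Rmult_1_l.
  rewrite (is_RInt_gen_unique (V := CR) _ _ is_R_integral).
  apply (Cmod_RInt_gen_le (Fa := at_right 0) (Fb := at_point s1)
    (R_integrand p rho mu psi U eta nu l N w)
    (fun s => B * bound_integrand p rho mu psi U eta nu l N e s) (fun s => 0 < s <= s1)).
  - apply le_at_right_at_point, s1_pos.
  - apply convex_Ioc.
  - apply at_right_Ioc.
  - apply at_point_Ioc.
  - intros s Hs. rewrite bound_integrand_Fj by auto.
    unfold R_integrand. rewrite Cmod_mult, DN_nuk_Fj by (unfold Icc; lra).
    rewrite <- Rmult_assoc. apply Rmult_le_compat_r. apply Cmod_ge_0. apply HB. lra.
  - apply is_R_integral.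
  - apply (is_RInt_gen_scal (V := RR)). apply (RInt_gen_correct (V := RR)), ex_bound; auto.
Qed.

(** The limit of [Vprim] at 0, that is, minus the integral over (0, s1]. *)
Definition boundary_value : C := (partial_0 sg (rho l) w (mu l) Fj (N - 1)
  + RtoC ((-1) ^ (N - 1)) * RInt_gen (V := CR) remn (at_right 0) (at_point s1))%C.

Lemma A_term_partial_0 : A_term p rho mu psi U eta l N w =
  (- (RtoC sg * phase psi w (p l) * partial_0 sg (rho l) w (mu l) Fj (N - 1)))%C.
Proof.
  unfold A_term. fold s1.
  set (P := phase psi w (p l)).
  assert (E : forall m, (m < N)%nat ->
    (sum_n (G := C_AbelianMonoid) (fun n => Theta rho mu l n
       * Derive_on_n (V := CR) n 0 s1 (k p rho mu psi U eta l) 0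
       * RtoC (rpow w (- ((INR n + mu l) / rho l)))) m)%C
    = (- RtoC sg * partial_0 sg (rho l) w (mu l) Fj m)%C).
  { assert (T : forall n, (n < N)%nat ->
      (Theta rho mu l n * Derive_on_n (V := CR) n 0 s1 (k p rho mu psi U eta l) 0
       * RtoC (rpow w (- ((INR n + mu l) / rho l))))%C
      = (- RtoC sg * (RtoC ((-1) ^ n) *
    (RtoC ((-1) ^ S n / INR (fact n)) * Phi_0 sg (rho l) w n (mu l - 1) * Fj n 0)))%C).
    { intros n Hn. rewrite Dk_Fj by lia. rewrite rpow_pos_base by auto.
      unfold Theta, Phi_0, theta. fold sg. specialize (hrho l).
      replace (INR n + (mu l - 1) + 1) with (INR n + mu l) by ring.
      replace (sg * (PI / 2) * ((INR n + mu l) / rho l))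
        with (sg * (PI / (2 * rho l)) * (INR n + mu l)) by (field; lra).
      set (EE := Cexp _). set (Gm := Gamma _). set (W := Rpower w _).
      assert (Hf := INR_fact_neq_0 n).
      (* The sign (-1)^n of repeated integration by parts and the sign (-1)^(n+1) of the kernel
         leave -1, the sign of a lower boundary term. *)
      assert (Hs : (-1) ^ n * (-1) ^ n = 1).
      { rewrite <- Rpow_mult_distr. replace (-1 * -1) with 1 by ring. apply pow1. }
      replace (sg / (INR (fact n) * rho l) * Gm)
        with (- sg * ((-1) ^ n * ((-1) ^ S n / INR (fact n) * (/ rho l * Gm)))).
      2:{ simpl pow. transitivity (((-1) ^ n * (-1) ^ n) * (sg / (INR (fact n) * rho l) * Gm)).
          field. split; [lra|auto]. rewrite Hs; ring. }
      rewrite !RtoC_mult, !RtoC_opp. ring. }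
    induction m; intros Hm; unfold partial_0 in *.
    - rewrite !sum_O. apply T; auto.
    - rewrite !sum_Sn, IHm, T by lia.
      match goal with |- ?a = ?b => change (@eq C a b) end.
      change (@plus C_AbelianMonoid) with Cplus. ring. }
  rewrite E by lia. ring.
Qed.

Lemma AR_boundary_value : (A_term p rho mu psi U eta l N w + R_term p rho mu psi U eta nu l N w)%C
  = (- (RtoC sg * phase psi w (p l) * boundary_value))%C.
Proof.
  rewrite A_term_partial_0. unfold R_term, boundary_value. fold s1.
  rewrite (is_RInt_gen_unique (V := CR) _ _ is_R_integral).
  (* The parity N + 1 + l is that of (l + 1) + (N - 1) + 1: the orientation sign, the sign of the
     remainder, and the minus of the lower limit. *)
  replace ((-1) ^ (N + 1 + idx l)) with (- (sg * (-1) ^ (N - 1))).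
  2:{ unfold sg, sgn. replace (N + 1 + idx l)%nat with (S ((idx l + 1) + (N - 1)))%nat by lia.
      rewrite <- tech_pow_Rmult, (pow_add _ (idx l + 1)). ring. }
  rewrite RtoC_opp, RtoC_mult. ring.
Qed.

Definition Yprim (y : R) : C :=
  (RtoC sg * phase psi w (p l) * Vprim sg (rho l) w (mu l) N s1 Fj (ph y))%C.

Definition Ydens (y : R) : C :=
  (RtoC sg * phase psi w (p l)
   * (osc sg (rho l) w (mu l - 1) (RtoC (ph y)) * Fj O (ph y) * RtoC (dp y)))%C.

Lemma is_derive_Yprim (y : R) : 0 < y < L2 -> is_derive (V := CR) Yprim y (Ydens y).
Proof.
  intros Hy. destruct LD as [_ [_ [_ [_ [_ [_ [_ [_ [_ H]]]]]]]]].
  destruct (H y Hy) as [H1 [H2 _]].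
  unfold Yprim, Ydens. apply is_derive_Cmult_l.
  assert (DV := is_derive_Vprim sg (rho l) w (mu l) N s1 Fj (sgn_cases l) (hrho l) Hw
    hN s1_pos Fj_jet (ph y) (proj1 H1)).
  eapply is_derive_Ceq.
  - apply (is_derive_comp (V := CR) _ ph y _ _ DV H2).
  - etransitivity; [apply scal_CR|]. cbv beta. ring.
Qed.

(** With s = ph y the phase splits as psi x = psi (p l) + sgn l s^rho. The constant part is the
    prefactor and the other is the exponent in [osc]; the two signs [sgn l] cancel. *)
Lemma Ydens_eq (y : R) : 0 < y < L2 ->
  Ydens y = (RtoC (cutoff p nu l y) * U (pt p l y) * phase psi w (pt p l y))%C.
Proof.
  intros Hy. destruct LD as [_ [_ [_ [_ [_ [_ [_ [_ [_ H]]]]]]]]].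
  destruct (H y Hy) as [[H1 _] [_ [H3 H4]]].
  unfold Ydens, osc. rewrite !Cpowr_RtoC by auto.
  unfold phase at 2. rewrite H3.
  replace (Ci * RtoC (w * (psi (p l) + sgn l * Rpower (ph y) (rho l))))%C
    with (Ci * RtoC (w * psi (p l)) + RtoC sg * Ci * RtoC w * RtoC (Rpower (ph y) (rho l)))%C.
  2:{ rewrite Rmult_plus_distr_l, RtoC_plus, !RtoC_mult. unfold sg. ring. }
  rewrite Cexp_add. fold (phase psi w (p l)).
  set (X := Cexp _). set (P := phase psi w (p l)).
  transitivity (RtoC sg * P * X * (RtoC (Rpower (ph y) (mu l - 1)) * Fj O (ph y) * RtoC (dp y)))%C.
  ring. rewrite H4.
  assert (Hsg2 : (RtoC sg * RtoC (sgn l))%C = RtoC 1).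
  { rewrite <- RtoC_mult. unfold sg. rewrite sgn_sqr. reflexivity. }
  transitivity ((RtoC sg * RtoC (sgn l)) * (P * X * (RtoC (cutoff p nu l y) * U (pt p l y))))%C.
  ring. rewrite Hsg2. ring.
Qed.

Lemma Ydens_continuous (y : R) : 0 < y < L2 -> continuous (U := CR) Ydens y.
Proof.
  intros Hy. destruct LD as [_ [_ [_ [_ [_ [_ [_ [_ [Cd H]]]]]]]]].
  destruct (H y Hy) as [[H1 _] [H2 _]].
  assert (Cph : continuous ph y).
  { eapply (derive_continuous (V := R_NormedModule)), H2. }
  unfold Ydens. apply (filterlim_Cmult (F := locally y)). apply filterlim_const.
  apply (filterlim_Cmult (F := locally y)).
  - apply (filterlim_Cmult (F := locally y)).
    + apply (continuous_comp (V := R_UniformSpace) (W := CR) ph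
        (fun s => osc sg (rho l) w (mu l - 1) (RtoC s))); auto.
      eapply (derive_continuous (V := CR)), (is_derive_osc sg (rho l) w (mu l - 1) RtoC). 
      apply (is_derive_RtoC (fun s => s)), (is_derive_id (K := R_AbsRing)).
      unfold Crp. rewrite Cmod_R, Rabs_pos_eq; simpl; lra.
    + apply (continuous_comp (V := R_UniformSpace) (W := CR) ph (Fj O)); auto.
      apply (jet_continuous (V := CR) N Fj Fj_jet). lia.
  - apply (filterlim_RtoC (F := locally y)), Cd.
Qed.

Lemma Yprim_limit_0 : filterlim Yprim (at_right 0)
  (locally (T := CR) (RtoC sg * phase psi w (p l) * boundary_value)%C).
Proof.
  unfold Yprim. apply (filterlim_Cmult (F := at_right 0)). apply filterlim_const.
  destruct LD as [_ [[HL2 _] [_ [_ [_ [_ [_ [Hph [_ H]]]]]]]]].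
  assert (Lim := Vprim_limit_0 sg (rho l) w (mu l) N s1 Fj (sgn_cases l) (hrho l) Hw (hmu l)
    hN s1_pos Fj_jet _ (RInt_gen_correct (V := CR) remn ex_remn)).
  eapply filterlim_comp; [|exact Lim].
  intros Q [d HQ].
  generalize (proj1 (filterlim_locally _ _) Hph d). intros A.
  assert (L2p : 0 < L2) by lra.
  generalize (filter_and _ _ A (filter_and _ _ (at_right_gt 0) (at_right_lt 0 L2 L2p))).
  unfold filtermap. apply filter_imp. intros y [B1 [B2 B3]]. apply HQ; auto.
  apply (H y); lra.
Qed.

Let Lc := p Pt2 - p Pt1 - eta.

Lemma Yprim_L : Yprim Lc = RtoC 0.
Proof.
  unfold Yprim, Lc. destruct LD as [_ [_ [_ [_ [_ [_ [-> _]]]]]]]. fold s1.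
  rewrite (Vprim_s1 sg (rho l) w (mu l) N s1 Fj hN Fj_flat). ring.
Qed.

Definition piece (x : R) : C := (RtoC (cutoff p nu l (sg * (x - p l))) * U x * phase psi w x)%C.

Lemma sg_affine (x : R) : pt p l (sg * (x - p l)) = x.
Proof.
  unfold pt. rewrite <- Rmult_assoc. unfold sg. rewrite sgn_sqr. ring.
Qed.

Definition Xprim (x : R) : C := (RtoC sg * Yprim (sg * (x - p l)))%C.

Lemma is_derive_Xprim (x : R) : 0 < sg * (x - p l) < L2 ->
  is_derive (V := CR) Xprim x (Ydens (sg * (x - p l))).
Proof.
  intros Hx. unfold Xprim.
  assert (D1 : is_derive (fun x => sg * (x - p l)) x sg).
  { auto_derive; auto. ring. }
  eapply is_derive_Ceq.
  - apply is_derive_Cmult_l.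
    apply (is_derive_comp (V := CR) Yprim (fun x => sg * (x - p l)) x _ _
      (is_derive_Yprim _ Hx) D1).
  - assert (Hq : sg * sg = 1) by apply sgn_sqr.
    etransitivity; [apply f_equal, scal_CR|]. cbv beta.
    rewrite Cmult_assoc, <- RtoC_mult, Hq. ring.
Qed.

Lemma piece_Ydens (x : R) : 0 < sg * (x - p l) < L2 -> Ydens (sg * (x - p l)) = piece x.
Proof.
  intros Hx. rewrite Ydens_eq by auto. rewrite sg_affine. reflexivity.
Qed.

Lemma convex_side : convex (fun x => 0 < sg * (x - p l) < L2).
Proof.
  intros x y z. unfold sg. destruct l; rewrite ?sgn_Pt1, ?sgn_Pt2; lra.
Qed.

Lemma piece_integral (Fa Fb : (R -> Prop) -> Prop) (FFa : Filter Fa) (FFb : Filter Fb)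
  (la lb : C) :
  Fa (fun x => 0 < sg * (x - p l) < L2) -> Fb (fun x => 0 < sg * (x - p l) < L2) ->
  filterlim Xprim Fa (locally (T := CR) la) -> filterlim Xprim Fb (locally (T := CR) lb) ->
  is_RInt_gen (V := CR) piece Fa Fb (lb - la)%C.
Proof.
  intros Ha Hb La Lb.
  apply (is_RInt_gen_ext_on (V := CR) (fun x => 0 < sg * (x - p l) < L2)
    (fun x => Ydens (sg * (x - p l)))); auto.
  apply convex_side. intros; apply piece_Ydens; auto.
  apply (is_RInt_gen_primitive_derive (V := CR) (fun x => 0 < sg * (x - p l) < L2) _ Xprim); auto.
  apply convex_side. intros; apply is_derive_Xprim; auto.
  intros x Hx. apply (continuous_comp (V := R_UniformSpace) (W := CR)
    (fun x => sg * (x - p l)) Ydens).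
  - apply (ex_derive_continuous (V := R_NormedModule)). auto_derive; auto.
  - apply Ydens_continuous; auto.
Qed.

(** From distance [Lc] on the cut-off is 0, so a singularity of [U] at the far endpoint does not
    affect this piece. *)
Lemma piece_zero_integral (Fa Fb : (R -> Prop) -> Prop) (FFa : Filter Fa) (FFb : Filter Fb)
  (D : R -> Prop) : convex D -> Fa D -> Fb D -> (forall x, D x -> Lc <= sg * (x - p l) <= p Pt2 - p Pt1) ->
  is_RInt_gen (V := CR) piece Fa Fb (RtoC 0).
Proof.
  intros HD Ha Hb H.
  apply (is_RInt_gen_ext_on (V := CR) D (fun _ => RtoC 0)); auto.
  - intros x Hx. unfold piece. rewrite (cutoff_far p eta nu l hnu1 hnu0).
    ring_C. apply H; auto.
  - assert (I : is_RInt_gen (V := CR) (fun _ => RtoC 0) Fa Fb (RtoC 0 - RtoC 0)%C).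
    { apply (is_RInt_gen_primitive_derive (V := CR) D _ (fun _ => RtoC 0)); auto.
      + intros. apply is_derive_Cconst.
      + intros. apply filterlim_const.
      + apply filterlim_const.
      + apply filterlim_const. }
    replace (RtoC 0 - RtoC 0)%C with (RtoC 0) in I by ring. exact I.
Qed.
End Endpoint.

(** * The whole integral *)

Lemma at_left_lt (a b : R) : b < a -> at_left a (fun t => b < t < a).
Proof.
  intros. unfold at_left, within.
  apply (filter_imp (fun t => b < t)); auto. apply (open_gt b a H).
Qed.

Lemma at_right_Ioo (a b : R) : a < b -> at_right a (fun t => a < t < b).
Proof.
  intros. generalize (filter_and _ _ (at_right_gt a) (at_right_lt a b H)).
  apply filter_imp; auto.
Qed.

Definition side (p : endpoint -> R) (l : endpoint) : (R -> Prop) -> Prop :=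
  match l with Pt1 => at_right (p Pt1) | Pt2 => at_left (p Pt2) end.

Global Instance side_proper p l : ProperFilter (side p l).
Proof. destruct l; simpl; typeclasses eauto. Qed.

Lemma side_interval (p : endpoint -> R) (l : endpoint) (r : R) : 0 < r ->
  side p l (fun x => 0 < sgn l * (x - p l) < r).
Proof.
  intros Hr. destruct l; rewrite ?sgn_Pt1, ?sgn_Pt2; simpl.
  - apply (filter_imp (fun x => p Pt1 < x < p Pt1 + r)). intros; lra.
    apply at_right_Ioo; lra.
  - apply (filter_imp (fun x => p Pt2 - r < x < p Pt2)). intros; lra.
    apply at_left_lt; lra.
Qed.

Lemma side_distance (p : endpoint -> R) (l : endpoint) :
  filterlim (fun x => sgn l * (x - p l)) (side p l) (at_right 0).
Proof.
  intros Q [d HQ]. generalize (side_interval p l d (cond_pos d)).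
  unfold filtermap. apply filter_imp. intros x Hx. apply HQ; [|lra].
  change (Rabs (sgn l * (x - p l) - 0) < d). rewrite Rminus_0_r, Rabs_pos_eq; lra.
Qed.

Section Total.
Variables (p rho mu : endpoint -> R) (psi : R -> R) (U : R -> C).
Variables (eta : R) (nu : R -> R) (N : nat).
Hypotheses
  (hN : (1 <= N)%nat) (hp : p Pt1 < p Pt2)
  (hrho : forall l, 1 <= rho l) (hmu : forall l, 0 < mu l <= 1)
  (heta : 0 < eta < (p Pt2 - p Pt1) / 2)
  (hnu1 : forall x, p Pt1 <= x <= p Pt1 + eta -> nu x = 1)
  (hnu0 : forall x, p Pt2 - eta <= x <= p Pt2 -> nu x = 0).
Variable w : R.
Hypothesis Hw : 0 < w.

Let AR l := (A_term p rho mu psi U eta l N w + R_term p rho mu psi U eta nu l N w)%C.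

(** The integral runs from [p l] to the other endpoint, so for [Pt2] it is oriented backwards; this
    is the factor [sgn l]. On the first part the primitive vanishes at the splitting point, and only
    its limit at [p l] remains. *)
Lemma piece_total (l : endpoint) se s1' L2 ph dp Kj Fj :
  local_data p rho mu psi U eta nu N l se s1' L2 ph dp Kj Fj ->
  is_RInt_gen (V := CR) (piece p psi U nu l w) (side p l) (side p (other l))
    (RtoC (sgn l) * AR l)%C.
Proof.
  (* [c] lies at distance [d] from [p l]; from there to the other endpoint the cut-off is 0. *)
  intros LD. set (d := p Pt2 - p Pt1 - eta). set (c := p l + sgn l * d).
  assert (HL2 : d < L2) by apply LD.
  assert (Hd : 0 < d) by (unfold d; lra).
  assert (Hc : sgn l * (c - p l) = d).
  { unfold c. transitivity ((sgn l * sgn l) * d). ring. rewrite sgn_sqr. ring. }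
  replace (RtoC (sgn l) * AR l)%C with (RtoC (sgn l) * AR l + RtoC 0)%C by ring.
  apply (is_RInt_gen_Chasles (V := CR) _ c).
  - unfold AR. rewrite (AR_boundary_value p rho mu psi U eta nu N l hN hrho hmu _ _ _ _ _ _ _ LD w Hw).
    set (v := (RtoC (sgn l) * phase psi w (p l) * _)%C).
    replace (RtoC (sgn l) * - v)%C with (RtoC 0 - RtoC (sgn l) * v)%C by ring.
    eapply piece_integral; eauto; try typeclasses eauto.
    + apply side_interval. lra.
    + unfold at_point. rewrite Hc. lra.
    + apply (filterlim_Cmult (F := side p l)). apply filterlim_const.
      eapply filterlim_comp; [apply side_distance|eapply Yprim_limit_0; eauto].
    + intros Q HQ. unfold filtermap, at_point.
      unfold Xprim. rewrite Hc. erewrite Yprim_L; eauto.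
      rewrite Cmult_0_r. apply (locally_singleton (T := CR)); auto.
  - apply (piece_zero_integral p psi U eta nu l hnu1 hnu0 w _ _ _ _
      (fun x => d <= sgn l * (x - p l) <= p Pt2 - p Pt1)); auto.
    + intros x y z. destruct l; rewrite ?sgn_Pt1, ?sgn_Pt2; lra.
    + unfold at_point. rewrite Hc. unfold d; lra.
    + generalize (side_interval p (other l) eta (proj1 heta)). apply filter_imp.
      intros x. unfold d. destruct l; simpl; rewrite ?sgn_Pt1, ?sgn_Pt2; lra.
Qed.

Lemma piece_Pt1 se s1' L2 ph dp Kj Fj :
  local_data p rho mu psi U eta nu N Pt1 se s1' L2 ph dp Kj Fj ->
  is_RInt_gen (V := CR) (piece p psi U nu Pt1 w) (at_right (p Pt1)) (at_left (p Pt2)) (AR Pt1).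
Proof.
  intros LD. assert (I := piece_total Pt1 _ _ _ _ _ _ _ LD).
  rewrite sgn_Pt1, Cmult_1_l in I. exact I.
Qed.

Lemma piece_Pt2 se s1' L2 ph dp Kj Fj :
  local_data p rho mu psi U eta nu N Pt2 se s1' L2 ph dp Kj Fj ->
  is_RInt_gen (V := CR) (piece p psi U nu Pt2 w) (at_right (p Pt1)) (at_left (p Pt2)) (AR Pt2).
Proof.
  intros LD. assert (I := piece_total Pt2 _ _ _ _ _ _ _ LD).
  apply (is_RInt_gen_swap (V := CR)) in I; try typeclasses eauto.
  replace (AR Pt2) with (opp (RtoC (sgn Pt2) * AR Pt2 : CR)%C). exact I.
  change (- (RtoC (sgn Pt2) * AR Pt2) = AR Pt2)%C. rewrite sgn_Pt2. ring.
Qed.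

Lemma R_term_first (l : endpoint) se s1' L2 ph dp Kj Fj :
  local_data p rho mu psi U eta nu N l se s1' L2 ph dp Kj Fj ->
  Cmod (R_term p rho mu psi U eta nu l N w)
     <= / INR (fact (N - 1)) * / rho l * Gamma (INR N / rho l)
        * bound_integral p rho mu psi U eta nu l N (mu l - 1)
        * rpow w (- (INR N / rho l)).
Proof.
  intros LD. rewrite rpow_pos_base by auto.
  set (b := bound_integral _ _ _ _ _ _ _ _ _ _).
  replace (/ INR (fact (N - 1)) * / rho l * Gamma (INR N / rho l) * b
     * Rpower w (- (INR N / rho l)))
    with ((/ INR (fact (N - 1)) * (/ rho l * Gamma (INR N / rho l) * Rpower w (- (INR N / rho l)))) * b)
    by ring.
  assert (Hm := hmu l).
  eapply R_term_Cmod; eauto. lra.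
  intros s Hs. rewrite kernel_Cmod by auto. rewrite Rmult_assoc.
  apply Rmult_le_compat_l. left; apply Rinv_0_lt_compat, INR_fact_lt_0.
  rewrite Rmult_comm. rewrite <- (INR_pred N hN) at 1 2.
  apply Phi_Cmod; auto. apply sgn_cases. lra.
Qed.

Lemma R_term_refined (j : endpoint) (ga K : R) se s1' L2 ph dp Kj Fj :
  local_data p rho mu psi U eta nu N j se s1' L2 ph dp Kj Fj ->
  mu j = 1 -> 2 <= rho j -> 0 < ga < 1 -> K_root (rho j) N K ->
  Cmod (R_term p rho mu psi U eta nu j N w)
     <= L_cst ga (rho j) N K * bound_integral p rho mu psi U eta nu j N (- ga)
        * rpow w (- ((ga + INR N) / rho j)).
Proof.
  intros LD Hmj Hrj Hga HK. rewrite rpow_pos_base by auto.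
  rewrite Rmult_assoc, (Rmult_comm (bound_integral _ _ _ _ _ _ _ _ _ _)), <- Rmult_assoc.
  eapply R_term_Cmod; eauto. lra.
  intros s Hs. rewrite kernel_Cmod by auto. rewrite Hmj, Rminus_diag.
  rewrite Rmult_assoc, (Rmult_comm (Rpower w _)), <- Rmult_assoc.
  apply Phi_refined; auto. apply sgn_cases.
Qed.
End Total.

Theorem theorem1p7
  (p rho mu : endpoint -> R) (psi : R -> R) (U : R -> C)
  (eta : R) (nu : R -> R) (N : nat) (j : endpoint)
  (hN : (1 <= N)%nat)
  (hp : p Pt1 < p Pt2)
  (hrho : forall l, 1 <= rho l)
  (hmu : forall l, 0 < mu l <= 1)
  (hmuj : mu j = 1) (hrhoj : 2 <= rho j)
  (hpsi : assumption_P p rho N psi)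
  (hU : assumption_A p mu N U)
  (heta : 0 < eta < (p Pt2 - p Pt1) / 2)
  (hnu_smooth : forall n,
     Ck_on (V := R_CompleteNormedModule) n (p Pt1) (p Pt2) nu)
  (hnu1 : forall x, p Pt1 <= x <= p Pt1 + eta -> nu x = 1)
  (hnu0 : forall x, p Pt2 - eta <= x <= p Pt2 -> nu x = 0)
  (hnu01 : forall x, p Pt1 <= x <= p Pt2 -> 0 <= nu x <= 1) :
  (* the derivatives and integrals in the statement make sense *)
  (forall l,
     Ck_on (V := CR) N 0 (s_max p rho psi eta l) (k p rho mu psi U eta l) /\
     Ck_on (V := CR) N 0 (s_max p rho psi eta l)
       (nuk p rho mu psi U eta nu l)) /\
  (forall l omega s, 0 < omega -> 0 < s ->
     ex_RInt_gen (V := CR)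
       (ray_form rho l s (kernel_integrand rho mu l (N - 1) s omega))
       (at_point 0) (Rbar_locally p_infty)) /\
  (forall l omega, 0 < omega ->
     ex_RInt_gen (V := CR) (R_integrand p rho mu psi U eta nu l N omega)
       (at_right 0) (at_point (s_max p rho psi eta l))) /\
  (forall l e, -1 < e ->
     ex_RInt_gen (V := R_CompleteNormedModule)
       (bound_integrand p rho mu psi U eta nu l N e)
       (at_right 0) (at_point (s_max p rho psi eta l))) /\
  (* asymptotic expansion with remainder *)
  (forall omega, 0 < omega ->
     is_RInt_gen (V := CR) (fun x => (U x * phase psi omega x)%C)
       (at_right (p Pt1)) (at_left (p Pt2))
       ((A_term p rho mu psi U eta Pt1 N omega
         + R_term p rho mu psi U eta nu Pt1 N omega)
        + (A_term p rho mu psi U eta Pt2 N omega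
           + R_term p rho mu psi U eta nu Pt2 N omega))%C) /\
  (* first remainder estimate *)
  (forall l omega, 0 < omega ->
     Cmod (R_term p rho mu psi U eta nu l N omega)
     <= / INR (fact (N - 1)) * / rho l * Gamma (INR N / rho l)
        * bound_integral p rho mu psi U eta nu l N (mu l - 1)
        * rpow omega (- (INR N / rho l))) /\
  (* refined remainder estimate *)
  (exists K : R, unique (K_root (rho j) N) K /\
   forall gamma, 0 < gamma < 1 ->
     let delta := (gamma + INR N) / rho j in
     INR N / rho j < delta < (INR N + 1) / rho j /\
     forall omega, 0 < omega ->
       Cmod (R_term p rho mu psi U eta nu j N omega)
       <= L_cst gamma (rho j) N K
          * bound_integral p rho mu psi U eta nu j N (- gamma)
          * rpow omega (- delta)).
Proof.
  assert (LD : forall l, exists se s1' L2 ph dp Kj Fj,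
    local_data p rho mu psi U eta nu N l se s1' L2 ph dp Kj Fj).
  { intros l. apply local_structure; auto. }
  split; [|split; [|split; [|split; [|split; [|split]]]]].
  - intros l. destruct (LD l) as (se & s1' & L2 & ph & dp & Kj & Fj & H).
    split; [eapply k_Ck|eapply nuk_Ck]; exact H.
  - intros l w s Hw Hs. eexists. apply is_ray_integral; auto.
  - intros l w Hw. destruct (LD l) as (se & s1' & L2 & ph & dp & Kj & Fj & H).
    eexists. eapply is_R_integral; eauto.
  - intros l e He. destruct (LD l) as (se & s1' & L2 & ph & dp & Kj & Fj & H).
    eapply ex_bound; eauto.
  - intros w Hw.
    destruct (LD Pt1) as (se & s1' & L2 & ph & dp & Kj & Fj & H1).
    destruct (LD Pt2) as (se' & s1'' & L2' & ph' & dp' & Kj' & Fj' & H2).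
    apply (is_RInt_gen_ext_on (V := CR) (fun _ => True) (fun x =>
      (piece p psi U nu Pt1 w x + piece p psi U nu Pt2 w x)%C)).
    + intros x y z; auto.
    + apply filter_true.
    + apply filter_true.
    (* The two cut-offs are nu and 1 - nu, evaluated at the same point [x]. *)
    + intros x _. unfold piece, cutoff. rewrite !sg_affine, RtoC_minus. ring_C.
    + apply (is_RInt_gen_Cplus (Fa := at_right (p Pt1)) (Fb := at_left (p Pt2))).
      eapply piece_Pt1; eauto. eapply piece_Pt2; eauto.
  - intros l w Hw. destruct (LD l) as (se & s1' & L2 & ph & dp & Kj & Fj & H).
    eapply R_term_first; eauto.
  - destruct (root_unique (a_cst (rho j) N) (b_cst (rho j) N) (c_cst (rho j) N) (rho j)) as [K HK].
    { apply a_cst_pos; auto. }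
    { left. apply b_cst_pos; auto. }
    (* Here rho j >= 2 gives rho j > 1; at rho = 1 the constant term would be 0. *)
    { apply c_cst_pos; auto. lra. }
    { auto. }
    exists K. split; [exact HK|]. intros ga Hga. simpl. split.
    + assert (Hr : 0 < / rho j) by (apply Rinv_0_lt_compat; lra).
      unfold Rdiv. split; apply Rmult_lt_compat_r; lra.
    + intros w Hw. destruct (LD j) as (se & s1' & L2 & ph & dp & Kj & Fj & H).
      eapply R_term_refined; eauto. exact (proj1 HK).
Qed.
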